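(* Let $T_1,\ldots,T_m$ be non-singular linear maps on $\mathbb{R}^N$ with $\|T_i\|<1$ for all $i=1,\ldots,m$. Let $\mu$ be a (non-zero) finite Borel measure on $I_\infty$, and let $\mu^\omega$ be the random measure obtained as the image of $\mu$ under $\Pi^\omega$, where $\omega=\{\omega_{\mathbf i}:\mathbf i\in I\}$ is a family of independent identically distributed random vectors with bounded density in a bounded region $D\subset\mathbb{R}^N$. Let $q>1$. Then for almost all $\omega$, $$\underline{D}_q(\mu^\omega)=\min\{d_q^-(T_1,\ldots,T_m;\mu),\,N\},$$ where $$d_q^-(T_1,\ldots,T_m;\mu)=\sup\Big\{s:\sum_{k=0}^\infty\sum_{\mathbf i\in I_k}\phi^s(T_{\mathbf i})^{1-q}\mu(C_{\mathbf i})^q<\infty\Big\}.$$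
   Context: Singular value function: for a non-singular linear contraction $T$ of $\mathbb{R}^N$ let $\alpha_1(T)\ge\cdots\ge\alpha_N(T)>0$ be its singular values. For $0<s\le N$ put $\phi^s(T)=\alpha_1\alpha_2\cdots\alpha_{j-1}\alpha_j^{s-j+1}$, where $j$ is the integer with $j-1<s\le j$; for $s>N$ put $\phi^s(T)=(\alpha_1\cdots\alpha_N)^{s/N}$. Code space: $I_k=\{1,\ldots,m\}^k$ ($I_0=\{\emptyset\}$), $I=\bigcup_{k\ge0}I_k$, $I_\infty=\{1,\ldots,m\}^{\mathbb N}$ with its product topology. For $\mathbf i=(i_1,\ldots,i_k)\in I_k$, $T_{\mathbf i}=T_{i_1}\cdots T_{i_k}$ ($T_\emptyset$ is the identity, $\phi^s(T_\emptyset)=1$), and $C_{\mathbf i}\subset I_\infty$ is the cylinder of infinite words beginning with $\mathbf i$. Projection: given $\omega=\{\omega_{\mathbf i}:\mathbf i\in I\}$ with $\omega_{\mathbf i}\in D$, for $\mathbf i=(i_1,i_2,\ldots)\in I_\infty$ set $$\Pi^\omega(\mathbf i)=\omega_{i_1}+T_{i_1}\omega_{i_1,i_2}+T_{i_1}T_{i_2}\omega_{i_1,i_2,i_3}+\cdots .$$ The almost self-affine set is $E^\omega=\Pi^\omega(I_\infty)$ and $\mu^\omega(A)=\mu\{\mathbf i:\Pi^\omega(\mathbf i)\in A\}$, a measure supported by $E^\omega$. Random model: $D\subset\mathbb{R}^N$ is a bounded region and the $\omega_{\mathbf i}\in D$ ($\mathbf i\in I$) are independent identically distributed random vectors whose common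 law is absolutely continuous with respect to $N$-dimensional Lebesgue measure with bounded density; ''almost all $\omega$'' refers to the product probability measure. Generalised dimension: for a finite non-zero Borel measure $\tau$ of bounded support, $q>1$ and $r>0$, let $M_r(q)=\sum_C\tau(C)^q$, the sum over all $r$-mesh cubes $C=[j_1r,(j_1+1)r)\times\cdots\times[j_Nr,(j_N+1)r)$, $j_1,\ldots,j_N\in\mathbb Z$, with $\tau(C)>0$. Then $\underline{D}_q(\tau)=\liminf_{r\to0}\frac{\log M_r(q)}{(q-1)\log r}$. Convention: the supremum defining $d_q^-$ is over $s>0$, and is $0$ if the set is empty. *)

(* Defs.v *)
From HB Require Import structures.
From mathcomp Require Import all_boot all_order all_algebra finmap.
From mathcomp Require Import polyrcf.
From mathcomp Require Import all_classical all_reals all_analysis.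

Set Implicit Arguments.
Unset Strict Implicit.
Unset Printing Implicit Defensive.

Import Order.TTheory GRing.Theory Num.Theory.
Import numFieldNormedType.Exports.

Local Open Scope classical_set_scope.
Local Open Scope ring_scope.

(* R^n is 'cV[R]_n, with linear maps acting as A *m x.                       *)

(* The sigma-algebra on column vectors is generated by the coordinates, as   *)
(* for n.-tuple T in the library; over R it is the Borel sigma-algebra.      *)
Definition measure_cV_display : measure_display -> measure_display.
Proof. exact. Qed.

Section measurable_cV.
Context {d} {T : sigmaRingType d}.
Variable n : nat.

Let coord : 'I_n -> 'cV[T]_n -> T := fun i v => v i ord0.

Let cV_set0 : g_sigma_preimage coord set0.
Proof. exact: sigma_algebra0. Qed.

Let cV_setC A : g_sigma_preimage coord A -> g_sigma_preimage coord (~` A).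
Proof. exact: sigma_algebraC. Qed.

Let cV_bigcup (F : (set 'cV[T]_n)^nat) :
  (forall i, g_sigma_preimage coord (F i)) ->
  g_sigma_preimage coord (\bigcup_i (F i)).
Proof. exact: sigma_algebra_bigcup. Qed.

HB.instance Definition _ := @isMeasurable.Build (measure_cV_display d)
  'cV[T]_n (g_sigma_preimage coord) cV_set0 cV_setC cV_bigcup.

End measurable_cV.

Section measurable_fun_cV.
Context d1 d2 (T1 : measurableType d1) (T2 : measurableType d2).

Lemma measurable_cV_coord n (i : 'I_n) :
  measurable_fun [set: 'cV[T2]_n] (fun v => v i ord0).
Proof.
move=> _ Y mY; rewrite setTI; apply: sub_sigma_algebra => /=.
rewrite -bigcup_seq/=; exists i => /=; first by rewrite mem_index_enum.
by exists Y => //; rewrite setTI.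
Qed.

Lemma measurable_fun_cV n (f : T1 -> 'cV[T2]_n) :
  (forall i, measurable_fun [set: T1] (fun x => f x i ord0)) ->
  measurable_fun [set: T1] f.
Proof.
move=> mf.
suff h : g_sigma_preimage (fun i x => f x i ord0) `<=` @measurable _ T1.
  move=> _ A mA; apply: h.
  rewrite (_ : (fun i x => f x i ord0) =
    (fun i => (fun v : 'cV[T2]_n => v i ord0) \o f))//.
  by rewrite g_sigma_preimage_comp; exists A.
apply: smallest_sub; first exact: sigma_algebra_measurable.
rewrite -bigcup_seq; apply: bigcup_sub => i _ _ [B mB <-].
exact: mf.
Qed.

End measurable_fun_cV.

Section lebesgue_cV.
Context {R : realType}.

Definition cV_cons n (p : R * 'cV[R]_n) : 'cV[R]_n.+1 :=
  \col_i (if unlift ord0 i is Some j then p.2 j ord0 else p.1).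

Lemma measurable_cV_cons n : measurable_fun setT (@cV_cons n).
Proof.
apply: measurable_fun_cV => i.
under eq_fun do rewrite mxE.
case: (unlift ord0 i) => [j|]; last exact: measurable_fst.
by apply: (measurableT_comp (measurable_cV_coord j)); exact: measurable_snd.
Qed.

Definition cV_uncons n (v : 'cV[R]_n.+1) : R * 'cV[R]_n :=
  (v ord0 ord0, \col_j v (lift ord0 j) ord0).

Lemma cV_consK n : cancel (@cV_cons n) (@cV_uncons n).
Proof.
move=> [x v]; rewrite /cV_uncons mxE unlift_none; congr pair.
by apply/matrixP => i j; rewrite !mxE liftK [j]ord1.
Qed.

Lemma measurable_cV_uncons n : measurable_fun setT (@cV_uncons n).
Proof.
apply/measurable_fun_pairP; split.
  exact: (measurable_cV_coord (T2 := R) ord0).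
apply: measurable_fun_cV => i.
rewrite (_ : (fun _ => _) = fun v : 'cV[R]_n.+1 => v (lift ord0 i) ord0).
  exact: measurable_cV_coord.
by apply/funext => v; rewrite /= mxE.
Qed.

Section step.
Variables (n : nat) (mu : {sigma_finite_measure set 'cV[R]_n -> \bar R}).

Definition lebesgue_cV_step : set 'cV[R]_n.+1 -> \bar R :=
  pushforward (@lebesgue_measure R \x mu)%E (@cV_cons n).

Let m0 : lebesgue_cV_step set0 = 0%E.
Proof. by rewrite /lebesgue_cV_step /pushforward preimage_set0 measure0. Qed.

Let m_ge0 A : (0 <= lebesgue_cV_step A)%E.
Proof. by rewrite /lebesgue_cV_step /pushforward measure_ge0. Qed.

Let m_additive : semi_sigma_additive lebesgue_cV_step.
Proof.
rewrite /lebesgue_cV_step; apply: measure_semi_sigma_additive.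
exact: measurable_cV_cons.
Qed.

HB.instance Definition _ :=
  isMeasure.Build _ _ _ lebesgue_cV_step m0 m_ge0 m_additive.

Let sigma_finite_step : sigma_finite setT lebesgue_cV_step.
Proof.
have /sigma_finiteP[F [TF ndF Foo]] := sigma_finiteT (@lebesgue_measure R).
have /sigma_finiteP[G [TG ndG Goo]] := sigma_finiteT mu.
exists (fun k => @cV_uncons n @^-1` (F k `*` G k)).
  rewrite -preimage_bigcup (_ : \bigcup_k _ = setT) ?preimage_setT//.
  rewrite -subTset => -[x v] _.
  have [k _ Fkx] : (\bigcup_k F k) x by rewrite -TF.
  have [l _ Glv] : (\bigcup_k G k) v by rewrite -TG.
  exists (maxn k l) => //; split => /=.
  - by move: x Fkx; exact/subsetPset/ndF/leq_maxl.
  - by move: v Glv; exact/subsetPset/ndG/leq_maxr.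
move=> k; have [mF Fk] := Foo k; have [mG Gk] := Goo k; split.
  rewrite -[X in measurable X]setTI; apply: measurable_cV_uncons => //.
  exact: measurableX.
rewrite /lebesgue_cV_step /pushforward -comp_preimage.
rewrite (_ : _ \o _ = id) ?preimage_id; last first.
  by apply/funext => p /=; rewrite cV_consK.
by rewrite product_measure1E// lte_mul_pinfty// ge0_fin_numE.
Qed.

HB.instance Definition _ :=
  Measure_isSigmaFinite.Build _ _ _ lebesgue_cV_step sigma_finite_step.

End step.

Fixpoint lebesgue_cV n : {sigma_finite_measure set 'cV[R]_n -> \bar R} :=
  if n is n'.+1 then lebesgue_cV_step (lebesgue_cV n')
  else @dirac _ 'cV[R]_0 0 R.

Lemma lebesgue_cV_box n (A : 'I_n -> set R) :
  (forall i, measurable (A i)) ->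
  lebesgue_cV n [set v | forall i, A i (v i ord0)] =
  (\prod_(i < n) lebesgue_measure (A i))%E.
Proof.
elim: n A => [|n IHn] A mA /=.
  by rewrite big_ord0 diracE mem_set// => -[].
have mbox : measurable [set v : 'cV[R]_n | forall i, A (lift ord0 i) (v i ord0)].
  rewrite (_ : mkset _ = \bigcap_(i in [set: 'I_n])
    ((fun v : 'cV[R]_n => v i ord0) @^-1` A (lift ord0 i))); last first.
    by apply/seteqP; split => v Av i //=; exact: Av.
  apply: fin_bigcap_measurable => // i _.
  by rewrite -[X in measurable X]setTI; exact: measurable_cV_coord.
rewrite big_ord_recl -IHn//.
rewrite -(product_measure1E (@lebesgue_measure R) (lebesgue_cV n))//; last exact: (mA ord0).
rewrite /lebesgue_cV_step /pushforward; congr (product_measure1 _ _ _).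
apply/seteqP; split => -[x v] /=.
- move=> Av; split => [|i]; first by have := Av ord0; rewrite mxE unlift_none.
  by have := Av (lift ord0 i); rewrite mxE liftK.
- move=> [Ax Av] i; rewrite mxE.
  by case: unliftP => [j ->|->//]; exact: Av.
Qed.

End lebesgue_cV.

Section euclidean.
Context {R : realType}.

Definition enorm n (x : 'cV[R]_n) : R := Num.sqrt (\sum_i x i ord0 ^+ 2).

Definition opnorm n (A : 'M[R]_n) : R :=
  sup [set enorm (A *m x) | x in [set x | enorm x <= 1]].

(* The square roots of the eigenvalues of A^T A, each repeated according to  *)
(* its multiplicity, in non-increasing order.                                *)
Definition singular_values n (A : 'M[R]_n) : seq R :=
  let p := char_poly (A^T *m A) in
  sort >=%R (flatten [seq nseq (mup x p) (Num.sqrt x) | x <- rootsR p]).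

(* The singular values are indexed from 0 here, so that alpha_l is           *)
(* (singular_values A)`_(l - 1).                                             *)
Definition phi n (s : R) (A : 'M[R]_n) : R :=
  let alpha := singular_values A in
  if s <= n%:R then
    let j := `|Num.ceil s|%N in
    (\prod_(l < j.-1) alpha`_l) * alpha`_j.-1 `^ (s - j%:R + 1)
  else (\prod_(l < n) alpha`_l) `^ (s / n%:R).

Definition mesh_cube n (r : R) (j : 'cV[int]_n) : set 'cV[R]_n :=
  [set x | forall i,
    (j i ord0)%:~R * r <= x i ord0 < (j i ord0 + 1)%:~R * r].

Definition mesh_moment n (tau : set 'cV[R]_n -> \bar R) (q r : R) : \bar R :=
  (\esum_(j in [set j : 'cV[int]_n | 0 < tau (mesh_cube r j)])
     tau (mesh_cube r j) `^ q)%E.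

Definition lower_dim n (tau : set 'cV[R]_n -> \bar R) (q : R) : \bar R :=
  limf_einf (fun r : R =>
    lne (mesh_moment tau q r) * (((q - 1) * ln r)^-1)%:E)%E 0^'+.

Definition has_bounded_density n (nu : set 'cV[R]_n -> \bar R) :=
  exists f : 'cV[R]_n -> R, exists c : R,
    [/\ measurable_fun setT f, forall x, 0 <= f x <= c &
      forall A, measurable A ->
        nu A = (\int[lebesgue_cV n]_(x in A) (f x)%:E)%E].

End euclidean.

Definition mutually_independent d d' (Om : measurableType d)
    (V : measurableType d') (R : realType) (P : probability Om R)
    (I : choiceType) (X : I -> Om -> V) :=
  forall (J : {fset I}) (A : I -> set V), (forall i, measurable (A i)) ->
    P (\bigcap_(i in [set` J]) (X i @^-1` A i)) =
    (\prod_(i <- J) P (X i @^-1` A i))%E.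

HB.instance Definition _ n := isPointed.Build 'I_n.+1 ord0.

(* The alphabet is 'I_m.+1: it has m.+1 letters, because the code space must *)
(* be inhabited to be a measurableType.                                      *)
Section code.
Variable m : nat.

Definition code := prod_topology (fun _ : nat => discrete_topology 'I_m.+1).

Definition borel_code := g_sigma_algebraType (@open code).

Definition prefix_word (x : nat -> 'I_m.+1) (k : nat) : seq 'I_m.+1 := mkseq x k.

Definition cylinder (i : seq 'I_m.+1) : set borel_code :=
  [set x | prefix_word x (size i) = i].

End code.

Section self_affine.
Context {R : realType} {N m : nat}.
Variable T : 'I_m.+1 -> 'M[R]_N.

Definition word_map (i : seq 'I_m.+1) : 'M[R]_N :=
  \big[mulmx/1%:M]_(a <- i) T a.

Definition projection (omega : seq 'I_m.+1 -> 'cV[R]_N) (x : borel_code m) :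
    'cV[R]_N :=
  limn (series (fun k =>
    word_map (prefix_word x k) *m omega (prefix_word x k.+1))).

Definition image_measure (mu : set (borel_code m) -> \bar R)
    (omega : seq 'I_m.+1 -> 'cV[R]_N) : set 'cV[R]_N -> \bar R :=
  pushforward mu (projection omega).

(* The maximum with 0 encodes the convention that the supremum of the empty  *)
(* set of exponents s > 0 is 0.                                              *)
Definition d_minus (mu : set (borel_code m) -> \bar R) (q : R) : \bar R :=
  maxe 0%E (ereal_sup [set s%:E | s in [set s : R | 0 < s /\
    (\sum_(0 <= k <oo) \sum_(i : k.-tuple 'I_m.+1)
       (phi s (word_map i) `^ (1 - q))%:E * mu (cylinder i) `^ q < +oo)%E]]).

End self_affine.

(* Main.v *)
Require Import Defs.
From mathcomp Require Import all_boot all_order all_algebra finmap.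
From mathcomp Require Import perm polyrcf complex ring lra.
From mathcomp Require Import all_classical all_reals all_analysis.
From mathcomp Require Import measurable_realfun.

(** Write [mu_i] for the mass of the cylinder of a finite word [i], [T_i] for
    the linear map of that word and [M_r] for the sum of the [q]-th powers of the
    masses of the mesh cubes of side [r].

    The dimension is at most the minimum for every bounded choice of the random
    vectors.  The image of the cylinder of [i] is contained in an ellipsoid with
    the singular values of [T_i] as semi-axes, up to a common factor.  If [r] is
    comparable with the singular value at which the product [phi s T_i] stops,
    this ellipsoid meets about [phi s T_i / r^s] mesh cubes of side [r]
    ([cover_image], [prod_sv_le_phi]), so that by convexity the cylinder
    contributes at least about [(phi s T_i / r^s)^(1-q) * mu_i^q] to [M_r]
    ([mesh_moment_ge]).  When [M_r <= r^(s'(q-1))] for small [r] and [s < s'], the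
    terms of the series of [d_minus] for the words of length [k] and of scale [r]
    therefore add up to at most a constant times [r^((s'-s)(q-1))].  Over the
    dyadic scales, all of which are at most about [a^k] for a common contraction
    ratio [a], these bounds sum to a geometric sequence in [k]
    ([level_sum_bound]).  The empty word alone yields the bound by [N], since the
    whole set meets about [r^(-N)] cubes.

    The dimension is almost surely at least the minimum.  Let [s < t] be such
    that the series of [d_minus] converges at [t].  A mesh cube containing the
    point of a word [x] has a mass bounded by that of a ball of comparable radius
    around this point ([mesh_moment_le]), so it is enough to bound the
    expectation of the integral of the [p]-th power of the mass of such balls,
    where [p = q - 1].  A ball around the point of [x] is cut according to the
    length [k] of the common prefix with [x].  The position of the point of [x]
    relatively to all words that leave [x] at length [k] depends on the random
    vector of the prefix of length [k + 1] of [x], which none of these words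
    uses.  Given the other vectors, the probability that two such points are
    within [rho] is that of a vector of bounded density falling into an
    ellipsoid, at most a constant times [rho^s / phi s T_(x|k)]
    ([ellipsoid_probability]).  For [p <= 1] this first moment bounds the moment
    of order [p].  For [p > 1] the power [p] is the mass times its power [p - 1],
    and the latter is at most the mass of the ball of twice the radius around
    another word, which the resampled vector does not move; this lowers [p] by
    one ([expect_ball_moment]).  The result is [rho^(s p)] times the integral of
    the [p]-th power of a weight that dominates [mu_(x|k) / phi s T_(x|k)], up to
    a factor that decays geometrically in [k] and comes from the slack between
    [s] and [t].  The integral of this weight is bounded by the series of
    [d_minus] at [t] ([sum_weight_le]).  Markov's inequality and the
    Borel-Cantelli lemma along dyadic radii conclude ([ae_lower_dim_ge]).

    Two devices keep the lower bound elementary.  The vectors are rounded to the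
    points of a mesh whose side is less than the radius of the ball, and words
    are cut at a length at which the remainder is at most comparable with this
    radius; the probability is then a
    finite sum over independent choices of cells ([mass_of_sample]) and
    resampling a vector is a permutation of that sum ([expect_resample]).  The
    preimage of a ball under a linear map is covered by small cubes with sides
    parallel to the axes ([cover_preimage]), so that Lebesgue measure enters only
    through the volume of such cubes. *)

Import Order.TTheory GRing.Theory Num.Theory.
Import numFieldNormedType.Exports.
Local Open Scope classical_set_scope.
Local Open Scope ring_scope.
Set Implicit Arguments.
Unset Strict Implicit.
Unset Printing Implicit Defensive.

(** * Power sums *)

Lemma geometric_sum_le (R : realType) (t : R) n : 0 <= t < 1 ->
  \sum_(k < n) t ^+ k <= (1 - t)^-1.
Proof.
move=> /andP[t0 t1].
have t10 : 0 < 1 - t by rewrite subr_gt0.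
rewrite -[leRHS]mul1r ler_pdivlMr// mulrC -opprB mulNr -subrX1 opprB.
by rewrite lerBlDr lerDl exprn_ge0.
Qed.

Lemma powR_powRV (R : realType) (x p : R) : 0 <= x -> 0 < p ->
  (x `^ p^-1) `^ p = x.
Proof. by move=> x0 p0; rewrite -powRrM mulVf ?gt_eqF// powRr1. Qed.

Lemma powRV_powR (R : realType) (x p : R) : 0 <= x -> 0 < p ->
  (x `^ p) `^ p^-1 = x.
Proof. by move=> x0 p0; rewrite -powRrM divff ?gt_eqF// powRr1. Qed.

Definition power_sum_const (R : realType) (p t : R) : R :=
  ((1 - t `^ p^-1)^-1) `^ p.

Lemma power_sum_const_ge0 (R : realType) (p t : R) :
  0 <= power_sum_const p t.
Proof. exact: powR_ge0. Qed.

(** Each [a k] is at most [t ^ (k / p)] times the [p]-th root of the weighted sum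
    on the right, since one term is at most the sum; it remains to add a
    geometric series.  One argument thus serves for [p <= 1] and [p > 1]. *)
Lemma powR_sum_le (R : realType) (p t : R) n (a : nat -> R) :
  0 < p -> 0 < t < 1 -> (forall k, 0 <= a k) ->
  (\sum_(k < n) a k) `^ p <=
    power_sum_const p t * \sum_(k < n) (t ^+ k)^-1 * a k `^ p.
Proof.
move=> p0 /andP[t0 t1] a0.
set S := \sum_(k < n) _ * _.
have S0 : 0 <= S.
  apply: sumr_ge0 => k _.
  by rewrite mulr_ge0 ?powR_ge0// invr_ge0 exprn_ge0// ltW.
set u := t `^ p^-1.
have u0 : 0 <= u by exact: powR_ge0.
have u1 : u < 1.
  have := @gt0_ltr_powR R p^-1 _ t 1.
  by rewrite powR1 !nnegrE invr_gt0; apply => //; exact: ltW.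
have ak (k : 'I_n) : a k <= u ^+ k * S `^ p^-1.
  have tk : 0 < t ^+ k by rewrite exprn_gt0.
  have -> : u ^+ k = (t ^+ k) `^ p^-1.
    by rewrite -(powR_mulrn _ (powR_ge0 _ _)) -(powR_mulrn _ (ltW t0)) -!powRrM mulrC.
  rewrite -[leLHS](powRV_powR (a0 k) p0).
  rewrite -powRM ?(ltW tk)//.
  apply: ge0_ler_powR; rewrite ?nnegrE ?invr_ge0 ?powR_ge0 ?(ltW p0)//.
    by rewrite mulr_ge0// ltW.
  rewrite -ler_pdivrMl// /S (bigD1 k)//= lerDl sumr_ge0// => j _.
  by rewrite mulr_ge0 ?powR_ge0// invr_ge0 exprn_ge0// ltW.
have -> : power_sum_const p t * S = ((1 - u)^-1 * S `^ p^-1) `^ p.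
  rewrite powRM ?powR_ge0//; last by rewrite invr_ge0 subr_ge0 ltW.
  by rewrite powR_powRV.
apply: ge0_ler_powR; rewrite ?nnegrE ?(ltW p0)//.
- exact: sumr_ge0.
- by rewrite mulr_ge0 ?powR_ge0// invr_ge0 subr_ge0 ltW.
apply: (@le_trans _ _ (\sum_(k < n) u ^+ k * S `^ p^-1)); first exact: ler_sum.
rewrite -mulr_suml ler_wpM2r ?powR_ge0//.
by rewrite geometric_sum_le// u0 u1.
Qed.

(** * Finite product probability spaces *)

Section finite_product.
Context {R : realType} (W S : finType) (p : S -> R).
Hypothesis p_ge0 : forall t, 0 <= p t.
Hypothesis p_sum1 : \sum_t p t = 1.

Definition expect (F : {ffun W -> S} -> R) : R :=
  \sum_(s : {ffun W -> S}) (\prod_w p (s w)) * F s.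

Definition update (s : {ffun W -> S}) (x : W) (t : S) : {ffun W -> S} :=
  [ffun w => if w == x then t else s w].

Lemma prod_weight_ge0 (s : {ffun W -> S}) : 0 <= \prod_w p (s w).
Proof. exact: prodr_ge0. Qed.

Lemma le_expect (F G : {ffun W -> S} -> R) :
  (forall s, F s <= G s) -> expect F <= expect G.
Proof.
by move=> FG; apply: ler_sum => s _; rewrite ler_wpM2l ?prod_weight_ge0.
Qed.

Lemma eq_expect (F G : {ffun W -> S} -> R) :
  (forall s, F s = G s) -> expect F = expect G.
Proof. by move=> FG; apply: eq_bigr => s _; rewrite FG. Qed.

Lemma expectZ c (F : {ffun W -> S} -> R) :
  expect (fun s => c * F s) = c * expect F.
Proof. by rewrite /expect mulr_sumr; apply: eq_bigr => s _; rewrite mulrCA. Qed.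

Lemma expect_sum (I : finType) (P : pred I) (F : I -> {ffun W -> S} -> R) :
  expect (fun s => \sum_(i | P i) F i s) = \sum_(i | P i) expect (F i).
Proof.
rewrite exchange_big/=; apply: eq_bigr => s _.
by rewrite mulr_sumr.
Qed.

Lemma expectD (F G : {ffun W -> S} -> R) :
  expect (fun s => F s + G s) = expect F + expect G.
Proof.
by rewrite -big_split/=; apply: eq_bigr => s _; rewrite mulrDr.
Qed.

Lemma expect_cst c : expect (fun=> c) = c.
Proof.
rewrite /expect -mulr_suml -(bigA_distr_bigA (fun _ t => p t))/=.
by rewrite big1 ?mul1r// => i _.
Qed.

Lemma expect_ge0 (F : {ffun W -> S} -> R) :
  (forall s, 0 <= F s) -> 0 <= expect F.
Proof. by move=> F0; rewrite -(expect_cst 0); exact: le_expect. Qed.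

(** Exchanging the value of the coordinate [x] with an independent copy is an
    involution of [{ffun W -> S} * S] that preserves the product weight. *)
Lemma expect_resample (x : W) (F : {ffun W -> S} -> R) :
  expect F = expect (fun s => \sum_t p t * F (update s x t)).
Proof.
rewrite /expect.
under [RHS]eq_bigr do rewrite mulr_sumr.
rewrite pair_bigA/=.
pose h (st : {ffun W -> S} * S) := (update st.1 x st.2, st.1 x).
have hK : involutive h.
  move=> [s t]; rewrite /h/=; congr pair; last by rewrite ffunE eqxx.
  by apply/ffunP => w; rewrite !ffunE; case: eqP => [->|].
rewrite [RHS](reindex_inj (inv_inj hK))/=.
under [RHS]eq_bigr => st _.
  have -> : update (update st.1 x st.2) x (st.1 x) = st.1.
    by apply/ffunP => w; rewrite !ffunE; case: eqP => [->|].
  have -> : (\prod_w p (update st.1 x st.2 w)) * (p (st.1 x) * F st.1) =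
            (\prod_w p (st.1 w)) * F st.1 * p st.2.
    rewrite (bigD1 x)//= [in RHS](bigD1 x)//= ffunE eqxx.
    rewrite (eq_bigr (fun w => p (st.1 w))); first ring.
    by move=> w /negPf wx; rewrite ffunE wx.
  over.
rewrite -(pair_bigA _ (fun (s : {ffun W -> S}) t => (\prod_w p (s w)) * F s * p t))/=.
by apply: eq_bigr => s _; rewrite -mulr_sumr p_sum1 mulr1.
Qed.

End finite_product.

(** * The moment estimate on a random finite tree *)

(** The recursion is on the integer [m] with [m < p <= m + 1].  The outer factors
    come from the summation over the lengths of the common prefix, the first
    summand of [A] from the resampling step and the second one from the leaves. *)
Fixpoint moment_const (R : realType) (s c th : R) (m : nat) (p : R) : R :=
  if m is m'.+1 then
    let A := c * (moment_const s c th m' (p - 1) * 2 `^ (s * (p - 1))) + c `^ p in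
    power_sum_const p (th `^ 2^-1) * A * (1 - th `^ 2^-1)^-1
  else
    power_sum_const p (th `^ (p / 2)) * (2 * c `^ p) * (1 - th `^ (p / 2))^-1.

Lemma ler_sum_subpred (R : numDomainType) (I : finType) (P Q : pred I)
    (F : I -> R) : (forall i, P i -> Q i) -> (forall i, Q i -> 0 <= F i) ->
  \sum_(i | P i) F i <= \sum_(i | Q i) F i.
Proof.
move=> PQ F0; rewrite [leLHS]big_mkcond [leRHS]big_mkcond; apply: ler_sum => i _.
case: ifPn => [/PQ ->//|_]; case: ifPn => // Qi; exact: F0.
Qed.

Lemma powR_predr (R : realType) (t p : R) : 0 <= t -> 0 < p ->
  t `^ p = t `^ (p - 1) * t.
Proof.
move=> t0 p0; rewrite -[X in _ = _ * X](powRr1 t0) -powRD; last first.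
  by rewrite subrK (gt_eqF p0).
by rewrite subrK.
Qed.

(** The leaves of a tree of depth [n] are placed at random: [dist sg] is their
    distance when the independent choices are [sg], and [idx w k] is the choice
    attached to the prefix of [w] of length [k.+1].  In the application [h w k] is
    the inverse of the singular value function at the prefix of [w] of length
    [k], [G] is the weight that dominates the ratios [prefix_mass k w * h w k],
    and [rho0] is the scale below which points are not resolved. *)
Section random_tree.
Context {R : realType} (W S L : finType) (pr : S -> R) (n : nat).
Hypothesis pr_ge0 : forall t, 0 <= pr t.
Hypothesis pr_sum1 : \sum_t pr t = 1.
Variables (mass : n.-tuple L -> R) (G : n.-tuple L -> R).
Variable dist : {ffun W -> S} -> n.-tuple L -> n.-tuple L -> R.
Variable idx : n.-tuple L -> nat -> W.
Variable h : n.-tuple L -> nat -> R.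
Variables (s c th rho0 : R).

Local Notation E := (expect pr).
Local Notation "v ~[ k ] w" := (take k (tval v) == take k (tval w))
  (at level 70, format "v  ~[ k ]  w").

Definition split_at k (v w : n.-tuple L) := (v ~[k] w) && ~~ (v ~[k.+1] w).

Definition prefix_mass k (w : n.-tuple L) := \sum_(v | v ~[k] w) mass v.

Hypothesis mass_ge0 : forall w, 0 <= mass w.
Hypothesis G_ge0 : forall w, 0 <= G w.
Hypothesis h_gt0 : forall w k, 0 < h w k.
Hypothesis h_prefix : forall v w k, v ~[k] w -> h v k = h w k.
Hypothesis s_ge0 : 0 <= s.
Hypothesis c_ge0 : 0 <= c.
Hypothesis th01 : 0 < th < 1.
Hypothesis rho0_gt0 : 0 < rho0.
Hypothesis dist_triangle : forall sg u v w,
  dist sg v w <= dist sg u v + dist sg u w.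
Hypothesis dist_indep : forall sg w v v' k t, (k < n)%N ->
  split_at k v w -> split_at k v' w ->
  dist (update sg (idx w k) t) v v' = dist sg v v'.
Hypothesis dist_prob : forall sg w v k rho, (k < n)%N -> split_at k v w ->
  rho0 <= rho ->
  \sum_t pr t * (dist (update sg (idx w k) t) w v <= rho)%R%:R
    <= c * rho `^ s * h w k.
Hypothesis G_prefix : forall w k, (k < n)%N ->
  prefix_mass k w * h w k <= th ^+ k * G w.
Hypothesis G_leaf : forall w, mass w <= c * rho0 `^ s * (th ^+ n * G w).

Definition ball_mass i rho sg (w : n.-tuple L) :=
  \sum_(v | (v ~[i] w) && (dist sg w v <= rho)) mass v.

(** The words of the ball that leave [w] exactly at level [k].  Level [n] stands
    for [w] itself, which lies in the ball whatever its radius. *)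
Definition ring_mass k rho sg (w : n.-tuple L) :=
  if (k < n)%N then \sum_(v | split_at k v w && (dist sg w v <= rho)) mass v
  else mass w.

Lemma ball_mass_ge0 i rho sg w : 0 <= ball_mass i rho sg w.
Proof. exact: sumr_ge0. Qed.

Lemma ring_mass_ge0 i rho sg w : 0 <= ring_mass i rho sg w.
Proof. by rewrite /ring_mass; case: ifP => // _; exact: sumr_ge0. Qed.

Lemma prefixS k (v w : n.-tuple L) : v ~[k.+1] w -> v ~[k] w.
Proof.
move=> /eqP vw; apply/eqP.
by rewrite -(take_takel (tval v) (leqnSn k)) vw take_takel.
Qed.

Lemma prefix_le i k (v w : n.-tuple L) : (i <= k)%N -> v ~[k] w -> v ~[i] w.
Proof.
move=> ik /eqP vw; apply/eqP.
by rewrite -(take_takel (tval v) ik) vw take_takel.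
Qed.

Lemma prefix_full k (v w : n.-tuple L) : (n <= k)%N -> v ~[k] w -> v = w.
Proof.
by move=> nk /eqP; rewrite !take_oversize ?size_tuple// => /val_inj.
Qed.

(** The words in the ball are sorted by the length of their common prefix with
    [w].  The range of the sum is independent of [i], as [sum_levels] applies the
    same power sum inequality for all [i]. *)
Lemma ball_mass_split i rho sg w : (i <= n)%N ->
  ball_mass i rho sg w <= \sum_(k < n.+1) (i <= k)%N%:R * ring_mass k rho sg w.
Proof.
have [d] := ubnP (n - i)%N; elim: d i => // d IH i.
rewrite ltnS => nid; rewrite leq_eqVlt => /predU1P[->|ilt].
  rewrite (bigD1 ord_max)//= leqnn mul1r {1}/ring_mass ltnn.
  apply: (@le_trans _ _ (mass w)); last first.
    by rewrite lerDl sumr_ge0// => k _; rewrite mulr_ge0// ring_mass_ge0.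
  rewrite -[leRHS](big_pred1_eq +%R w mass) /ball_mass.
  by apply: ler_sum_subpred => // v /andP[/prefix_full -> //=].
have -> : ball_mass i rho sg w = ring_mass i rho sg w + ball_mass i.+1 rho sg w.
  rewrite /ball_mass (bigID (fun v => v ~[i.+1] w))/= addrC /ring_mass ilt.
  congr (_ + _); apply: eq_bigl => v.
    by rewrite /split_at -andbA (andbC (_ <= _)) andbA.
  rewrite andbAC; congr (_ && _); apply/andb_idl; exact: prefixS.
have ilt' : (i < n.+1)%N by rewrite ltnW// ltnS.
rewrite (bigD1 (Ordinal ilt'))//= leqnn mul1r lerD2l.
apply: le_trans (IH i.+1 _ ilt) _.
  by rewrite (leq_trans _ nid)// -subSn// subSS leq_sub2l.
rewrite (bigD1 (Ordinal ilt'))//= ltnn mul0r add0r.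
apply: ler_sum => k ki; rewrite ler_wpM2r ?ring_mass_ge0// ler_nat.
by case: (ltnP i k) => [/ltnW ->|].
Qed.

Definition total i (w0 : n.-tuple L) p := \sum_(w | w ~[i] w0) mass w * G w `^ p.

Lemma total_ge0 i w0 p : 0 <= total i w0 p.
Proof. by apply: sumr_ge0 => w _; rewrite mulr_ge0 ?powR_ge0. Qed.

(** The power of a sum over levels costs a factor [(u ^+ k)^-1] at level [k]
    ([powR_sum_le]); half of the decay [u ^+ 2] pays for it and the other half
    makes the sum over the levels converge. *)
Lemma sum_levels p u A i w0 rho : 0 < p -> 0 < u < 1 -> 0 <= A -> (i <= n)%N ->
  (forall k, (i <= k <= n)%N ->
    E (fun sg => \sum_(w | w ~[i] w0) mass w * ring_mass k rho sg w `^ p)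
      <= A * rho `^ (s * p) * (u ^+ 2) ^+ k * total i w0 p) ->
  E (fun sg => \sum_(w | w ~[i] w0) mass w * ball_mass i rho sg w `^ p)
    <= power_sum_const p u * A * (1 - u)^-1 * rho `^ (s * p) * total i w0 p.
Proof.
move=> p0 /andP[u0 u1] A0 iN H.
set K := power_sum_const p u.
have K0 : 0 <= K by exact: power_sum_const_ge0.
pose F k sg := (i <= k)%N%:R *
  \sum_(w | w ~[i] w0) mass w * ring_mass k rho sg w `^ p.
apply: (@le_trans _ _ (E (fun sg => K * \sum_(k < n.+1) (u ^+ k)^-1 * F k sg))).
  apply: le_expect => // sg.
  have -> : K * \sum_(k < n.+1) (u ^+ k)^-1 * F k sg =
      \sum_(w | w ~[i] w0) mass w * (K * \sum_(k < n.+1)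
        (u ^+ k)^-1 * ((i <= k)%N%:R * ring_mass k rho sg w) `^ p).
    under eq_bigr do rewrite /F !mulr_sumr.
    rewrite exchange_big mulr_sumr/=; apply: eq_bigr => w _.
    rewrite mulrCA; congr (_ * _); rewrite mulr_sumr; apply: eq_bigr => k _.
    rewrite powRM ?ring_mass_ge0//.
    have -> : ((i <= k)%N%:R : R) `^ p = (i <= k)%N%:R.
      by case: (i <= k)%N; rewrite ?powR1 ?powR0 ?gt_eqF.
    by ring.
  apply: ler_sum => w _; rewrite ler_wpM2l//.
  apply: (@le_trans _ _ ((\sum_(k < n.+1) (i <= k)%N%:R * ring_mass k rho sg w) `^ p)).
    apply: ge0_ler_powR; rewrite ?nnegrE ?(ltW p0) ?ball_mass_ge0//.
      by apply: sumr_ge0 => k _; rewrite mulr_ge0 ?ring_mass_ge0.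
    exact: ball_mass_split.
  apply: (@powR_sum_le _ p u n.+1 (fun k => (i <= k)%N%:R * ring_mass k rho sg w)).
  - by [].
  - by rewrite u0 u1.
  - by move=> k; rewrite mulr_ge0 ?ring_mass_ge0.
rewrite expectZ expect_sum -!mulrA ler_wpM2l//.
apply: (@le_trans _ _ (\sum_(k < n.+1) u ^+ k * (A * (rho `^ (s * p) * total i w0 p)))).
  apply: ler_sum => k _; rewrite expectZ ler_pdivrMl ?exprn_gt0//.
  rewrite /F expectZ; case: (leqP i k) => ik; last first.
    by rewrite mul0r !mulr_ge0 ?powR_ge0 ?total_ge0 ?exprn_ge0// ltW.
  rewrite mul1r; apply: le_trans (H k _) _; first by rewrite ik -ltnS ltn_ord.
  by rewrite -exprM mulnC exprM expr2 le_eqVlt; apply/orP; left; apply/eqP; ring.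
rewrite -mulr_suml [leRHS]mulrCA ler_wpM2r//.
  by rewrite !mulr_ge0 ?powR_ge0 ?total_ge0.
by rewrite geometric_sum_le// u1 ltW.
Qed.

(** Only the coordinate indexed by the prefix of [w] of length [k.+1] is
    resampled: it moves [w] but none of the words that leave [w] at level [k],
    so that what depends on these words alone factors out of the expectation. *)
Lemma expect_dist w v k rho (Y : {ffun W -> S} -> R) : (k < n)%N ->
  split_at k v w -> rho0 <= rho -> (forall sg, 0 <= Y sg) ->
  (forall sg t, Y (update sg (idx w k) t) = Y sg) ->
  E (fun sg => (dist sg w v <= rho)%R%:R * Y sg) <= c * rho `^ s * h w k * E Y.
Proof.
move=> kn vw rhor Y0 YE.
rewrite (expect_resample pr_sum1 (idx w k)) -expectZ.
apply: le_expect => // sg.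
under eq_bigr do rewrite YE mulrA.
by rewrite -mulr_suml ler_wpM2r// dist_prob.
Qed.

(** The decay is [th ^ p] but it is only used as [th ^ e] for some [e <= p], to
    match the decay obtained on the other levels. *)
Lemma leaf_level p e i w0 rho : 0 < p -> 0 <= e -> e <= p -> rho0 <= rho ->
  E (fun sg => \sum_(w | w ~[i] w0) mass w * ring_mass n rho sg w `^ p)
      <= c `^ p * rho `^ (s * p) * (th `^ e) ^+ n * total i w0 p.
Proof.
move=> p0 e0 ep rhor; have /andP[th0 th1] := th01.
have rho_ge0 : 0 <= rho by rewrite (le_trans _ rhor)// ltW.
rewrite (@eq_expect _ _ _ _ _ (fun=> \sum_(w | w ~[i] w0) mass w * mass w `^ p)).
  2: by move=> sg; apply: eq_bigr => w _; rewrite /ring_mass ltnn.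
rewrite expect_cst// mulr_sumr; apply: ler_sum => w _.
rewrite mulrCA ler_wpM2l//.
have := G_leaf w; move/(@ge0_ler_powR _ p (ltW p0)) => H.
apply: le_trans (H _ _) _; rewrite ?nnegrE ?mulr_ge0 ?powR_ge0 ?exprn_ge0 ?(ltW th0)//.
have thn : 0 <= th ^+ n by rewrite exprn_ge0// ltW.
rewrite !powRM ?mulr_ge0 ?powR_ge0// mulrA ler_wpM2r ?powR_ge0//.
rewrite ler_pM ?mulr_ge0 ?powR_ge0// ?ler_wpM2l ?powR_ge0//.
  rewrite -powRrM; apply: ge0_ler_powR; rewrite ?nnegrE// ?mulr_ge0// ?(ltW p0)//.
  exact: ltW.
rewrite -(powR_mulrn _ (ltW th0)) -(powR_mulrn _ (powR_ge0 _ _)) -!powRrM.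
rewrite ger_powR ?th0 ?(ltW th1)// mulrC.
  by rewrite ler_wpM2l.
Qed.

(** With [l] a bound of the mean of [t], this bounds the mean of [t `^ p] by
    [2 * l `^ p]; it replaces Jensen's inequality for the concave power. *)
Lemma powR_le_threshold (t l p : R) : 0 <= t -> 0 < l -> 0 < p <= 1 ->
  t `^ p <= l `^ p + l `^ (p - 1) * t.
Proof.
move=> t0 l0 /andP[p0 p1]; have [tl|/ltW lt] := leP t l.
  apply: (@le_trans _ _ (l `^ p)).
    by apply: ge0_ler_powR; rewrite ?nnegrE ?(ltW p0) ?(ltW l0).
  by rewrite lerDl mulr_ge0 ?powR_ge0.
apply: (@le_trans _ _ (l `^ (p - 1) * t)); last by rewrite lerDr powR_ge0.
have tt : 0 < t by rewrite (lt_le_trans l0).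
rewrite powR_predr// ler_wpM2r// -(opprB 1 p) !powRN lef_pV2 ?posrE ?powR_gt0//.
by apply: ge0_ler_powR; rewrite ?nnegrE ?subr_ge0// ltW.
Qed.

(** For [p <= 1] no induction is needed: the mean of a ring mass is estimated by
    resampling each word of the ring separately. *)
Lemma small_moment_level p i k w0 rho : 0 < p <= 1 -> (k < n)%N -> rho0 <= rho ->
  E (fun sg => \sum_(w | w ~[i] w0) mass w * ring_mass k rho sg w `^ p)
      <= 2 * c `^ p * rho `^ (s * p) * (th `^ p) ^+ k * total i w0 p.
Proof.
move=> /andP[p0 p1] kn rhor; have /andP[th0 th1] := th01.
have rho_gt0 : 0 < rho by rewrite (lt_le_trans _ rhor).
rewrite expect_sum mulr_sumr; apply: ler_sum => w _.
rewrite expectZ mulrCA ler_wpM2l//.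
set l := c * rho `^ s * (th ^+ k * G w).
have l0 : 0 <= l by rewrite !mulr_ge0 ?powR_ge0 ?exprn_ge0// ltW.
have lE : l `^ p = c `^ p * rho `^ (s * p) * (th `^ p) ^+ k * G w `^ p.
  rewrite /l !powRM ?mulr_ge0 ?powR_ge0 ?exprn_ge0 ?(ltW th0)// -powRrM mulrA.
  do 2 congr (_ * _).
  rewrite -(powR_mulrn _ (ltW th0)) -(powR_mulrn _ (powR_ge0 _ _)) -!powRrM.
  by rewrite mulrC.
have -> : 2 * c `^ p * rho `^ (s * p) * (th `^ p) ^+ k * G w `^ p = 2 * l `^ p.
  by rewrite lE !mulrA.
have Er : E (fun sg => ring_mass k rho sg w) <= l.
  rewrite /ring_mass kn.
  rewrite (@eq_expect _ _ _ _ _ (fun sg => \sum_(v | split_at k v w)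
      mass v * ((dist sg w v <= rho)%R%:R * 1))); last first.
    move=> sg; rewrite big_mkcondr; apply: eq_bigr => v _.
    by case: ifP; rewrite ?mul1r ?mul0r ?mulr1 ?mulr0.
  rewrite expect_sum; apply: (@le_trans _ _
      (\sum_(v | split_at k v w) mass v * (c * rho `^ s * h w k))).
    apply: ler_sum => v vw; rewrite expectZ ler_wpM2l//.
    apply: le_trans (expect_dist kn vw rhor _ _) _ => //.
    by rewrite expect_cst// mulr1.
  rewrite -mulr_suml; apply: (@le_trans _ _ (prefix_mass k w * (c * rho `^ s * h w k))).
    apply: ler_wpM2r; first by rewrite !mulr_ge0 ?powR_ge0// ltW.
    by apply: ler_sum_subpred => // v /andP[].
  rewrite [leLHS](_ : _ = c * rho `^ s * (prefix_mass k w * h w k)); last ring.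
  by rewrite ler_wpM2l ?mulr_ge0 ?powR_ge0// G_prefix.
move: l0; rewrite le_eqVlt => /predU1P[l0|l0]; last first.
  apply: (@le_trans _ _ (E (fun sg => l `^ p + l `^ (p - 1) * ring_mass k rho sg w))).
    apply: le_expect => // sg; apply: powR_le_threshold => //.
      exact: ring_mass_ge0.
    by rewrite p0 p1.
  rewrite expectD expect_cst// expectZ.
  apply: (@le_trans _ _ (l `^ p + l `^ (p - 1) * l)).
    by rewrite lerD2l ler_wpM2l ?powR_ge0.
  by rewrite -powR_predr ?(ltW l0)//; lra.
have G00 : c = 0 \/ G w = 0.
  move/esym/eqP: l0; rewrite /l !mulf_eq0 !orbA expf_eq0 (gt_eqF th0) andbF orbF.
  by rewrite powR_eq0 (gt_eqF rho_gt0)/= orbF => /orP[/eqP|/eqP]; tauto.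
(* with a vanishing bound the first moment is zero, hence so is the power *)
have E0 (sg : {ffun W -> S}) : (\prod_x pr (sg x)) * ring_mass k rho sg w = 0.
  apply/eqP; have /eqP : E (fun sg => ring_mass k rho sg w) = 0.
    apply/eqP; rewrite eq_le expect_ge0 ?andbT//; last first.
      by move=> sg'; exact: ring_mass_ge0.
    by apply: le_trans Er _; rewrite l0.
  rewrite /expect psumr_eq0; last first.
    by move=> sg' _; rewrite mulr_ge0 ?ring_mass_ge0 ?prod_weight_ge0.
  by move=> /allP/(_ sg); rewrite mem_index_enum => /(_ isT).
rewrite /expect big1 ?mulr_ge0 ?powR_ge0// => sg _.
have /eqP := E0 sg; rewrite mulf_eq0 => /orP[/eqP ->|/eqP ->]; first by rewrite mul0r.
by rewrite powR0 ?mulr0// gt_eqF.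
Qed.

(** One of the [p] factors is expanded over the words [v] of the ring.  In the
    others the centre [w] is replaced by [v] at the cost of doubling the radius,
    which makes them independent of the vector that will be resampled. *)
Lemma ring_power_le p k rho sg w : 1 < p -> (k < n)%N ->
  ring_mass k rho sg w `^ p <=
  \sum_(v | split_at k v w) mass v * ((dist sg w v <= rho)%R%:R *
    (\sum_(v' | split_at k v' w && (dist sg v v' <= 2 * rho)) mass v') `^ (p - 1)).
Proof.
move=> p1 kn; have p10 : 0 < p - 1 by rewrite subr_gt0.
rewrite -{1}(subrK 1 p) addrC powRD; last by rewrite addrC subrK gt_eqF ?(lt_trans _ p1).
rewrite powRr1 ?ring_mass_ge0// {1}/ring_mass kn mulr_suml big_mkcondr/=.
apply: ler_sum => v vw; case: ifPn => [wv|]; last first.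
  by rewrite mul0r mulr0.
rewrite mul1r ler_wpM2l//; apply: ge0_ler_powR; rewrite ?nnegrE ?ring_mass_ge0 ?(ltW p10)//.
  exact: sumr_ge0.
rewrite /ring_mass kn; apply: ler_sum_subpred => // v' /andP[-> wv'] /=.
by rewrite (le_trans (dist_triangle sg w v v'))// mulr2n mulrDl mul1r lerD.
Qed.

(** After resampling, [mass w * h w k] is left for every word [w] with a given
    prefix of length [k]; adding these gives [prefix_mass k v * h v k], which
    [G_prefix] converts into the missing factor [G v]. The moment of order
    [p - 1] is needed on every subtree of depth [k], whence the parameters [i] and
    [w0] in the statements. *)
Lemma large_moment_level p C i k w0 rho : 1 < p -> 0 <= C -> (i <= k < n)%N ->
  rho0 <= rho ->
  (forall w, E (fun sg => \sum_(v | v ~[k] w)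
     mass v * ball_mass k (2 * rho) sg v `^ (p - 1))
     <= C * (2 * rho) `^ (s * (p - 1)) * total k w (p - 1)) ->
  E (fun sg => \sum_(w | w ~[i] w0) mass w * ring_mass k rho sg w `^ p)
      <= c * (C * 2 `^ (s * (p - 1))) * rho `^ (s * p) * th ^+ k * total i w0 p.
Proof.
move=> p1 C0 /andP[ik kn] rhor IH; have /andP[th0 th1] := th01.
have rho_gt0 : 0 < rho by rewrite (lt_le_trans _ rhor).
have p10 : 0 < p - 1 by rewrite subr_gt0.
set D := c * (C * 2 `^ (s * (p - 1))) * rho `^ (s * p).
have D0 : 0 <= D by rewrite !mulr_ge0 ?powR_ge0.
rewrite expect_sum.
apply: (@le_trans _ _ (\sum_(w | w ~[i] w0) mass w * (D * h w k * total k w (p - 1)))).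
  apply: ler_sum => w _; rewrite expectZ ler_wpM2l//.
  apply: le_trans (le_expect pr_ge0 (fun sg => ring_power_le rho sg w p1 kn)) _.
  rewrite expect_sum.
  apply: (@le_trans _ _ (\sum_(v | split_at k v w) mass v * (c * rho `^ s * h w k *
      E (fun sg => ball_mass k (2 * rho) sg v `^ (p - 1))))).
    apply: ler_sum => v vw; rewrite expectZ ler_wpM2l//.
    apply: le_trans (expect_dist kn vw rhor _ _) _.
    - by move=> sg; exact: powR_ge0.
    - move=> sg t; congr (_ `^ _); apply: eq_bigl => v'.
      by apply: andb_id2l => v'w; rewrite dist_indep.
    apply: ler_wpM2l; first by rewrite !mulr_ge0 ?powR_ge0// ltW.
    apply: le_expect => // sg; apply: ge0_ler_powR; rewrite ?nnegrE ?ball_mass_ge0 ?(ltW p10)//.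
      exact: sumr_ge0.
    apply: ler_sum_subpred => // v' /andP[/andP[/eqP v'w _] ->].
    by case/andP: vw => /eqP -> _; rewrite v'w eqxx.
  under eq_bigr do rewrite mulrCA.
  rewrite -mulr_sumr.
  have -> : D * h w k * total k w (p - 1) = c * rho `^ s * h w k *
      (C * (2 * rho) `^ (s * (p - 1)) * total k w (p - 1)).
    rewrite powRM ?(ltW rho_gt0)// /D.
    have -> : s * p = s + s * (p - 1) by ring.
    rewrite powRD; last by rewrite (gt_eqF rho_gt0) implybT.
    by ring.
  apply: ler_wpM2l; first by rewrite !mulr_ge0 ?powR_ge0// ltW.
  apply: le_trans (IH w); rewrite expect_sum.
  under eq_bigr do rewrite -expectZ.
  apply: ler_sum_subpred => [v /andP[]//|v _].
  by apply: expect_ge0 => // sg; rewrite mulr_ge0 ?powR_ge0.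
under eq_bigr => w _.
  have -> : mass w * (D * h w k * total k w (p - 1)) =
      D * \sum_(v | v ~[k] w) mass w * h w k * (mass v * G v `^ (p - 1)).
    by rewrite /total -mulr_sumr; ring.
  over.
rewrite -mulr_sumr -mulrA ler_wpM2l//.
rewrite (exchange_big_dep (fun v => v ~[i] w0))/=; last first.
  by move=> w v /eqP <- /(prefix_le ik).
rewrite /total mulr_sumr; apply: ler_sum => v vw0.
apply: (@le_trans _ _ (mass v * (G v `^ (p - 1) * (prefix_mass k v * h v k)))).
  rewrite /prefix_mass mulr_suml !mulr_sumr.
  rewrite [leLHS](eq_big (fun w => w ~[k] v)
    (fun w => mass v * (G v `^ (p - 1) * (mass w * h v k)))) => //.
    move=> w; rewrite andb_idl; first by rewrite eq_sym.
    by move=> /(prefix_le ik)/eqP <-.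
  by move=> w /andP[_ vw]; rewrite -(h_prefix vw); ring.
rewrite [leRHS]mulrCA ler_wpM2l//.
rewrite (@powR_predr _ _ p)// ?(lt_trans _ p1)// [leRHS]mulrCA ler_wpM2l ?powR_ge0//.
exact: G_prefix.
Qed.


(** The induction lowers the exponent by one: a ring mass to the power [p] is
    the ring mass times its power [p - 1], the first factor is estimated by
    resampling, and the second one is compared with the mass of a ball of twice
    the radius centred at a word on which the resampling has no effect. *)
Theorem expect_ball_moment m p i w0 rho : m%:R < p <= m.+1%:R -> (i <= n)%N ->
  rho0 <= rho ->
  0 <= moment_const s c th m p /\
  E (fun sg => \sum_(w | w ~[i] w0) mass w * ball_mass i rho sg w `^ p)
    <= moment_const s c th m p * rho `^ (s * p) * total i w0 p.
Proof.
have /andP[th0 th1] := th01.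
have th_lt1 x : 0 < x -> 0 < th `^ x < 1.
  move=> x0; rewrite powR_gt0//=.
  have := @gt0_ltr_powR R x x0 th 1.
  by rewrite powR1 !nnegrE; apply => //; exact: ltW.
have H x : 0 < x -> 0 <= (1 - th `^ x)^-1.
  by move=> /th_lt1/andP[_ xlt]; rewrite invr_ge0 subr_ge0 ltW.
have H2 : 0 < 2^-1 :> R by rewrite invr_gt0.
elim: m p i w0 rho => [|m IH] p i w0 rho /andP[mp pm] iN rhor.
  split; first by rewrite /= !mulr_ge0 ?power_sum_const_ge0 ?powR_ge0 ?H ?divr_gt0.
  apply: sum_levels => //.
  - by rewrite th_lt1 ?divr_gt0.
  - by rewrite mulr_ge0 ?powR_ge0.
  have -> : (th `^ (p / 2)) ^+ 2 = th `^ p.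
    rewrite -(powR_mulrn _ (powR_ge0 _ _)) -powRrM divfK//.
  move=> k /andP[ik]; rewrite leq_eqVlt => /predU1P[->|kn].
    apply: le_trans (leaf_level i w0 mp (ltW mp) (lexx p) rhor) _.
    rewrite -!mulrA; apply: ler_peMl; last by lra.
    by rewrite !mulr_ge0 ?powR_ge0 ?exprn_ge0 ?total_ge0 ?powR_ge0.
  by apply: small_moment_level => //; rewrite mp pm.
have mp1 : m%:R < p - 1 <= m.+1%:R by move: mp pm; rewrite -!natr1; lra.
have p1 : 1 < p by move/andP: mp1 => [mp1 _]; have := ler0n R m; lra.
have p0 : 0 < p by rewrite (lt_trans _ p1).
set C := moment_const s c th m (p - 1).
have C0 : 0 <= C by have [] := IH (p - 1) 0%N w0 rho mp1 isT rhor.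
have A0 : 0 <= c * (C * 2 `^ (s * (p - 1))) + c `^ p.
  by rewrite addr_ge0 ?mulr_ge0 ?powR_ge0.
split; first by rewrite /= !mulr_ge0 ?power_sum_const_ge0 ?H.
apply: sum_levels => //; first by rewrite th_lt1.
have -> : (th `^ 2^-1) ^+ 2 = th.
  by rewrite -(powR_mulrn _ (powR_ge0 _ _)) powR_powRV// ltW.
have rho_ge0 : 0 <= rho by rewrite (le_trans _ rhor)// ltW.
move=> k /andP[ik]; rewrite leq_eqVlt => /predU1P[->|kn].
  apply: le_trans (leaf_level i w0 p0 ler01 (ltW p1) rhor) _.
  rewrite powRr1 ?(ltW th0)// -!mulrA.
  rewrite ler_wpM2r ?mulr_ge0 ?powR_ge0 ?exprn_ge0 ?total_ge0 ?(ltW th0)//.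
  by rewrite lerDr !mulr_ge0 ?powR_ge0.
apply: le_trans (large_moment_level w0 p1 C0 _ rhor _) _.
- by rewrite ik kn.
- move=> w; have rr : rho0 <= 2 * rho by rewrite (le_trans rhor)//; lra.
  by have [] := IH (p - 1) k w (2 * rho) mp1 (ltnW kn) rr.
do 3 (apply: ler_wpM2r; first by rewrite ?powR_ge0 ?exprn_ge0 ?total_ge0 ?(ltW th0)).
by rewrite lerDl powR_ge0.
Qed.

End random_tree.

(** * Orthogonal diagonalisation of real symmetric matrices *)

Section spectral_theorem.
Context {R : realType}.

(** Seen over the complex numbers the matrix is Hermitian, hence unitarily
    diagonalisable with real eigenvalues. *)
Lemma symmetric_eigenvalue n (B : 'M[R]_n.+1) : B^T = B ->
  exists x, eigenvalue B x.
Proof.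
move=> Bsym.
pose Bc : 'M[R[i]]_n.+1 := map_mx (real_complex R) B.
have Bc_herm : Bc \is hermsymmx.
  apply: realsym_hermsym.
    by apply/is_hermitianmxP; rewrite expr0 scale1r map_mx_id// /Bc map_trmx Bsym.
  by apply/mxOverP => i j; rewrite mxE complex_real.
have dreal := hermitian_spectral_diag_real Bc_herm.
have /orthomx_spectralP BcE := hermitian_normalmx Bc_herm.
set P := spectralmx Bc in BcE; set D := spectral_diag Bc in BcE dreal.
have Pu : P \in unitmx by exact: spectral_unit.
have [x Dx] : exists x, D 0 0 = (x%:C)%C.
  by apply/complex_realP; exact: (mxOverP dreal).
exists x; rewrite eigenvalue_root_char -(fmorph_root (real_complex R)).
rewrite map_char_poly -eigenvalue_root_char -/Bc; apply/eigenvalueP.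
exists (row 0 P); last first.
  apply/eqP => P0; have : row 0 (P *m invmx P) = 0 by rewrite row_mul P0 mul0mx.
  rewrite mulmxV// => /rowP/(_ 0); rewrite !mxE eqxx => /eqP.
  by rewrite oner_eq0.
rewrite -row_mul {1}BcE -mulmxA mulKVmx// row_mul.
apply/rowP => j; rewrite !mxE (bigD1 0)//= big1 => [|i i0].
  by rewrite !mxE eqxx mulr1n Dx addr0.
by rewrite !mxE eq_sym (negPf i0) mulr0n mul0r.
Qed.

Definition orthogonal n (V : 'M[R]_n) := V *m V^T = 1%:M.

Lemma orthogonal_tr n (V : 'M[R]_n) : orthogonal V -> orthogonal V^T.
Proof. by rewrite /orthogonal trmxK => /mulmx1C. Qed.

Lemma orthogonalM n (U V : 'M[R]_n) :
  orthogonal U -> orthogonal V -> orthogonal (U *m V).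
Proof.
move=> UU VV.
by rewrite /orthogonal trmx_mul mulmxA -(mulmxA U) VV mulmx1.
Qed.

Lemma row_dot_gt0 n (v : 'rV[R]_n) : v != 0 -> 0 < (v *m v^T) 0 0.
Proof.
move=> v0; have -> : (v *m v^T) 0 0 = \sum_i v 0 i ^+ 2.
  by rewrite mxE; apply: eq_bigr => i _; rewrite mxE expr2.
rewrite lt_neqAle sumr_ge0 ?andbT => [|i _]; last exact: sqr_ge0.
apply: contraNneq v0 => v0; apply/eqP/rowP => i; rewrite mxE; apply/eqP.
move/esym/eqP: v0; rewrite psumr_eq0 => [/allP/(_ i)|j _]; last exact: sqr_ge0.
by rewrite mem_index_enum sqrf_eq0 => /(_ isT).
Qed.

(** The Householder reflection exchanging [v] and the first basis vector. *)
Lemma unit_row_orthogonal n (v : 'rV[R]_n.+1) : v *m v^T = 1%:M ->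
  exists2 H : 'M[R]_n.+1, orthogonal H & row 0 H = v.
Proof.
move=> vv; set e : 'rV[R]_n.+1 := delta_mx 0 0.
have ee : e *m e^T = 1%:M.
  by rewrite /e trmx_delta mul_delta_mx; apply/rowP => i; rewrite !ord1 !mxE.
have [<-|ve] := eqVneq e v.
  exists 1%:M; first by rewrite /orthogonal trmx1 mulmx1.
  by apply/rowP => i; rewrite !mxE eq_sym.
pose u := e - v.
have uu0 : (u *m u^T) 0 0 != 0 by rewrite gt_eqF ?row_dot_gt0 ?subr_eq0.
set a := (u *m u^T) 0 0 in uu0.
have uuE : u *m u^T = a%:M.
  by apply/rowP => i; rewrite ord1 [RHS]mxE eqxx mulr1n.
have aE : a = 2 - 2 * (e *m v^T) 0 0.
  have -> : a = (u *m u^T) 0 0 by [].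
  rewrite /u linearB/= mulmxBl !mulmxBr ee vv.
  have -> : v *m e^T = (e *m v^T)^T by rewrite trmx_mul trmxK.
  have subE (M1 M2 : 'M[R]_1) : (M1 - M2) 0 0 = M1 0 0 - M2 0 0 by rewrite !mxE.
  have trE (M1 : 'M[R]_1) : M1^T 0 0 = M1 0 0 by rewrite mxE.
  have oneE : (1%:M : 'M[R]_1) 0 0 = 1 by rewrite mxE.
  by rewrite !subE trE oneE; ring.
pose H := 1%:M - (2 / a) *: (u^T *m u).
have HT : H^T = H by rewrite /H linearB/= linearZ/= trmx1 trmx_mul trmxK.
exists H.
  rewrite /orthogonal HT {2}/H mulmxBr mulmx1 {1}/H -scalemxAr /H mulmxBl mul1mx.
  rewrite -scalemxAl -mulmxA (mulmxA u) uuE mul_scalar_mx -scalemxAr !scalerA.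
  rewrite divfK// scalerBr scalerA !opprB addrA.
  apply/matrixP => i j; rewrite !mxE; field; exact: uu0.
have -> : row 0 H = e *m H by rewrite -rowE.
rewrite mulmxBr mulmx1 -scalemxAr mulmxA.
have -> : e *m u^T = (1 - (e *m v^T) 0 0)%:M.
  rewrite /u linearB/= mulmxBr ee; apply/rowP => i.
  by rewrite ord1 [LHS]mxE [RHS]mxE [X in X + _]mxE [X in _ + X]mxE eqxx mulr1n.
have -> : 1 - (e *m v^T) 0 0 = a / 2 by rewrite aE; field.
rewrite mul_scalar_mx scalerA mulf_div (mulrC 2) divff ?mulf_neq0// scale1r.
by rewrite /u opprB addrC subrK.
Qed.

(** By deflation: in an orthonormal basis beginning with a unit eigenvector the
    matrix is block diagonal, by symmetry, and the second block is again
    symmetric. *)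
Theorem symmetric_diagonalization n (B : 'M[R]_n) : B^T = B ->
  exists2 V : 'M[R]_n, orthogonal V &
    exists d : 'rV[R]_n, B = V^T *m diag_mx d *m V.
Proof.
elim: n B => [|n IH] B Bsym.
  exists 1%:M; first by rewrite /orthogonal trmx1 mulmx1.
  by exists 0; apply/matrixP => -[].
have [x /eigenvalueP[v0 v0B v00]] := symmetric_eigenvalue Bsym.
pose nv := (v0 *m v0^T) 0 0.
have nv0 : 0 < nv by exact: row_dot_gt0.
pose v := (Num.sqrt nv)^-1 *: v0.
have vv : v *m v^T = 1%:M.
  rewrite /v linearZ/= -scalemxAl -scalemxAr scalerA -expr2 exprVn sqr_sqrtr ?(ltW nv0)//.
  by apply/rowP => i; rewrite !ord1 mxE -/nv mulVf ?gt_eqF// mxE.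
have vB : v *m B = x *: v by rewrite /v -scalemxAl v0B scalerA mulrC -scalerA.
have [H Ho Hv] := unit_row_orthogonal vv.
pose C : 'M[R]_(1 + n) := H *m B *m H^T.
have CT : C^T = C by rewrite /C !trmx_mul trmxK Bsym mulmxA.
have C0 j : C 0 j = if j == 0 then x else 0.
  have -> : C 0 j = (row 0 C) 0 j by rewrite [RHS]mxE.
  rewrite /C !row_mul Hv vB -scalemxAl -Hv -row_mul Ho !mxE.
  by rewrite eq_sym; case: eqP => _; rewrite ?mulr1 ?mulr0.
have BC : B = H^T *m C *m H.
  have HH := orthogonal_tr Ho; rewrite /orthogonal trmxK in HH.
  by rewrite /C !mulmxA HH mul1mx -mulmxA HH mulmx1.
clearbody C.
have CE : C = block_mx (x%:M : 'M[R]_1) 0 0 (drsubmx C).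
  have C0' j : C j 0 = (if j == 0 then x else 0) by rewrite -CT [LHS]mxE C0.
  rewrite -{1}[C]submxK; congr block_mx.
  - by apply/matrixP => i j; rewrite !ord1 !mxE lshift0 C0.
  - by apply/matrixP => i j; rewrite !ord1 !mxE lshift0 C0.
  - by apply/matrixP => i j; rewrite !ord1 !mxE lshift0 C0'.
have [V Vo [d dE]] : exists2 V : 'M[R]_n, orthogonal V &
    exists d : 'rV[R]_n, drsubmx C = V^T *m diag_mx d *m V.
  by apply: IH; rewrite trmx_drsub CT.
pose V1 : 'M[R]_(1 + n) := block_mx 1%:M 0 0 V.
have V1o : orthogonal V1.
  rewrite /orthogonal /V1 tr_block_mx !trmx0 trmx1 mulmx_block.
  by rewrite !mul0mx !mulmx0 !addr0 !add0r mulmx1 Vo -scalar_mx_block.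
exists (V1 *m H); first exact: orthogonalM.
exists (row_mx (x%:M : 'M[R]_1) d : 'rV[R]_(1 + n)).
rewrite BC.
rewrite trmx_mul -!mulmxA; congr (_ *m _); rewrite !mulmxA; congr (_ *m _).
have V1T : V1^T = block_mx 1%:M 0 0 V^T.
  by rewrite /V1 tr_block_mx !trmx0 trmx1.
rewrite CE dE (@diag_mx_row _ n 1) V1T.
rewrite [X in _ = X *m _](@mulmx_block _ 1 n 1 n 1 n) (@mulmx_block _ 1 n 1 n 1 n).
rewrite !(mul0mx, mulmx0, addr0, add0r, mulmx1, mul1mx).
have -> : diag_mx (x%:M : 'M[R]_1) = x%:M.
  by apply/matrixP => i j; rewrite !ord1 !mxE eqxx.
by [].
Qed.

End spectral_theorem.

(** * Euclidean norm and singular value decomposition *)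

Section euclidean_norm.
Context {R : realType}.

Lemma enorm_ge0 n (x : 'cV[R]_n) : 0 <= enorm x.
Proof. exact: sqrtr_ge0. Qed.

Lemma sqr_enorm n (x : 'cV[R]_n) : enorm x ^+ 2 = \sum_i x i ord0 ^+ 2.
Proof. by rewrite sqr_sqrtr// sumr_ge0// => i _; exact: sqr_ge0. Qed.

Lemma sqr_enormE n (x : 'cV[R]_n) : enorm x ^+ 2 = (x^T *m x) 0 0.
Proof.
by rewrite sqr_enorm mxE; apply: eq_bigr => i _; rewrite mxE expr2.
Qed.

Lemma enorm_orthogonal n (V : 'M[R]_n) (x : 'cV[R]_n) :
  orthogonal V -> enorm (V *m x) = enorm x.
Proof.
move=> /orthogonal_tr; rewrite /orthogonal trmxK => VV.
apply/eqP; rewrite -(@eqrXn2 _ 2)// ?enorm_ge0// !sqr_enormE trmx_mul.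
by rewrite -mulmxA (mulmxA V^T) VV mul1mx.
Qed.

Lemma coord_le_enorm n (x : 'cV[R]_n) i : `|x i ord0| <= enorm x.
Proof.
rewrite -sqrtr_sqr /enorm ler_sqrt ?sumr_ge0// => [|j _]; last exact: sqr_ge0.
by rewrite (bigD1 i)//= lerDl sumr_ge0// => j _; exact: sqr_ge0.
Qed.

Lemma enorm_le_coord n (x : 'cV[R]_n) c : 0 <= c ->
  (forall i, `|x i ord0| <= c) -> enorm x <= Num.sqrt n%:R * c.
Proof.
move=> c0 xc; rewrite -[X in _ * X](ger0_norm c0) -sqrtr_sqr -sqrtrM//.
rewrite /enorm ler_sqrt; last by rewrite mulr_ge0 ?sqr_ge0.
apply: (@le_trans _ _ (\sum_(i < n) c ^+ 2)).
  apply: ler_sum => i _; rewrite -[leLHS]real_normK ?num_real//.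
  by rewrite lerXn2r ?nnegrE.
by rewrite sumr_const card_ord mulr_natl.
Qed.

Lemma cauchy_schwarz_sum n (f g : 'I_n -> R) :
  (\sum_i f i * g i) ^+ 2 <= (\sum_i f i ^+ 2) * (\sum_i g i ^+ 2).
Proof.
set a := \sum_i f i ^+ 2; set b := \sum_i f i * g i; set c := \sum_i g i ^+ 2.
have a0 : 0 <= a by apply: sumr_ge0 => i _; exact: sqr_ge0.
have H x : 0 <= x ^+ 2 * a + 2 * x * b + c.
  have -> : x ^+ 2 * a + 2 * x * b + c = \sum_i (x * f i + g i) ^+ 2.
    rewrite /a /b /c !mulr_sumr -!big_split/=; apply: eq_bigr => i _; ring.
  by apply: sumr_ge0 => i _; exact: sqr_ge0.
move: a0; rewrite le_eqVlt => /predU1P[a0|a0]; last first.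
  have := H (- b / a); rewrite -(pmulr_rge0 _ a0).
  have -> : a * ((- b / a) ^+ 2 * a + 2 * (- b / a) * b + c) = a * c - b ^+ 2.
    by field; rewrite gt_eqF.
  by rewrite subr_ge0.
have -> : b = 0.
  apply: big1 => i _; have /eqP : a = 0 by [].
  rewrite psumr_eq0 => [/allP/(_ i)|j _]; last exact: sqr_ge0.
  by rewrite mem_index_enum sqrf_eq0 => /(_ isT)/eqP ->; rewrite mul0r.
by rewrite -a0 mul0r expr0n.
Qed.

Lemma enormD n (x y : 'cV[R]_n) : enorm (x + y) <= enorm x + enorm y.
Proof.
rewrite -(@ler_pXn2r _ 2)// ?nnegrE ?addr_ge0 ?enorm_ge0// sqrrD !sqr_enorm.
have -> : \sum_i (x + y) i ord0 ^+ 2 = \sum_i x i ord0 ^+ 2 +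
    2 * (\sum_i x i ord0 * y i ord0) + \sum_i y i ord0 ^+ 2.
  rewrite mulr_sumr -!big_split/=; apply: eq_bigr => i _; rewrite mxE; ring.
rewrite lerD2r lerD2l -[leRHS]mulr_natl ler_pM2l//.
rewrite (le_trans (ler_norm _))// -sqrtr_sqr /enorm -sqrtrM.
  by rewrite ler_sqrt ?cauchy_schwarz_sum// mulr_ge0// sumr_ge0// => i _; exact: sqr_ge0.
by rewrite sumr_ge0// => i _; exact: sqr_ge0.
Qed.

Lemma enormN n (x : 'cV[R]_n) : enorm (- x) = enorm x.
Proof. by congr Num.sqrt; apply: eq_bigr => i _; rewrite mxE sqrrN. Qed.

Lemma enormB n (x y : 'cV[R]_n) : enorm (x - y) = enorm (y - x).
Proof. by rewrite -enormN opprB. Qed.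

Lemma enorm0 n : enorm (0 : 'cV[R]_n) = 0.
Proof.
by rewrite /enorm big1 ?sqrtr0// => i _; rewrite mxE expr0n.
Qed.

Lemma enormZ n a (x : 'cV[R]_n) : enorm (a *: x) = `|a| * enorm x.
Proof.
rewrite -sqrtr_sqr -sqrtrM ?sqr_ge0// mulr_sumr; congr Num.sqrt.
by apply: eq_bigr => i _; rewrite mxE exprMn.
Qed.

Lemma enorm_eq0 n (x : 'cV[R]_n) : (enorm x == 0) = (x == 0).
Proof.
apply/eqP/eqP => [x0|->]; last exact: enorm0.
apply/matrixP => i j; rewrite ord1 mxE; apply/eqP; rewrite -normr_le0.
by rewrite (le_trans (coord_le_enorm x i))// x0.
Qed.

Lemma char_poly_orthogonal n (V D : 'M[R]_n) : orthogonal V ->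
  char_poly (V^T *m D *m V) = char_poly D.
Proof.
move=> Vo; have VV := orthogonal_tr Vo; rewrite /orthogonal trmxK in VV.
pose P := map_mx (@polyC R) V.
have PP : P^T *m P = 1%:M.
  by rewrite /P map_trmx -map_mxM VV map_mx1.
rewrite /char_poly.
have -> : char_poly_mx (V^T *m D *m V) = P^T *m char_poly_mx D *m P.
  rewrite /char_poly_mx mulmxBr mulmxBl !map_mxM -/P -map_trmx -/P; congr (_ - _).
  by rewrite mul_mx_scalar -scalemxAl PP scalemx1.
by rewrite !det_mulmx mulrC mulrA -det_mulmx mulmx1C// det1 mul1r.
Qed.

(** Applied to a characteristic polynomial that splits, this identifies the
    eigenvalues repeated according to multiplicity with the diagonal entries of a
    diagonalisation. *)
Lemma roots_with_multiplicity (s : seq R) (f : R -> R) p :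
  p = \prod_(x <- s) ('X - x%:P) ->
  perm_eq (flatten [seq nseq (mup x p) (f x) | x <- rootsR p]) (map f s).
Proof.
move=> pE; have p0 : p != 0 by rewrite pE monic_neq0 ?monic_prod_XsubC.
have rE : perm_eq (rootsR p) (undup s).
  apply: uniq_perm; rewrite ?undup_uniq//; first exact: uniq_roots.
  move=> x; rewrite mem_undup -[RHS]root_prod_XsubC -pE.
  by have := roots_on_rootsR p0 x; rewrite in_itv/= => ->.
have -> : [seq nseq (mup x p) (f x) | x <- rootsR p] =
    map (map f) [seq nseq (count_mem x s) x | x <- rootsR p].
  by rewrite -map_comp; apply: eq_map => x /=; rewrite map_nseq pE mu_prod_XsubC.
rewrite -map_flatten perm_map//.
rewrite -(permPr (perm_count_undup s)); apply: perm_flatten.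
exact: perm_map.
Qed.

(** The diagonal entries of a diagonalisation of the Gram matrix are the squared
    lengths of the images of the orthonormal eigenvectors; for invertible [A] this
    makes them positive. *)
Lemma gram_diagonalization n (A : 'M[R]_n) :
  exists2 V : 'M[R]_n, orthogonal V & exists2 d : 'rV[R]_n,
    (forall i, d 0 i = enorm (A *m col i V^T) ^+ 2) /\
    A^T *m A = V^T *m diag_mx d *m V &
    perm_eq (singular_values A) [seq Num.sqrt (d 0 i) | i <- enum 'I_n].
Proof.
have sym : (A^T *m A)^T = A^T *m A by rewrite trmx_mul trmxK.
have [V Vo [d dE]] := symmetric_diagonalization sym.
exists V => //; exists d; first split => // i.
  rewrite sqr_enormE trmx_mul -mulmxA (mulmxA A^T) dE colE trmx_mul trmxK.
  rewrite !mulmxA -(mulmxA _ V V^T) Vo mulmx1 -(mulmxA _ V V^T) Vo mulmx1.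
  by rewrite trmx_delta -rowE -colE !mxE eqxx.
rewrite /singular_values dE char_poly_orthogonal// char_poly_trig ?diag_mx_is_trig//.
have -> : \prod_(i < n) ('X - (diag_mx d i i)%:P) =
    \prod_(x <- [seq d 0 i | i <- enum 'I_n]) ('X - x%:P).
  rewrite big_map big_enum/=; apply: eq_bigr => i _.
  by rewrite mxE eqxx mulr1n.
rewrite perm_sort (permPl (roots_with_multiplicity _ (erefl _))).
by rewrite -map_comp.
Qed.

(** The rows of [V] are eigenvectors of the Gram matrix, permuted so that the
    eigenvalues decrease.  With [D] the diagonal matrix of singular values,
    [U := A *m V^T *m D^-1] is orthogonal because [V] diagonalises
    [A^T *m A] with eigenvalues [D ^+ 2]. *)
Theorem singular_value_decomposition n (A : 'M[R]_n) : A \in unitmx ->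
  [/\ sorted >=%R (singular_values A),
      forall i : 'I_n, 0 < (singular_values A)`_i &
  exists U V : 'M[R]_n, [/\ orthogonal U, orthogonal V &
    A = U *m diag_mx (\row_i (singular_values A)`_i) *m V]].
Proof.
move=> Au; have [V0 V0o [d [d0E dE] sperm]] := gram_diagonalization A.
have d_gt0 i : 0 < d 0 i.
  rewrite d0E exprn_gt0// lt_neqAle enorm_ge0 andbT eq_sym enorm_eq0.
  apply/negP => /eqP /(congr1 (mulmx (invmx A))).
  rewrite mulKmx// mulmx0 => /(congr1 (mulmx V0)).
  rewrite colE mulmxA V0o mulmx0 mul1mx => /colP/(_ i).
  by rewrite !mxE !eqxx => /eqP; rewrite oner_eq0.
pose t := [tuple Num.sqrt (d 0 i) | i < n].
have /tuple_permP[s sE] : perm_eq (singular_values A) t by [].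
have aE (i : 'I_n) : (singular_values A)`_i = Num.sqrt (d 0 (s i)).
  by rewrite sE -(tnth_nth 0 [tuple tnth t (s i) | i < n]) !tnth_mktuple.
have a_gt0 (i : 'I_n) : 0 < (singular_values A)`_i by rewrite aE sqrtr_gt0.
split => //; first by apply: sort_sorted => x y; exact: le_total.
pose D := diag_mx (\row_i (singular_values A)`_i : 'rV[R]_n).
pose Dv := diag_mx (\row_i ((singular_values A)`_i)^-1 : 'rV[R]_n).
have DDv : D *m Dv = 1%:M.
  apply/matrixP => i j; rewrite mul_diag_mx !mxE.
  by case: eqP => [->|_]; rewrite ?mulr0// mulr1n divff// gt_eqF.
have DvD : Dv *m D = 1%:M by exact: mulmx1C.
pose V := perm_mx s *m V0.
have Vo : orthogonal V.
  apply: orthogonalM V0o; rewrite /orthogonal tr_perm_mx -perm_mxM mulgV.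
  exact: perm_mx1.
have VV := orthogonal_tr Vo; rewrite /orthogonal trmxK in VV.
have AAE : A^T *m A = V^T *m (D *m D) *m V.
  have SS : (perm_mx s)^T *m perm_mx s = 1%:M :> 'M[R]_n.
    by rewrite tr_perm_mx -perm_mxM mulVg perm_mx1.
  have SD : perm_mx s *m diag_mx d = D *m D *m perm_mx s.
    apply/matrixP => i j; rewrite -row_permE -mulmxA /D !mul_diag_mx !mxE mulrA.
    rewrite aE -expr2 sqr_sqrtr ?(ltW (d_gt0 _))//.
    by rewrite mulr_natr.
  rewrite dE /V trmx_mul -!mulmxA; congr (_ *m _); rewrite !mulmxA.
  by rewrite -(mulmxA _ D D) -(mulmxA _ (D *m D)) -SD mulmxA SS mul1mx.
clearbody V; exists (A *m V^T *m Dv), V; split => //.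
  rewrite -[X in orthogonal X]trmxK; apply: orthogonal_tr.
  rewrite /orthogonal trmxK !trmx_mul trmxK.
  rewrite !mulmxA -(mulmxA _ A^T A) AAE tr_diag_mx -/Dv.
  rewrite !mulmxA -(mulmxA _ V V^T) Vo mulmx1 -(mulmxA _ V V^T) Vo mulmx1.
  transitivity (1%:M *m D *m Dv); last by rewrite mul1mx.
  exact: (congr1 (fun M => M *m D *m Dv) DvD).
have -> : A *m V^T *m Dv *m D = A *m V^T.
  by rewrite -mulmxA; transitivity (A *m V^T *m 1%:M); [congr (_ *m _); exact: DvD|rewrite mulmx1].
by rewrite -mulmxA VV mulmx1.
Qed.

End euclidean_norm.

(** * The singular value function *)

Section singular_value_function.
Context {R : realType}.

Definition clip (x : R) : R := Num.min 1 (Num.max 0 x).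

Lemma clip_ge0 x : 0 <= clip x.
Proof. by rewrite /clip le_min ler01 le_max lexx. Qed.

Lemma clip_le1 x : clip x <= 1.
Proof. by rewrite /clip ge_min lexx. Qed.

Lemma clip0 x : x <= 0 -> clip x = 0.
Proof. by move=> x0; rewrite /clip max_l// min_r. Qed.

Lemma clip_id x : 0 <= x <= 1 -> clip x = x.
Proof. by move=> /andP[x0 x1]; rewrite /clip max_r// min_r. Qed.

Lemma clip1 x : 1 <= x -> clip x = 1.
Proof. by move=> x1; rewrite /clip max_r ?(le_trans ler01)// min_l. Qed.

Lemma le_clip x y : x <= y -> clip x <= clip y.
Proof.
move=> xy; have [x0|x0] := leP x 0; first by rewrite clip0// clip_ge0.
have [y1|y1] := leP 1 y; first by rewrite (clip1 y1) clip_le1.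
by rewrite !clip_id//; lra.
Qed.

Lemma sum_clip n s : 0 <= s -> \sum_(l < n) clip (s - l%:R) = Num.min s n%:R.
Proof.
move=> s0; elim: n => [|n IH].
  by rewrite big_ord0 /Num.min ltNge s0.
rewrite big_ord_recr/= {}IH -natr1.
have [sn|sn] := leP s n%:R.
  by rewrite clip0 ?subr_le0// addr0 min_l; lra.
have [s1|s1] := leP s (n%:R + 1); first by rewrite clip_id; lra.
by rewrite clip1; lra.
Qed.

Lemma prod_powR (I : Type) (r : seq I) (P : pred I) (c : R) (f : I -> R) :
  0 < c -> \prod_(i <- r | P i) c `^ f i = c `^ (\sum_(i <- r | P i) f i).
Proof.
move=> c0; apply/esym.
apply: (big_morph (fun x => c `^ x)); last by rewrite powRr0.
by move=> x y; rewrite powRD ?(gt_eqF c0) ?implybT.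
Qed.

Variable n : nat.

Definition sv (A : 'M[R]_n) (l : nat) : R := (singular_values A)`_l.

Lemma sv_gt0 (A : 'M[R]_n) (l : 'I_n) : A \in unitmx -> 0 < sv A l.
Proof. by move=> /singular_value_decomposition[_ h _]; exact: h. Qed.

(** The [l]-th singular value is the length of the image of the [l]-th right
    singular vector. *)
Lemma sv_le (A : 'M[R]_n) c (l : 'I_n) : A \in unitmx ->
  (forall x, enorm (A *m x) <= c * enorm x) -> sv A l <= c.
Proof.
move=> Au; have [_ a_gt0 [U [V [Uo Vo AE]]]] := singular_value_decomposition Au.
move=> /(_ (V^T *m delta_mx l 0)).
have e1 : enorm (delta_mx l 0 : 'cV[R]_n) = 1.
  rewrite /enorm (bigD1 l)//= big1 => [|i /negPf il].
    by rewrite mxE !eqxx expr1n addr0 sqrtr1.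
  by rewrite mxE il expr0n.
rewrite (enorm_orthogonal _ (orthogonal_tr Vo)) e1 mulr1 {1}AE -!mulmxA.
rewrite (mulmxA V) Vo mul1mx enorm_orthogonal//.
have -> : diag_mx (\row_i (singular_values A)`_i) *m delta_mx l 0 =
    sv A l *: delta_mx l 0 :> 'cV[R]_n.
  apply/matrixP => i j; rewrite mul_diag_mx !mxE /sv.
  by case: eqP => [->//|]; rewrite !mulr0.
by rewrite enormZ e1 mulr1 gtr0_norm// sv_gt0.
Qed.

Lemma sv_decreasing (A : 'M[R]_n) (k l : 'I_n) : A \in unitmx ->
  (k <= l)%N -> sv A l <= sv A k.
Proof.
move=> Au; have [srt a_gt0 _] := singular_value_decomposition Au => kl.
have lsize : (l < size (singular_values A))%N.
  rewrite ltnNge; apply/negP => h; have := a_gt0 l.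
  by rewrite nth_default// ltxx.
have := @sorted_leq_nth R >=%R _ _ 0 _ srt k l.
rewrite !inE; apply => //.
- by move=> x y z /= yx xz; exact: le_trans xz yx.
- by move=> x /=.
- exact: leq_ltn_trans lsize.
Qed.

(** With exponents written this way, each of them is non-decreasing in [s] and
    they add up to [s] ([sum_clip]), so that comparisons between values of [phi]
    reduce to comparisons factor by factor. *)
Lemma phiE (A : 'M[R]_n) s : A \in unitmx -> 0 < s <= n%:R ->
  phi s A = \prod_(l < n) sv A l `^ clip (s - l%:R).
Proof.
move=> Au /andP[s0 sn]; rewrite /phi sn -/(sv A _).
have /andP[cl cr] := ceil_itv s; set j := `|Num.ceil s|%N.
have c0 : 0 < Num.ceil s by rewrite ceil_gt0.
have jE : j%:R = (Num.ceil s)%:~R :> R by rewrite pmulrn /j gez0_abs// ltW.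
have j0 : (0 < j)%N by rewrite /j absz_gt0 gt_eqF.
have sj : s <= j%:R by rewrite jE.
have js : j%:R - 1 < s by move: cl; rewrite intrB -jE.
have jn : (j <= n)%N.
  rewrite leqNgt; apply/negP => nj; have : n.+1%:R <= j%:R :> R by rewrite ler_nat.
  by rewrite -natr1; lra.
have -> : j = j.-1.+1 by rewrite prednK.
move: j0 jn sj js; case: j {jE} => // j _ jn; rewrite -natr1 /= => sj js.
rewrite -(big_mkord xpredT (fun l => sv A l `^ clip (s - l%:R))).
rewrite (@big_cat_nat _ _ _ j)//= ?(ltnW jn)// (big_ltn jn) [X in _ = _ * (_ * X)]big1_seq.
  rewrite mulr1 clip_id; last lra.
  congr (_ * _); last by congr (_ `^ _); lra.
  rewrite big_mkord; apply: eq_bigr => l _.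
  have lj : l.+1%:R <= j%:R :> R by rewrite ler_nat.
  rewrite clip1 ?powRr1//; last by rewrite -natr1 in lj; lra.
  have ln : (l < n)%N by exact: ltn_trans jn.
  exact/ltW/(sv_gt0 (Ordinal ln) Au).
move=> l /andP[_]; rewrite mem_index_iota => /andP[jl ln].
have lj : j.+1%:R <= l%:R :> R by rewrite ler_nat.
by rewrite clip0 ?powRr0//; rewrite -natr1 in lj; lra.
Qed.

Lemma phi_gt0 (A : 'M[R]_n) s : A \in unitmx -> 0 < s <= n%:R -> 0 < phi s A.
Proof.
move=> Au sn; rewrite phiE//; apply: prodr_gt0 => l _.
by rewrite powR_gt0// sv_gt0.
Qed.

Lemma phi_gt0_all (A : 'M[R]_n) s : A \in unitmx -> 0 < s -> 0 < phi s A.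
Proof.
move=> Au s0; have [sn|ns] := leP s n%:R; first by rewrite phi_gt0// s0.
rewrite /phi (lt_geF ns) powR_gt0//; apply: prodr_gt0 => l _.
exact: sv_gt0.
Qed.

(** From [s] to [t] the exponents of the singular values grow by [t - s] in
    total, and every singular value is at most [c].  Beyond [n] the exponent acts
    on the determinant, which is at most [c ^+ n]. *)
Lemma phi_le_phi (A : 'M[R]_n) s t c : A \in unitmx -> 0 < s < n%:R -> s <= t ->
  0 < c <= 1 -> (forall x, enorm (A *m x) <= c * enorm x) ->
  phi t A <= c `^ (t - s) * phi s A.
Proof.
move=> Au /andP[s0 sn] st /andP[c0 c1] Ac.
have n0 : 0 < n%:R :> R by exact: lt_trans sn.
have H u : s <= u <= n%:R -> phi u A <= c `^ (u - s) * phi s A.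
  move=> /andP[su un].
  rewrite !phiE ?s0 ?(ltW sn) ?un ?(lt_le_trans s0)//.
  have -> : c `^ (u - s) = \prod_(l < n) c `^ (clip (u - l%:R) - clip (s - l%:R)).
    rewrite prod_powR// sumrB !sum_clip ?(ltW s0)// ?(le_trans (ltW s0))//.
    by rewrite !min_l// ltW.
  rewrite -big_split/=; apply: ler_prod => l _; rewrite powR_ge0/=.
  have al := sv_gt0 l Au.
  have -> : sv A l `^ clip (u - l%:R) =
      sv A l `^ (clip (u - l%:R) - clip (s - l%:R)) * sv A l `^ clip (s - l%:R).
    by rewrite -powRD ?subrK// (gt_eqF al) implybT.
  rewrite ler_wpM2r ?powR_ge0//; apply: ge0_ler_powR; rewrite ?nnegrE ?(ltW al) ?(ltW c0)//.
    by rewrite subr_ge0 le_clip// lerD2r.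
  exact: sv_le.
have [tn|nt] := leP t n%:R; first by rewrite H// st tn.
rewrite {1}/phi (lt_geF nt).
have nE : phi n%:R A = \prod_(l < n) sv A l.
  rewrite phiE// ?n0 ?lexx//; apply: eq_bigr => l _.
  rewrite clip1 ?powRr1//; first exact/ltW/sv_gt0.
  have ln : l.+1%:R <= n%:R :> R by rewrite ler_nat.
  by rewrite -natr1 in ln; lra.
rewrite -nE.
have p0 : 0 < phi n%:R A by rewrite phi_gt0 ?n0//=.
have -> : t / n%:R = 1 + (t - n%:R) / n%:R by field; rewrite gt_eqF.
rewrite powRD; last by rewrite (gt_eqF p0) implybT.
rewrite powRr1 ?(ltW p0)//.
apply: (@le_trans _ _ (phi n%:R A * c `^ (t - n%:R))).
  rewrite ler_wpM2l ?(ltW p0)//.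
  have tnE : t - n%:R = n%:R * ((t - n%:R) / n%:R) by field; rewrite gt_eqF.
  rewrite [in leRHS]tnE [leRHS]powRrM.
  apply: ge0_ler_powR; rewrite ?nnegrE ?powR_ge0 ?(ltW p0)//.
  - by rewrite divr_ge0 ?subr_ge0 ?(ltW nt) ?(ltW n0).
  - rewrite powR_mulrn ?(ltW c0)// nE -[X in c ^+ X]card_ord -prodr_const.
    by apply: ler_prod => l _; rewrite ltW ?sv_gt0//= sv_le.
apply: (@le_trans _ _ (c `^ (n%:R - s) * phi s A * c `^ (t - n%:R))).
  by rewrite ler_wpM2r ?powR_ge0// H// lexx ltW.
rewrite mulrAC -powRD ?(gt_eqF c0) ?implybT//.
by rewrite addrC -addrA (addrA (- _)) addNr add0r.
Qed.

Lemma phi_le (A : 'M[R]_n) s c : A \in unitmx -> 0 < s <= n%:R ->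
  0 < c -> (forall x, enorm (A *m x) <= c * enorm x) -> phi s A <= c `^ s.
Proof.
move=> Au /andP[s0 sn] c0 Ac; rewrite phiE ?s0//.
have -> : c `^ s = \prod_(l < n) c `^ clip (s - l%:R).
  by rewrite prod_powR// sum_clip ?(ltW s0)// min_l.
apply: ler_prod => l _; rewrite powR_ge0/=.
by apply: ge0_ler_powR; rewrite ?nnegrE ?clip_ge0 ?(ltW c0) ?sv_le// ltW// sv_gt0.
Qed.

End singular_value_function.

(** * Coverings of rotated boxes *)

Section coverings.
Context {R : realType}.

Lemma powR_divM (x a e : R) : 0 <= x -> 0 < a -> (x / a) `^ e = x `^ e / a `^ e.
Proof.
move=> x0 a0; rewrite powRM ?invr_ge0 ?(ltW a0)//; congr (_ * _).
by rewrite -powR_inv1 ?(ltW a0)// -powRrM mulN1r powRN.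
Qed.

(** Interpolation between the exponents 0 and 1. *)
Lemma min_le_powR (R0 x e : R) : 1 <= R0 -> 0 < x -> 0 <= e <= 1 ->
  Num.min R0 x <= R0 * x `^ e.
Proof.
move=> R01 x0 /andP[e0 e1]; have R00 : 0 <= R0 by rewrite (le_trans ler01).
have [x1|x1] := leP 1 x.
  apply: (@le_trans _ _ R0); first by rewrite ge_min lexx.
  rewrite ler_peMr//; have := @ge0_ler_powR R e e0 1 x.
  by rewrite powR1 !nnegrE; apply => //; exact: ltW.
apply: (@le_trans _ _ x); first by rewrite ge_min lexx orbT.
apply: (@le_trans _ _ (x `^ e)); last by rewrite ler_peMl ?powR_ge0.
by rewrite -{1}(powRr1 (ltW x0)) ger_powR// x0 ltW.
Qed.

(** In the coordinates given by [Q] the points of a grid of step [eta] are within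
    [eta] of every point of the box, coordinate by coordinate; the grid has at
    most [2 * l i / eta + 1] points along the side [i]. *)
Lemma cover_rotated_box n (Q : 'M[R]_n) (b l : 'I_n -> R) (eta : R) :
  orthogonal Q -> (forall i, 0 <= l i) -> 0 < eta ->
  exists xs : seq 'cV[R]_n,
    (size xs)%:R <= \prod_i (2 * l i / eta + 1) /\
    forall y : 'cV[R]_n, (forall i, `|(Q *m y) i 0 - b i| <= l i) ->
      exists2 x, x \in xs & enorm (y - x) <= Num.sqrt n%:R * eta.
Proof.
move=> Qo l0 eta0.
have q0 i : 0 <= 2 * l i / eta by rewrite divr_ge0 ?mulr_ge0// ltW.
pose m i := Num.truncn (2 * l i / eta).
pose M := \max_i m i.
pose F (i : 'I_n) := [pred k : 'I_M.+1 | (k <= m i)%N].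
pose pt (f : {ffun 'I_n -> 'I_M.+1}) :=
  Q^T *m \col_i (b i - l i + (f i)%:R * eta).
exists (map pt (enum (family F))); split.
  rewrite size_map -cardE card_family.
  have -> : foldr muln 1%N [seq #|F x| | x : 'I_n] = (\prod_i #|F i|)%N.
    by rewrite foldrE big_image.
  rewrite natr_prod; apply: ler_prod => i _; rewrite ler0n/=.
  apply: (@le_trans _ _ ((m i).+1)%:R).
    rewrite ler_nat -[leqRHS]card_ord.
    pose g (k : 'I_M.+1) : 'I_(m i).+1 := inord k.
    rewrite -(@card_in_imset _ _ g); first exact: max_card.
    move=> j k; rewrite !inE => jm km /(congr1 val); rewrite /= !inordK//.
    exact: val_inj.
  by rewrite -natr1 lerD2r truncn_le.
move=> y yb.
pose v i := ((Q *m y) i 0 - b i + l i) / eta.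
have v0 i : 0 <= v i.
  by rewrite divr_ge0 ?(ltW eta0)//; have := yb i; rewrite ler_norml; lra.
have vm i : (Num.truncn (v i) <= m i)%N.
  apply: le_truncn; rewrite ler_pM2r ?invr_gt0//.
  by have := yb i; rewrite ler_norml; lra.
have mM i : (m i < M.+1)%N by rewrite ltnS; exact: leq_bigmax.
pose f : {ffun 'I_n -> 'I_M.+1} := [ffun i => inord (Num.truncn (v i))].
have fE i : f i = Num.truncn (v i) :> nat.
  by rewrite ffunE inordK// (leq_ltn_trans (vm i)).
exists (pt f).
  apply: map_f; rewrite mem_enum; apply/familyP => i.
  by rewrite inE fE.
have QQ := orthogonal_tr Qo; rewrite /orthogonal trmxK in QQ.
have -> : y - pt f = Q^T *m (Q *m y - \col_i (b i - l i + (f i)%:R * eta)).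
  by rewrite mulmxBr mulmxA QQ mul1mx.
rewrite (enorm_orthogonal _ (orthogonal_tr Qo)).
apply: enorm_le_coord; first exact: ltW.
move=> i; rewrite [X in `|X|]mxE [X in _ + X]mxE [X in _ - X]mxE fE.
have /andP[t1 t2] := truncn_itv (v0 i).
have vE : (Q *m y) i 0 = v i * eta + b i - l i.
  by rewrite /v divfK ?gt_eqF//; ring.
have t1' : (Num.truncn (v i))%:R * eta <= v i * eta by rewrite ler_wpM2r// ltW.
have t2' : v i * eta <= ((Num.truncn (v i))%:R + 1) * eta.
  by rewrite ler_wpM2r ?(ltW eta0)// natr1 ltW.
rewrite mulrDl mul1r in t2'.
by rewrite vE ler_norml; lra.
Qed.

(** Within the ball of radius [R0], the preimage under [A] of a ball is contained
    in a box with sides along the right singular vectors and half-lengths the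
    minimum of [R0] and [rho / sv A i].  A grid with a step below every
    half-length yields a covering by balls of total volume comparable with that
    of the box, which [min_le_powR] bounds by a constant times
    [rho `^ s / phi s A].  The volume is expressed with [h ^+ n], so that each
    ball may be enlarged to a cube with sides parallel to the axes. *)
Lemma cover_preimage n (A : 'M[R]_n) (c : 'cV[R]_n) (rho R0 s : R) :
  A \in unitmx -> 0 < s <= n%:R -> 0 < rho -> 1 <= R0 ->
  exists xs : seq 'cV[R]_n, exists2 h : R, 0 < h &
    (forall u, enorm u <= R0 -> enorm (c + A *m u) <= rho ->
      exists2 x, x \in xs & enorm (u - x) <= h) /\
    (size xs)%:R * h ^+ n <=
      (3 * R0 * Num.sqrt n%:R) ^+ n * (rho `^ s / phi s A).
Proof.
move=> Au /andP[s0 sn] rho0 R01.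
have [_ _ [U [V [Uo Vo AE]]]] := singular_value_decomposition Au.
have a0 (i : 'I_n) : 0 < sv A i by exact: sv_gt0.
have R00 : 0 < R0 by lra.
pose l (i : 'I_n) := Num.min R0 (rho / sv A i).
have l0 i : 0 < l i by rewrite /l lt_min R00 divr_gt0.
(* any positive step below all the sides would do *)
pose eta := (1 + \sum_i (l i)^-1)^-1.
have S0 : 0 <= \sum_i (l i)^-1 by apply: sumr_ge0 => i _; rewrite invr_ge0 ltW.
have eta0 : 0 < eta by rewrite invr_gt0; lra.
have etal i : eta <= l i.
  rewrite -[l i]invrK /eta lef_pV2 ?posrE ?invr_gt0//; last lra.
  rewrite (bigD1 i)//= addrCA lerDl addr_ge0// sumr_ge0// => j _.
  by rewrite invr_ge0 ltW.
pose w := U^T *m c.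
(* the constraint on the coordinate [i] comes from [R0] or from [rho] *)
pose b (i : 'I_n) := if R0 <= rho / sv A i then 0 else - (w i 0 / sv A i).
have [xs [xsize xcov]] := cover_rotated_box b Vo (fun i => ltW (l0 i)) eta0.
have n0 : 0 < Num.sqrt n%:R :> R.
  rewrite sqrtr_gt0; exact: lt_le_trans sn.
exists xs, (Num.sqrt n%:R * eta); first by rewrite mulr_gt0.
split.
  move=> u uR ucA; apply: xcov => i.
  rewrite /b /l; have [Ri|Ri] := leP R0 (rho / sv A i).
    by rewrite subr0 (le_trans (coord_le_enorm _ _))// enorm_orthogonal.
  rewrite opprK.
  have := coord_le_enorm (U^T *m (c + A *m u)) i.
  rewrite (enorm_orthogonal _ (orthogonal_tr Uo)) => /le_trans/(_ ucA).
  have UU := orthogonal_tr Uo; rewrite /orthogonal trmxK in UU.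
  rewrite mulmxDr -/w {1}AE -!mulmxA (mulmxA U^T) UU mul1mx mul_diag_mx.
  rewrite [X in `|X|]mxE [X in _ + X]mxE [X in X * _]mxE -/(sv A i) => H.
  rewrite ler_pdivlMr// -{2}(gtr0_norm (a0 i)) -normrM mulrDl divfK ?gt_eqF//.
  by rewrite mulrC addrC.
apply: (@le_trans _ _ ((\prod_i (2 * l i / eta + 1)) * (Num.sqrt n%:R * eta) ^+ n)).
  by rewrite ler_wpM2r ?exprn_ge0 ?mulr_ge0 ?(ltW n0) ?(ltW eta0).
have E (x : R) : x ^+ n = \prod_(i < n) x by rewrite prodr_const card_ord.
have -> : rho `^ s / phi s A =
    \prod_(i < n) (rho `^ clip (s - i%:R) / sv A i `^ clip (s - i%:R)).
  rewrite phiE ?s0// prodf_div prod_powR// sum_clip ?(ltW s0)//.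
  by rewrite min_l.
rewrite !E -!big_split/=; apply: ler_prod => i _; apply/andP; split.
  apply: mulr_ge0; last by rewrite mulr_ge0 ?(ltW n0) ?(ltW eta0).
  by rewrite addr_ge0// divr_ge0 ?(ltW eta0)// mulr_ge0// ltW.
apply: (@le_trans _ _ (3 * l i / eta * (Num.sqrt n%:R * eta))).
  rewrite ler_wpM2r ?mulr_ge0 ?(ltW n0) ?(ltW eta0)//.
  have : 1 <= l i / eta by rewrite ler_pdivlMr// mul1r.
  by rewrite -!mulrA; lra.
have -> : 3 * l i / eta * (Num.sqrt n%:R * eta) = 3 * Num.sqrt n%:R * l i.
  by field; rewrite gt_eqF.
rewrite -powR_divM ?(ltW rho0)// [leRHS](_ : _ = 3 * Num.sqrt n%:R *
  (R0 * (rho / sv A i) `^ clip (s - i%:R))); last by ring.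
rewrite ler_wpM2l ?mulr_ge0 ?(ltW n0)//.
by rewrite min_le_powR ?divr_gt0// clip_ge0 clip_le1.
Qed.

End coverings.

(** * Mesh cubes *)

Section mesh.
Context {R : realType}.

Definition mesh_index n (r : R) (y : 'cV[R]_n) : 'cV[int]_n :=
  \col_i Num.floor (y i 0 / r).

Lemma mesh_cubeE n (r : R) (j : 'cV[int]_n) y : 0 < r ->
  mesh_cube r j y <-> mesh_index r y = j.
Proof.
move=> r0; split => [H|<- i]; last first.
  rewrite mxE; have /andP[h1 h2] := floor_itv (y i 0 / r).
  by rewrite -ler_pdivlMr// h1 -ltr_pdivrMr// h2.
apply/matrixP => i k; rewrite (ord1 k) mxE; apply/floor_def.
by rewrite ler_pdivlMr// ltr_pdivrMr// H.
Qed.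

Lemma mesh_cube_dist n (r : R) (x y : 'cV[R]_n) : 0 < r ->
  mesh_index r x = mesh_index r y -> enorm (x - y) <= Num.sqrt n%:R * r.
Proof.
move=> r0 /esym xy; apply: enorm_le_coord; first exact: ltW.
have := iffRL (mesh_cubeE (mesh_index r x) x r0) erefl.
have := iffRL (mesh_cubeE (mesh_index r x) y r0) xy.
move=> Hy Hx i; have := Hy i; have := Hx i; rewrite intrD mulrDl mul1r.
have -> : (x - y) i ord0 = x i ord0 - y i ord0 by rewrite !mxE.
by rewrite ler_norml; lra.
Qed.

(** The index of [y] differs from that of [z] by at most [M] in each coordinate.
    The bound does not depend on the scale. *)
Lemma mesh_ball n : exists K : nat, forall (z : 'cV[R]_n) r, 0 < r ->
  exists js : seq 'cV[int]_n, (size js <= K)%N /\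
    forall y, enorm (y - z) <= Num.sqrt n%:R * r -> mesh_index r y \in js.
Proof.
pose M := (Num.truncn (Num.sqrt n%:R : R)).+2.
exists #|{ffun 'I_n -> 'I_(M + M).+1}| => z r r0.
pose pt (f : {ffun 'I_n -> 'I_(M + M).+1}) : 'cV[int]_n :=
  \col_i (Num.floor (z i 0 / r) + (f i)%:Z - M%:Z).
exists (map pt (enum {: {ffun 'I_n -> 'I_(M + M).+1}})); split.
  by rewrite size_map -cardE.
move=> y yz.
have yzi i : `|y i 0 / r - z i 0 / r| <= Num.sqrt n%:R.
  rewrite -mulrBl normrM (gtr0_norm (_ : 0 < r^-1)) ?invr_gt0// ler_pdivrMr//.
  by apply: le_trans yz; have := coord_le_enorm (y - z) i; rewrite !mxE.
have Mgt : Num.sqrt n%:R + 1 < M%:R :> R.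
  by rewrite /M -natr1 ltrD2r; exact: truncnS_gt.
have fl i : `|(Num.floor (y i 0 / r) - Num.floor (z i 0 / r))%:~R| <= M%:R :> R.
  have := yzi i; rewrite intrB.
  have := floor_itv (y i 0 / r); have := floor_itv (z i 0 / r).
  by rewrite !intrD !ler_norml; lra.
pose k i : nat := absz (Num.floor (y i 0 / r) - Num.floor (z i 0 / r) + M%:Z)%R.
have kE i : (k i)%:Z = Num.floor (y i 0 / r) - Num.floor (z i 0 / r) + M%:Z.
  rewrite /k gez0_abs// -(ler_int R) intrD -pmulrn.
  by have := fl i; rewrite ler_norml; lra.
have kM i : (k i < (M + M).+1)%N.
  rewrite ltnS -(ler_nat R) natrD pmulrn kE intrD -pmulrn lerD2r.
  by have := fl i; rewrite ler_norml; lra.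
apply/mapP; exists [ffun i => Ordinal (kM i)]; first by rewrite mem_enum.
apply/matrixP => i o; rewrite !mxE ffunE /= kE; ring.
Qed.

(** The image of the ball lies in a box along the left singular vectors, which is
    covered by balls of radius comparable with [r]; each of them meets a bounded
    number of mesh cubes. *)
Lemma cover_image n : exists2 K : R, 0 < K & forall (A : 'M[R]_n) c R0 r,
  A \in unitmx -> 0 < R0 -> 0 < r -> exists js : seq 'cV[int]_n,
    (size js)%:R <= K * \prod_(l < n) (2 * (sv A l * R0) / r + 1) /\
    forall x, enorm x <= R0 -> mesh_index r (c + A *m x) \in js.
Proof.
have [K HK] := mesh_ball n; exists K.+1%:R => // A c R0 r Au R00 r0.
have [_ _ [U [V [Uo Vo AE]]]] := singular_value_decomposition Au.
have UU := orthogonal_tr Uo; rewrite /orthogonal trmxK in UU.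
have a0 (i : 'I_n) : 0 < sv A i by exact: sv_gt0.
have [xs [xsize xcov]] := cover_rotated_box (fun=> 0) (orthogonal_tr Uo)
  (fun i => mulr_ge0 (ltW (a0 i)) (ltW R00)) r0.
have /choice[g gP] : forall x, exists js : seq 'cV[int]_n, (size js <= K)%N /\
    forall y, enorm (y - x) <= Num.sqrt n%:R * r -> mesh_index r y \in js.
  by move=> x; exact: HK.
exists (flatten [seq g (c + x) | x <- xs]); split.
  apply: (@le_trans _ _ (K.+1%:R * (size xs)%:R)); last by rewrite ler_wpM2l.
  rewrite -natrM ler_nat size_flatten /shape -map_comp.
  elim: xs {xsize xcov} => //= x xs IH; rewrite mulnS leq_add//.
  by have [gx _] := gP (c + x); rewrite (leq_trans gx).
move=> x xR; have [|y yxs yd] := xcov (A *m x).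
  move=> i; rewrite subr0 {1}AE -!mulmxA (mulmxA U^T) UU mul1mx mul_diag_mx.
  rewrite mxE [X in X * _]mxE -/(sv A i) normrM (gtr0_norm (a0 i)).
  rewrite ler_wpM2l ?(ltW (a0 i))// (le_trans (coord_le_enorm _ _))//.
  by rewrite enorm_orthogonal.
apply/flattenP; exists (g (c + y)); first by apply: map_f.
have [_] := gP (c + y); apply.
by rewrite (_ : c + A *m x - (c + y) = A *m x - y)// opprD addrACA subrr add0r.
Qed.

(** Let [x := sv A l / r].  The factor [2 * R0 * x + 1] is of order [x] before the
    singular value at which [phi] stops, where [x > 1 / 2], and of order 1 after
    it, where [x <= 1].  At that singular value [x] is between [1 / 2] and 1 and
    the exponent does not matter. *)
Lemma prod_sv_le_phi n (A : 'M[R]_n) s R0 r : A \in unitmx -> 0 < s <= n%:R ->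
  0 < R0 -> 0 < r -> r / 2 < sv A (`|Num.ceil s|%N).-1 <= r ->
  \prod_(l < n) (2 * (sv A l * R0) / r + 1) <=
    (4 * R0 + 2) ^+ n * (phi s A / r `^ s).
Proof.
move=> Au /andP[s0 sn] R00 r0 /andP[rj jr].
set j := `|Num.ceil s|%N in rj jr.
have /andP[cl cr] := ceil_itv s.
have c0 : 0 < Num.ceil s by rewrite ceil_gt0.
have jE : j%:R = (Num.ceil s)%:~R :> R by rewrite pmulrn /j gez0_abs// ltW.
have j0 : (0 < j)%N by rewrite /j absz_gt0 gt_eqF.
have sj : s <= j%:R by rewrite jE.
have js : j%:R - 1 < s by move: cl; rewrite intrB -jE.
have jn : (j <= n)%N.
  rewrite leqNgt; apply/negP => nj; have : n.+1%:R <= j%:R :> R by rewrite ler_nat.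
  by rewrite -natr1; lra.
have jj : j = j.-1.+1 by rewrite prednK.
have jn' : (j.-1 < n)%N by rewrite -jj.
have jR : j%:R = j.-1%:R + 1 :> R by rewrite {1}jj natr1.
have E (x : R) : x ^+ n = \prod_(i < n) x by rewrite prodr_const card_ord.
rewrite E.
have -> : phi s A / r `^ s =
    \prod_(i < n) (sv A i `^ clip (s - i%:R) / r `^ clip (s - i%:R)).
  rewrite phiE ?s0// prodf_div prod_powR// sum_clip ?(ltW s0)//.
  by rewrite min_l.
rewrite -big_split/=; apply: ler_prod => l _; have al := sv_gt0 l Au.
rewrite -powR_divM ?(ltW al)// -mulrA.
set x := sv A l / r; have x0 : 0 < x by rewrite divr_gt0.
have -> : 2 * (sv A l * R0 / r) = 2 * R0 * x by rewrite /x; ring.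
apply/andP; split; first by have := mulr_gt0 R00 x0; lra.
have [lj|lj|lj] := ltngtP l j.-1.
- have : sv A j.-1 <= sv A l by exact: (sv_decreasing (l := Ordinal jn') Au (ltnW lj)).
  move=> jl; have x12 : 1 / 2 < x by rewrite /x ltr_pdivlMr//; lra.
  have lR : l.+1%:R <= j.-1%:R :> R by rewrite ler_nat.
  rewrite -natr1 in lR.
  rewrite clip1; last by lra.
  by rewrite powRr1 ?(ltW x0)//; nra.
- have : sv A l <= sv A j.-1.
    by have := sv_decreasing (k := Ordinal jn') Au (ltnW lj).
  move=> jl; have x1 : x <= 1 by rewrite /x ler_pdivrMr//; lra.
  have lR : j.-1.+1%:R <= l%:R :> R by rewrite ler_nat.
  rewrite -natr1 in lR.
  rewrite clip0; last by lra.
  by rewrite powRr0; nra.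
- have x1 : 1 / 2 < x <= 1.
    by rewrite /x lj ltr_pdivlMr// ler_pdivrMr//; apply/andP; split; lra.
  have lR : l%:R = j.-1%:R :> R by rewrite lj.
  rewrite clip_id; last by apply/andP; split; lra.
  have : x <= x `^ (s - l%:R).
    rewrite -{1}(powRr1 (ltW x0)) ger_powR//; last lra.
    by case/andP: x1 => _ ->; rewrite x0.
  by case/andP: x1; nra.
Qed.

End mesh.

(** * The projection of the code space *)

Section operator_norm.
Context {R : realType}.

Lemma mulmx_bounded n (A : 'M[R]_n) :
  exists2 C, 0 < C & forall x, enorm (A *m x) <= C * enorm x.
Proof.
pose S := \sum_i \sum_j `|A i j|.
have S0 : 0 <= S by apply: sumr_ge0 => i _; exact: sumr_ge0.
exists (Num.sqrt n%:R * S + 1); first by rewrite ltr_pwDr// mulr_ge0.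
move=> x; apply: (@le_trans _ _ (Num.sqrt n%:R * (S * enorm x))).
  apply: enorm_le_coord; first by rewrite mulr_ge0// enorm_ge0.
  move=> i; rewrite mxE (le_trans (ler_norm_sum _ _ _))//.
  apply: (@le_trans _ _ ((\sum_j `|A i j|) * enorm x)); last first.
    rewrite ler_wpM2r ?enorm_ge0// /S [leRHS](bigD1 i)//= lerDl.
    by apply: sumr_ge0 => k _; exact: sumr_ge0.
  rewrite mulr_suml; apply: ler_sum => j _; rewrite normrM ler_wpM2l//.
  exact: coord_le_enorm.
by rewrite mulrDl mul1r mulrA lerDl enorm_ge0.
Qed.

Lemma enorm_mulmx n (A : 'M[R]_n) x : enorm (A *m x) <= opnorm A * enorm x.
Proof.
have [C C0 AC] := mulmx_bounded A.
have [->|x0] := eqVneq x 0; first by rewrite mulmx0 !enorm0 mulr0.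
have e0 : 0 < enorm x by rewrite lt_neqAle enorm_ge0 andbT eq_sym enorm_eq0.
rewrite -ler_pdivrMr//.
have -> : enorm (A *m x) / enorm x = enorm (A *m ((enorm x)^-1 *: x)).
  by rewrite -scalemxAr enormZ ger0_norm ?invr_ge0 ?(ltW e0)// mulrC.
apply: sup_upper_bound; last first.
  exists ((enorm x)^-1 *: x) => //=.
  by rewrite enormZ ger0_norm ?invr_ge0 ?(ltW e0)// mulVf ?gt_eqF.
split; first by exists (enorm (A *m 0)), 0 => //=; rewrite enorm0.
exists C => _ [y /= y1 <-]; apply: le_trans (AC y) _.
by rewrite -[leRHS]mulr1 ler_wpM2l// ltW.
Qed.

Lemma common_contraction_ratio n (I : finType) (T : I -> 'M[R]_n) :
  (forall i, opnorm (T i) < 1) ->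
  exists2 a, 0 < a < 1 & forall i x, enorm (T i *m x) <= a * enorm x.
Proof.
move=> T1; pose a := \big[Num.max/(1 / 2)]_i opnorm (T i).
have ha : 1 / 2 <= a by exact: bigmax_ge_id.
have a1 : a < 1 by apply/bigmax_ltP; split => [|i _]; [lra|exact: T1].
exists a; first by apply/andP; split; [lra|].
move=> i x; apply: (@le_trans _ _ (opnorm (T i) * enorm x)).
  exact: enorm_mulmx.
apply: ler_wpM2r; first exact: enorm_ge0.
exact: (le_bigmax _ (fun i => opnorm (T i))).
Qed.

Lemma mx_norm_le_enorm n (x : 'cV[R]_n) : `|x| <= enorm x.
Proof.
rewrite [leLHS]mx_normrE; apply/bigmax_leP; split => [|[i j] _]; first exact: enorm_ge0.
by rewrite /= ord1; exact: coord_le_enorm.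
Qed.

Lemma enorm_le_mx_norm n (x : 'cV[R]_n) : enorm x <= Num.sqrt n%:R * `|x|.
Proof.
apply: enorm_le_coord => // i; rewrite [leRHS]mx_normrE.
exact: (le_bigmax _ (fun ij => `|x ij.1 ij.2|) (i, 0)).
Qed.

End operator_norm.

Section projections.
Context {R : realType} {N m : nat}.
Variables (T : 'I_m.+1 -> 'M[R]_N) (a : R).
Hypothesis T_unit : forall i, T i \in unitmx.
Hypothesis a01 : 0 < a < 1.
Hypothesis T_contr : forall i x, enorm (T i *m x) <= a * enorm x.

Local Notation word := (seq 'I_m.+1).

Lemma word_map_nil : word_map T [::] = 1%:M.
Proof. by rewrite /word_map big_nil. Qed.

Lemma word_map_cat u v : word_map T (u ++ v) = word_map T u *m word_map T v.
Proof.
rewrite /word_map; elim: u => [|i u IH]; first by rewrite big_nil mul1mx.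
by rewrite cat_cons !big_cons IH mulmxA.
Qed.

Lemma word_map_unit u : word_map T u \in unitmx.
Proof.
rewrite /word_map; elim: u => [|i u IH]; first by rewrite big_nil unitmx1.
by rewrite big_cons unitmx_mul T_unit.
Qed.

Lemma word_map_contr u x : enorm (word_map T u *m x) <= a ^+ size u * enorm x.
Proof.
have /andP[a0 a1] := a01; rewrite /word_map.
elim: u => [|i u IH]; first by rewrite big_nil mul1mx mul1r.
rewrite big_cons -mulmxA exprS -mulrA (le_trans (T_contr _ _))//.
by rewrite ler_wpM2l// ltW.
Qed.

Definition partial_sum (om : word -> 'cV[R]_N) (w : word) : 'cV[R]_N :=
  \sum_(k < size w) word_map T (take k w) *m om (take k.+1 w).

Lemma partial_sum_cat om u v : partial_sum om (u ++ v) =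
  partial_sum om u + word_map T u *m partial_sum (fun w => om (u ++ w)) v.
Proof.
rewrite /partial_sum size_cat big_split_ord/=; congr (_ + _).
  apply: eq_bigr => k _; rewrite !takel_cat ?(ltnW (ltn_ord k))//.
rewrite mulmx_sumr; apply: eq_bigr => k _.
rewrite mulmxA -word_map_cat -addnS !take_cat !ltnNge !leq_addr/=.
by rewrite !addKn.
Qed.

Lemma enorm_partial_sum om w b : 0 <= b -> (forall i, enorm (om i) <= b) ->
  enorm (partial_sum om w) <= b / (1 - a).
Proof.
move=> b0 omb; have /andP[a0 a1] := a01.
apply: (@le_trans _ _ (\sum_(k < size w) a ^+ k * b)).
  rewrite /partial_sum.
  elim/big_rec2 : _ => [|k y x _ xy]; first by rewrite enorm0.
  apply: le_trans (enormD _ _) _; apply: lerD => //.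
  apply: le_trans (word_map_contr _ _) _.
  by rewrite size_takel ?(ltnW (ltn_ord k))// ler_wpM2l ?exprn_ge0 ?(ltW a0).
by rewrite -mulr_suml mulrC ler_wpM2l// geometric_sum_le// a1 ltW.
Qed.

Lemma partial_sumB om om' w : partial_sum om w - partial_sum om' w =
  partial_sum (fun i => om i - om' i) w.
Proof.
by rewrite /partial_sum -sumrB; apply: eq_bigr => k _; rewrite mulmxBr.
Qed.

Lemma eq_partial_sum om om' w :
  (forall k, (k < size w)%N -> om (take k.+1 w) = om' (take k.+1 w)) ->
  partial_sum om w = partial_sum om' w.
Proof. by move=> E; apply: eq_bigr => k _; rewrite E. Qed.

Lemma size_prefix_word (x : nat -> 'I_m.+1) k : size (prefix_word x k) = k.
Proof. exact: size_mkseq. Qed.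

Lemma take_prefix_word (x : nat -> 'I_m.+1) j k : (j <= k)%N ->
  take j (prefix_word x k) = prefix_word x j.
Proof.
by move=> jk; rewrite /prefix_word /mkseq -map_take take_iota (minn_idPl jk).
Qed.

Lemma series_projection om (x : borel_code m) n :
  series (fun k => word_map T (prefix_word x k) *m om (prefix_word x k.+1)) n =
  partial_sum om (prefix_word x n).
Proof.
rewrite /series/= /partial_sum size_prefix_word big_mkord.
apply: eq_bigr => k _; rewrite !take_prefix_word//.
exact: ltnW.
Qed.

Variables (om : word -> 'cV[R]_N) (b : R).
Hypothesis b_ge0 : 0 <= b.
Hypothesis om_bounded : forall i, enorm (om i) <= b.

Lemma cvg_projection (x : borel_code m) :
  (fun n => partial_sum om (prefix_word x n)) @ \oo --> projection T om x.
Proof.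
set u := fun k => word_map T (prefix_word x k) *m om (prefix_word x k.+1).
have -> : (fun n => partial_sum om (prefix_word x n)) = series u.
  by apply/funext => n; rewrite -series_projection.
suff : cvgn (series u) by [].
have : cvgn (series (fun k => `|u k|)).
  apply: (@series_le_cvg _ _ (geometric b a)) => //.
  - by move=> n; rewrite /= mulr_ge0 ?exprn_ge0//; case/andP: a01 => /ltW.
  - move=> n /=; rewrite (le_trans (mx_norm_le_enorm _))//.
    rewrite (le_trans (word_map_contr _ _))// size_prefix_word mulrC.
    by rewrite ler_wpM2r ?exprn_ge0//; case/andP: a01 => /ltW.
  apply: is_cvg_geometric_series; have /andP[a0 a1] := a01.
  by rewrite gtr0_norm.
move=> /cauchy_cvgP/cauchy_seriesP ucvg.
apply/cauchy_cvgP/cauchy_seriesP => e /ucvg.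
apply: filterS => n /=; rewrite ger0_norm ?sumr_ge0//.
by apply: le_lt_trans; apply: ler_norm_sum.
Qed.

(** Every point of the image of the cylinder of a word [w] is obtained by
    applying [word_map T w] to a vector of a ball whose radius does not depend
    on [w], and translating.  The vector is found by inverting [word_map T w]; it
    is a limit of partial sums along the rest of the infinite word, all of which
    are in the ball. *)
Lemma projection_split (x : borel_code m) k : exists2 y,
  enorm y <= b / (1 - a) & projection T om x =
    partial_sum om (prefix_word x k) + word_map T (prefix_word x k) *m y.
Proof.
set W := word_map T (prefix_word x k); set p := partial_sum om _.
have Wu : W \in unitmx by exact: word_map_unit.
exists (invmx W *m (projection T om x - p)); last first.
  by rewrite mulKVmx// addrC subrK.
have [C C0 WC] := mulmx_bounded (invmx W).
apply/ler_addgt0Pr => e e0.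
have eC0 : 0 < e / (C * (Num.sqrt N%:R + 1)).
  by rewrite divr_gt0// mulr_gt0// ltr_wpDl.
have /cvgrPdist_le/(_ _ eC0)[n _ nP] := @cvg_projection x.
have := nP (maxn n k) (leq_maxl _ _).
set S := partial_sum om (prefix_word x (maxn n k)) => nSp.
have [v Sv] : exists v, S = p + W *m partial_sum (fun w => om (prefix_word x k ++ w)) v.
  exists (drop k (prefix_word x (maxn n k))).
  rewrite /S -{1}(cat_take_drop k (prefix_word x (maxn n k))).
  by rewrite partial_sum_cat take_prefix_word// leq_maxr.
have -> : projection T om x - p = (projection T om x - S) + (S - p).
  by rewrite addrA subrK.
rewrite mulmxDr (le_trans (enormD _ _))// addrC lerD//.
  rewrite Sv addrAC subrr add0r mulKmx//.
  exact: enorm_partial_sum.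
apply: le_trans (WC _) _; rewrite -ler_pdivlMl// mulrC.
apply: le_trans (enorm_le_mx_norm _) _.
apply: (@le_trans _ _ ((Num.sqrt N%:R + 1) * (e / (C * (Num.sqrt N%:R + 1))))).
  by apply: ler_pM => //; rewrite lerDl.
rewrite le_eqVlt; apply/orP; left; apply/eqP; field.
by rewrite !gt_eqF// ltr_wpDl.
Qed.

(** Truncating at length [k] costs [a ^+ k] times the radius of the attractor. *)
Lemma projection_near (x : borel_code m) k :
  enorm (projection T om x - partial_sum om (prefix_word x k)) <=
    a ^+ k * (b / (1 - a)).
Proof.
have [y yb ->] := projection_split x k.
rewrite addrAC subrr add0r (le_trans (word_map_contr _ _))//.
by rewrite size_prefix_word ler_wpM2l// exprn_ge0//; case/andP: a01 => /ltW.
Qed.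

Lemma measurable_cylinder (w : word) : measurable (cylinder w).
Proof.
rewrite /cylinder.
have -> : [set x : borel_code m | prefix_word x (size w) = w] =
    \bigcap_(k in [set k | (k < size w)%N]) [set x | x k = nth ord0 w k].
  apply/seteqP; split => x /=.
    by move=> xw k /= kw; rewrite -xw nth_mkseq.
  move=> H; apply: (@eq_from_nth _ ord0); rewrite size_mkseq// => k kw.
  by rewrite nth_mkseq// H.
apply: fin_bigcap_measurable; first exact: finite_II.
move=> k _.
apply: sub_sigma_algebra => /=.
pose K (_ : nat) : topologicalType := discrete_topology 'I_m.+1.
have /continuousP pc : continuous (@proj nat K k : prod_topology K -> K k).
  exact: proj_continuous.
exact: (pc [set nth ord0 w k] (discrete_open _)).
Qed.

Lemma prefix_tuple_subproof (x : nat -> 'I_m.+1) n : size (prefix_word x n) == n.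
Proof. by rewrite size_prefix_word. Qed.

Definition prefix_tuple (x : nat -> 'I_m.+1) n : n.-tuple 'I_m.+1 :=
  Tuple (prefix_tuple_subproof x n).

Lemma cylinderP n (w : n.-tuple 'I_m.+1) (x : borel_code m) :
  cylinder w x <-> prefix_tuple x n = w.
Proof.
rewrite /cylinder /= size_tuple; split => [xw|<-//].
exact: val_inj.
Qed.

Lemma measurable_prefix_fun d' (V : measurableType d') n
    (f : n.-tuple 'I_m.+1 -> V) :
  measurable_fun setT (fun x : borel_code m => f (prefix_tuple x n)).
Proof.
move=> _ Y mY; rewrite setTI.
have -> : (fun x : borel_code m => f (prefix_tuple x n)) @^-1` Y =
    \bigcup_(w in [set w | Y (f w)]) cylinder (val w).
  apply/seteqP; split => x /=.
    by move=> Yx; exists (prefix_tuple x n) => //; apply/cylinderP.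
  by move=> [w /= Yw /cylinderP ->].
apply: fin_bigcup_measurable; first exact: finite_finset.
move=> w _; exact: measurable_cylinder.
Qed.

Lemma measurable_projection : measurable_fun setT (projection T om).
Proof.
apply: measurable_fun_cV => i.
apply: (@measurable_fun_cvg _ (borel_code m) R setT
  (fun n (x : borel_code m) => partial_sum om (prefix_word x n) i ord0)
  (fun x => projection T om x i ord0)).
  move=> n.
  exact: (measurable_prefix_fun (fun w : n.-tuple _ => partial_sum om w i ord0)).
move=> x _.
apply: (cvg_comp _ (fun M : 'cV[R]_N => M i ord0) (@cvg_projection x)).
exact: coord_continuous.
Qed.

End projections.

(** * Moments over mesh cubes *)

Section moments.
Context {R : realType}.

(** The convex function [y `^ q] lies above its tangent at [M]; this is Young's
    inequality for the exponents [q] and [q / (q - 1)]. *)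
Lemma powR_tangent (y M q : R) : 0 <= y -> 0 <= M -> 1 < q ->
  q * (y * M `^ (q - 1)) <= y `^ q + (q - 1) * M `^ q.
Proof.
move=> y0 M0 q1; have q0 : 0 < q by lra.
have q10 : 0 < q - 1 by lra.
have := @conjugate_powR _ y (M `^ (q - 1)) q (q / (q - 1)) y0 (powR_ge0 _ _) q0.
rewrite divr_gt0// => /(_ isT).
have -> : q^-1 + (q / (q - 1))^-1 = 1 by field; rewrite ?gt_eqF.
move=> /(_ erefl); rewrite -powRrM.
have -> : (q - 1) * (q / (q - 1)) = q by field; rewrite ?gt_eqF.
rewrite -(ler_pM2l q0) mulrDr.
have -> : q * (y `^ q / q) = y `^ q by field; rewrite ?gt_eqF.
suff -> : q * (M `^ q / (q / (q - 1))) = (q - 1) * M `^ q by [].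
by field; rewrite ?gt_eqF.
Qed.

(** The number of terms may be replaced by any upper bound [L], since the tangent
    at the mean value [X / L] is used rather than the mean over the actual number
    of terms. *)
Lemma power_mean (I : eqType) (s : seq I) (x : I -> R) (q L : R) : 1 < q ->
  (forall i, 0 <= x i) -> 0 < L -> (size s)%:R <= L ->
  L `^ (1 - q) * (\sum_(i <- s) x i) `^ q <= \sum_(i <- s) x i `^ q.
Proof.
move=> q1 x0 L0 sL; set X := \sum_(i <- s) x i.
have X0 : 0 <= X by exact: sumr_ge0.
pose M := X / L; have M0 : 0 <= M by rewrite divr_ge0// ltW.
have XE : X = L * M by rewrite /M mulrC divfK// gt_eqF.
have : \sum_(i <- s) (q * (x i * M `^ (q - 1))) <=
    \sum_(i <- s) (x i `^ q + (q - 1) * M `^ q).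
  by apply: ler_sum => i _; exact: powR_tangent.
rewrite -mulr_sumr -mulr_suml -/X big_split/= big_const_seq count_predT iter_addr_0.
rewrite -mulr_natr => H.
have : (q - 1) * M `^ q * (size s)%:R <= (q - 1) * M `^ q * L.
  by rewrite ler_wpM2l// mulr_ge0 ?powR_ge0//; lra.
have -> : L `^ (1 - q) * X `^ q = L * M `^ q.
  rewrite XE powRM ?(ltW L0)// mulrA -powRD; last by rewrite (gt_eqF L0) implybT.
  by rewrite subrK powRr1// ltW.
have ME : X * M `^ (q - 1) = L * M `^ q.
  by rewrite XE -mulrA mulr_powRB1//; lra.
by move: H; rewrite ME; lra.
Qed.

Lemma powR_superadditive (I : finType) (P : pred I) (x : I -> R) q :
  1 < q -> (forall i, 0 <= x i) ->
  \sum_(i | P i) x i `^ q <= (\sum_(i | P i) x i) `^ q.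
Proof.
move=> q1 x0; set X := \sum_(i | P i) x i.
have X0 : 0 <= X by exact: sumr_ge0.
have q10 : 0 < q - 1 by lra.
have -> : X `^ q = \sum_(i | P i) x i * X `^ (q - 1).
  by rewrite -mulr_suml mulr_powRB1//; lra.
apply: ler_sum => i Pi; rewrite -[leLHS]mulr_powRB1//; last lra.
rewrite ler_wpM2l//; apply: ge0_ler_powR; rewrite ?nnegrE ?(ltW q10)//.
by rewrite /X (bigD1 i)//= lerDl sumr_ge0.
Qed.

Lemma ler_sum_subset (I : eqType) (t s : seq I) (F : I -> R) :
  (forall i, 0 <= F i) -> uniq t -> uniq s -> {subset t <= s} ->
  \sum_(i <- t) F i <= \sum_(i <- s) F i.
Proof.
move=> F0 ut us ts; have tE : perm_eq t [seq i <- s | i \in t].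
  apply: uniq_perm; rewrite ?filter_uniq// => i; rewrite mem_filter.
  by rewrite andb_idr//; exact: ts.
rewrite (perm_big _ tE)/= big_filter [leRHS](bigID (mem t))/= lerDl.
exact: sumr_ge0.
Qed.

Lemma measurable_mesh_cube n (r : R) (j : 'cV[int]_n) :
  measurable (mesh_cube r j : set 'cV[R]_n).
Proof.
rewrite (_ : mesh_cube r j = \bigcap_(i in [set: 'I_n])
    ((fun v : 'cV[R]_n => v i ord0) @^-1`
      `[(j i ord0)%:~R * r, (j i ord0 + 1)%:~R * r[)); last first.
  apply/seteqP; split => v Hv i => [_|].
    by rewrite /= in_itv/=; exact: Hv.
  by have := Hv i I; rewrite /= in_itv.
apply: fin_bigcap_measurable => // i _.
rewrite -[X in measurable X]setTI; apply: measurable_cV_coord => //.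
Qed.

Section finite_measure.
Context d (X : measurableType d) (mu : {finite_measure set X -> \bar R}).

Definition mass_of (A : set X) : R := fine (mu A).

Lemma mass_ofE A : measurable A -> mu A = (mass_of A)%:E.
Proof. by move=> mA; rewrite fineK// fin_num_measure. Qed.

Lemma mass_of_ge0 A : 0 <= mass_of A.
Proof. exact: fine_ge0. Qed.

Lemma le_mass_of A B : measurable A -> measurable B -> A `<=` B ->
  mass_of A <= mass_of B.
Proof.
move=> mA mB AB; rewrite -lee_fin -!mass_ofE//.
by apply: le_measure; rewrite ?inE.
Qed.

Lemma mass_of_fibers (K : eqType) (f : X -> K) A (s : seq K) :
  (forall k, measurable (f @^-1` [set k])) -> measurable A -> uniq s ->
  \sum_(k <- s) mass_of (A `&` f @^-1` [set k]) =
    mass_of (A `&` [set x | f x \in s]).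
Proof.
move=> mf mA; have mfs (t : seq K) : measurable [set x | f x \in t].
  rewrite (_ : [set x | f x \in t] = \bigcup_(k in [set` t]) f @^-1` [set k]).
    by apply: fin_bigcup_measurable => //; exact: finite_seq.
  apply/seteqP; split => x /=; first by move=> xt; exists (f x).
  by move=> [k /= kt ->].
elim: s => [_|k s IH /= /andP[ks us]].
  rewrite big_nil (_ : [set x | f x \in [::]] = set0) ?setI0 /mass_of ?measure0//.
  by apply/seteqP; split.
have m1 : measurable (A `&` f @^-1` [set k]) by exact: measurableI.
have m2 : measurable (A `&` [set x | f x \in s]) by exact: measurableI.
have m3 : measurable (A `&` [set x | f x \in k :: s]) by exact: measurableI.
rewrite big_cons IH//; apply/eqP; rewrite -eqe EFinD -!mass_ofE// -measureU//.
  apply/eqP; congr (mu _); rewrite -setIUr; congr (_ `&` _).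
  apply/seteqP; split => x /=; rewrite inE.
    by move=> [->|->]; rewrite ?eqxx ?orbT.
  by move=> /orP[/eqP|]; [left|right].
apply/seteqP; split => x //= [[_ fk] [_ fs]].
by move: ks; rewrite -fk fs.
Qed.

Variables (n : nat) (f : X -> 'cV[R]_n) (r q : R).
Hypothesis mf : measurable_fun setT f.
Hypothesis r_gt0 : 0 < r.
Hypothesis q_gt1 : 1 < q.

Local Notation idx := (fun x => mesh_index r (f x)).
Local Notation tau := (pushforward mu f).

Lemma preimage_mesh_cube j : f @^-1` (mesh_cube r j) = idx @^-1` [set j].
Proof. by apply/seteqP; split => x /= /mesh_cubeE; apply. Qed.

Lemma measurable_idx j : measurable (idx @^-1` [set j]).
Proof.
rewrite -preimage_mesh_cube -[X in measurable X]setTI.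
apply: mf => //; exact: measurable_mesh_cube.
Qed.

Lemma pushforward_mesh_cube j :
  tau (mesh_cube r j) = (mass_of (idx @^-1` [set j]))%:E.
Proof.
by rewrite /pushforward preimage_mesh_cube mass_ofE//; exact: measurable_idx.
Qed.

Lemma sum_le_mesh_moment (s : seq 'cV[int]_n) : uniq s ->
  ((\sum_(j <- s) mass_of (idx @^-1` [set j]) `^ q)%:E <= mesh_moment tau q r)%E.
Proof.
move=> us; rewrite /mesh_moment; apply: esum_ge.
pose t := [seq j <- s | (0 < tau (mesh_cube r j))%E].
exists [set` t].
  split; first exact: finite_seq.
  by move=> j /=; rewrite mem_filter => /andP[].
rewrite -fsbig_seq ?filter_uniq// big_filter -sumEFin.
rewrite (bigID (fun j => (0 < tau (mesh_cube r j))%E))/= [X in (_ + X)%E]big1.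
  rewrite adde0; apply: lee_sum => j _.
  by rewrite pushforward_mesh_cube poweR_EFin.
move=> j; rewrite pushforward_mesh_cube lte_fin -leNgt => j0.
have -> : mass_of (idx @^-1` [set j]) = 0.
  by apply/eqP; rewrite eq_le j0 mass_of_ge0.
by rewrite powR0// gt_eqF// (lt_trans _ q_gt1).
Qed.

Lemma mesh_moment_le_sum (B : R) :
  (forall s : seq 'cV[int]_n, uniq s ->
     \sum_(j <- s) mass_of (idx @^-1` [set j]) `^ q <= B) ->
  (mesh_moment tau q r <= B%:E)%E.
Proof.
move=> H; apply: ge_ereal_sup => _ [Y [/finite_fsetP[F ->] _] <-].
rewrite -fsbig_seq ?fset_uniq//.
have := H F (fset_uniq F); rewrite -lee_fin -sumEFin; apply: le_trans.
by apply: lee_sum => j _; rewrite pushforward_mesh_cube poweR_EFin.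
Qed.

(** The fiber of [g] above [i] is cut by at most [L i] cubes, so convexity of the
    power [q] bounds its contribution from below; the contributions of disjoint
    fibers to the same cube add up because the power is superadditive. *)
Lemma mesh_moment_ge (I : finType) (g : X -> I) (P : pred I)
    (js : I -> seq 'cV[int]_n) (L : I -> R) :
  (forall i, measurable (g @^-1` [set i])) ->
  (forall i, P i -> 0 < L i) -> (forall i, P i -> (size (js i))%:R <= L i) ->
  (forall x, P (g x) -> idx x \in js (g x)) ->
  ((\sum_(i | P i) L i `^ (1 - q) * mass_of (g @^-1` [set i]) `^ q)%:E
     <= mesh_moment tau q r)%E.
Proof.
move=> mg L0 sL H.
pose s := undup (flatten [seq js i | i <- enum I]).
pose x i j := mass_of (g @^-1` [set i] `&` idx @^-1` [set j]).
have x0 i j : 0 <= x i j by exact: mass_of_ge0.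
apply: le_trans (sum_le_mesh_moment (undup_uniq _ : uniq s)).
rewrite lee_fin.
apply: (@le_trans _ _ (\sum_(i | P i) \sum_(j <- s) x i j `^ q)).
  apply: ler_sum => i Pi.
  have -> : mass_of (g @^-1` [set i]) = \sum_(j <- undup (js i)) x i j.
    rewrite (mass_of_fibers measurable_idx (mg i) (undup_uniq _)); congr mass_of.
    apply/seteqP; split => [y /= gy|y []//]; split => //=.
    by rewrite mem_undup -gy H// gy.
  apply: le_trans (power_mean q_gt1 (x0 i) (L0 i Pi) _) _.
    by rewrite (le_trans _ (sL i Pi))// ler_nat size_undup.
  apply: ler_sum_subset.
  - by move=> j; exact: powR_ge0.
  - exact: undup_uniq.
  - exact: undup_uniq.
  move=> j.
  rewrite !mem_undup => ji; apply/flattenP; exists (js i) => //.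
  by apply: map_f; rewrite mem_enum.
rewrite exchange_big/=; apply: ler_sum => j _.
apply: le_trans (powR_superadditive P q_gt1 (x0^~ j)) _.
apply: ge0_ler_powR; rewrite ?nnegrE ?mass_of_ge0 ?(ltW (lt_trans ltr01 q_gt1))//.
  exact: sumr_ge0.
apply: (@le_trans _ _ (\sum_i x i j)).
  by apply: ler_sum_subpred.
rewrite -big_enum/=.
under eq_bigr do rewrite /x setIC.
rewrite (mass_of_fibers mg (measurable_idx j) (enum_uniq _)).
apply: le_mass_of; last by move=> y [].
  apply: measurableI; first exact: measurable_idx.
  rewrite (_ : [set y | g y \in enum I] = setT)//.
  by apply/seteqP; split => y //= _; rewrite mem_enum.
exact: measurable_idx.
Qed.

(** A cube that meets the image of a fiber of [g] gets its whole mass from nearby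
    fibers; this bounds all but one of the [q] factors of its contribution. *)
Lemma mesh_moment_le (I : finType) (g : X -> I) (near : rel I) :
  (forall i, measurable (g @^-1` [set i])) ->
  (forall x y, enorm (f x - f y) <= Num.sqrt n%:R * r -> near (g x) (g y)) ->
  (mesh_moment tau q r <= (\sum_i mass_of (g @^-1` [set i]) *
    (\sum_(j | near i j) mass_of (g @^-1` [set j])) `^ (q - 1))%:E)%E.
Proof.
move=> mg H; apply: mesh_moment_le_sum => s us.
pose b i := \sum_(j | near i j) mass_of (g @^-1` [set j]).
have b0 i : 0 <= b i by apply: sumr_ge0 => j _; exact: mass_of_ge0.
have q10 : 0 < q - 1 by have := q_gt1; lra.
pose x i j := mass_of (g @^-1` [set i] `&` idx @^-1` [set j]).
have x0 i j : 0 <= x i j by exact: mass_of_ge0.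
pose t j := mass_of (idx @^-1` [set j]).
have tE j : t j = \sum_i x i j.
  rewrite -big_enum/=.
  under eq_bigr do rewrite /x setIC.
  rewrite (mass_of_fibers mg (measurable_idx j) (enum_uniq _)).
  congr mass_of; apply/seteqP; split => y /=; last by case.
  by move=> yj; split => //; rewrite mem_enum.
have tb i j : x i j * t j `^ (q - 1) <= x i j * b i `^ (q - 1).
  have [[y [/= gy fy]]|no] := pselect (exists y, g y = i /\ idx y = j); last first.
    suff -> : x i j = 0 by rewrite !mul0r.
    rewrite /x (_ : _ `&` _ = set0) /mass_of ?measure0//.
    by apply/seteqP; split => y //= [gy fy]; apply: no; exists y.
  rewrite ler_wpM2l//; apply: ge0_ler_powR; rewrite ?nnegrE ?mass_of_ge0 ?(ltW q10)//.
  rewrite tE /b [leRHS]big_mkcond/=; apply: ler_sum => k _.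
  case: ifPn => ik.
    apply: le_mass_of; [|exact: mg|by move=> ? []].
    by apply: measurableI; [exact: mg|exact: measurable_idx].
  rewrite /x (_ : _ `&` _ = set0) /mass_of ?measure0//.
  apply/seteqP; split => z //= [gz fz]; move/negP: ik; apply.
  rewrite -gy -gz; apply: H; apply: mesh_cube_dist => //.
  by rewrite fy fz.
apply: (@le_trans _ _ (\sum_(j <- s) \sum_i x i j * b i `^ (q - 1))).
  apply: ler_sum => j _; rewrite -/(t j) -mulr_powRB1 ?mass_of_ge0//; last by lra.
  rewrite {1}tE mulr_suml; apply: ler_sum => i _; exact: tb.
rewrite exchange_big/=; apply: ler_sum => i _; rewrite -mulr_suml.
rewrite ler_wpM2r ?powR_ge0// (mass_of_fibers measurable_idx (mg i) us).
apply: le_mass_of; [|exact: mg|by move=> ? []].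
apply: measurableI; first exact: mg.
rewrite (_ : [set y | idx y \in s] = \bigcup_(k in [set` s]) idx @^-1` [set k]).
  by apply: fin_bigcup_measurable => [|k _]; [exact: finite_seq|exact: measurable_idx].
apply/seteqP; split => y /=; first by move=> ys; exists (idx y).
by move=> [k /= ks ->].
Qed.

Lemma mesh_moment_le_total :
  (mesh_moment tau q r <= (mass_of setT `^ q)%:E)%E.
Proof.
have q0 : 0 < q by exact: lt_trans q_gt1.
have q10 : 0 < q - 1 by rewrite subr_gt0.
apply: mesh_moment_le_sum => s us; rewrite -[leRHS]mulr_powRB1 ?mass_of_ge0//.
apply: (@le_trans _ _ (\sum_(j <- s) mass_of (setT `&` idx @^-1` [set j]) *
    mass_of setT `^ (q - 1))).
  apply: ler_sum => j _; rewrite setTI -mulr_powRB1 ?mass_of_ge0//.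
  rewrite ler_wpM2l ?mass_of_ge0//.
  apply: ge0_ler_powR; rewrite ?nnegrE ?mass_of_ge0 ?(ltW q10)//.
  by apply: le_mass_of => //; exact: measurable_idx.
rewrite -mulr_suml ler_wpM2r ?powR_ge0// mass_of_fibers//; last exact: measurable_idx.
apply: le_mass_of => //; rewrite setTI.
rewrite (_ : [set y | idx y \in s] = \bigcup_(k in [set` s]) idx @^-1` [set k]).
  by apply: fin_bigcup_measurable => [|k _]; [exact: finite_seq|exact: measurable_idx].
apply/seteqP; split => y /=; first by move=> ys; exists (idx y).
by move=> [k /= ks ->].
Qed.

End finite_measure.

(** For [r < 1] the denominator [(q - 1) * ln r] is negative, so upper bounds on
    the moments are lower bounds on the dimension. *)
Lemma lower_dim_ge n (tau : set 'cV[R]_n -> \bar R) (q s r0 : R) : 1 < q ->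
  0 < r0 -> (forall r, 0 < r < r0 ->
    (mesh_moment tau q r <= (r `^ (s * (q - 1)))%:E)%E) ->
  (s%:E <= lower_dim tau q)%E.
Proof.
move=> q1 r00 H; rewrite /lower_dim limf_einfE.
pose r1 := Num.min r0 1.
have r10 : 0 < r1 by rewrite lt_min r00 ltr01.
apply: le_ereal_sup_tmp; exists (ereal_inf
  ((fun r : R => lne (mesh_moment tau q r) * (((q - 1) * ln r)^-1)%:E)%E
    @` `]0, r1[%classic)).
  exists `]0, r1[%classic => //.
  apply/nbhs_ballP; exists r1 => //= r; rewrite /ball/= sub0r normrN => rr rp.
  by rewrite in_itv/= rp -(gtr0_norm rp).
apply: le_ereal_inf_tmp => _ [r /= +] <-.
rewrite in_itv/= => /andP[rp]; rewrite lt_min => /andP[rr0 r1'].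
have M0 : (0 <= mesh_moment tau q r)%E.
  by apply: esum_ge0 => j _; exact: poweR_ge0.
have lnr : ln r < 0 by rewrite ln_lt0// rp.
have lr : (q - 1) * ln r < 0 by rewrite pmulr_rlt0// subr_gt0.
have : (lne (mesh_moment tau q r) <= (s * (q - 1) * ln r)%:E)%E.
  rewrite -ln_powR -lne_EFin ?powR_gt0// lee_lne ?in_itv/= ?leey ?M0 ?andbT//.
    by apply: H; rewrite rp rr0.
  by rewrite lee_fin powR_ge0.
case: (lne _) => [x| |] //; last first.
  by move=> _; rewrite mulNyr ltr0_sg ?invr_lt0// mulN1e leey.
rewrite lee_fin => xs; rewrite -EFinM lee_fin ler_ndivlMr//.
by rewrite mulrA.
Qed.

Lemma lower_dim_gt n (tau : set 'cV[R]_n -> \bar R) (q s : R) : 1 < q ->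
  (s%:E < lower_dim tau q)%E -> exists2 r0, 0 < r0 & forall r, 0 < r < r0 ->
    (mesh_moment tau q r <= (r `^ (s * (q - 1)))%:E)%E.
Proof.
move=> q1; rewrite /lower_dim limf_einfE => /ereal_sup_gt[_ [V V0 <-]] sV.
have [e /= e0 He] : exists2 e, 0 < e & forall r, 0 < r < e -> V r.
  move: V0 => /nbhs_ballP[e /= e0 He]; exists e => // r /andP[rp re].
  apply: He => //; rewrite /ball/= sub0r normrN gtr0_norm//.
exists (Num.min e 1); first by rewrite lt_min e0 ltr01.
move=> r /andP[rp]; rewrite lt_min => /andP[re r1].
have Vr : V r by apply: He; rewrite rp re.
have := lt_le_trans sV (ereal_inf_lbound (imageP _ Vr)).
have M0 : (0 <= mesh_moment tau q r)%E.
  by apply: esum_ge0 => j _; exact: poweR_ge0.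
have lnr : ln r < 0 by rewrite ln_lt0// rp.
have lr : (q - 1) * ln r < 0 by rewrite pmulr_rlt0// subr_gt0.
move=> H; suff : (lne (mesh_moment tau q r) <= (s * (q - 1) * ln r)%:E)%E.
  rewrite -ln_powR -lne_EFin ?powR_gt0// lee_lne ?in_itv/= ?leey ?M0 ?andbT//.
  by rewrite lee_fin powR_ge0.
case: (lne _) H => [x|H|_]; last by rewrite leNye.
  by rewrite -EFinM lte_fin ltr_ndivlMr// lee_fin mulrA => /ltW.
by move: H; rewrite mulyr ltr0_sg ?invr_lt0// mulN1e.
Qed.

End moments.

(** * The upper bound *)

Section upper_bound.
Context {R : realType}.

Lemma nneseries_geometric_lty (t : nat -> R) (C g : R) k0 :
  (forall k, 0 <= t k) -> 0 <= C -> 0 < g < 1 ->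
  (forall k, (k0 <= k)%N -> t k <= C * g ^+ k) ->
  (\sum_(0 <= k <oo) (t k)%:E < +oo)%E.
Proof.
move=> t0 C0 /andP[g0 g1] H.
apply: (@le_lt_trans _ _ (\sum_(k < k0) t k + C * (1 - g)^-1)%:E); last exact: ltry.
apply: lime_le; first by apply: is_cvg_nneseries => k _ _; rewrite lee_fin.
apply: nearW => n; rewrite big_mkord sumEFin lee_fin.
apply: (@le_trans _ _ (\sum_(k < n) ((k < k0)%N%:R * t k + C * g ^+ k))).
  apply: ler_sum => k _; case: ltnP => kk.
    by rewrite mul1r lerDl mulr_ge0// exprn_ge0// ltW.
  by rewrite mul0r add0r H.
rewrite big_split/= lerD//; last first.
  by rewrite -mulr_sumr ler_wpM2l// geometric_sum_le// g1 ltW.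
have F0 k : 0 <= (k < k0)%N%:R * t k by rewrite mulr_ge0.
apply: (@le_trans _ _ (\sum_(k < n + k0) (k < k0)%N%:R * t k)).
  by rewrite big_split_ord/= lerDl sumr_ge0.
rewrite addnC big_split_ord/= [X in _ + X]big1 ?addr0.
  by apply: ler_sum => k _; rewrite ltn_ord mul1r.
by move=> k _; rewrite ltnNge leq_addr mul0r.
Qed.

Lemma dyadic_scale (x : R) : 0 < x <= 1 ->
  exists n, (2^-1) ^+ n / 2 < x <= (2^-1) ^+ n.
Proof.
move=> /andP[x0 x1].
have ex : exists n, (2^-1 : R) ^+ n.+1 < x.
  have h : `|2^-1 : R| < 1 by rewrite ger0_norm ?invr_ge0// invf_lt1// ltr1n.
  have /cvgrPdist_lt/(_ _ x0)[n _ nP] := cvg_geometric (1 : R) h.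
  exists n; have := nP n.+1 (leqnSn n); rewrite /geometric/= mul1r sub0r normrN.
  by rewrite ger0_norm// exprn_ge0// invr_ge0.
have [n nx nmin] := ex_minnP ex.
exists n; rewrite -exprSr nx/= leNgt; apply/negP => xn.
case: n nx nmin xn => [|n] nx nmin xn; first by rewrite expr0 ltNge x1 in xn.
by have := nmin n xn; rewrite ltnn.
Qed.

Lemma exp_lt_eventually (a e : R) : 0 < a < 1 -> 0 < e ->
  exists k0, forall k, (k0 <= k)%N -> a ^+ k < e.
Proof.
move=> /andP[a0 a1] e0.
have h : `|a| < 1 by rewrite gtr0_norm.
have /cvgrPdist_lt/(_ _ e0)[k0 _ kP] := cvg_geometric (1 : R) h.
exists k0 => k kk; have := kP k kk; rewrite /geometric/= mul1r sub0r normrN.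
by rewrite ger0_norm// exprn_ge0// ltW.
Qed.

Context {N m : nat}.
Variables (T : 'I_m.+1 -> 'M[R]_N) (a : R).
Hypothesis T_unit : forall i, T i \in unitmx.
Hypothesis a01 : 0 < a < 1.
Hypothesis T_contr : forall i x, enorm (T i *m x) <= a * enorm x.
Variable mu : {finite_measure set (borel_code m) -> \bar R}.
Variables (om : seq 'I_m.+1 -> 'cV[R]_N) (b : R).
Hypothesis b_ge0 : 0 <= b.
Hypothesis om_bounded : forall i, enorm (om i) <= b.
Variable q : R.
Hypothesis q_gt1 : 1 < q.

Definition word_mass (w : seq 'I_m.+1) : R := mass_of mu (cylinder w).

Definition level_sum (s : R) (k : nat) : R :=
  \sum_(w : k.-tuple 'I_m.+1) phi s (word_map T w) `^ (1 - q) * word_mass w `^ q.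

Lemma level_sum_ge0 s k : 0 <= level_sum s k.
Proof. by apply: sumr_ge0 => w _; rewrite mulr_ge0 ?powR_ge0. Qed.

Lemma level_sumE s k : (\sum_(i : k.-tuple 'I_m.+1)
    (phi s (word_map T i) `^ (1 - q))%:E * mu (cylinder i) `^ q)%E =
  (level_sum s k)%:E.
Proof.
rewrite /level_sum -sumEFin; apply: eq_bigr => w _.
by rewrite (mass_ofE mu (measurable_cylinder w)) poweR_EFin -EFinM.
Qed.

Lemma prefix_tuple_fiber k (w : k.-tuple 'I_m.+1) :
  (fun x : borel_code m => prefix_tuple x k) @^-1` [set w] = cylinder w.
Proof. by apply/seteqP; split => x /= /cylinderP. Qed.

Lemma measurable_prefix_fiber k (w : k.-tuple 'I_m.+1) :
  measurable ((fun x : borel_code m => prefix_tuple x k) @^-1` [set w]).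
Proof. by rewrite prefix_tuple_fiber; exact: measurable_cylinder. Qed.

Local Notation R0 := (b / (1 - a) + 1).
Local Notation M r := (mesh_moment (image_measure T mu om) q r).

Lemma R0_gt0 : 0 < R0.
Proof.
have /andP[a0 a1] := a01.
by rewrite ltr_wpDl// divr_ge0// subr_ge0 ltW.
Qed.

(** The bound [B w] on the number of cubes that meet the image of a cylinder
    is left free because it is used in two ways: for the empty word with
    [r ^- N] and for the words of a given scale with [phi s / r `^ s]. *)
Lemma cylinder_sum_le_moment : exists2 K : R, 0 < K &
  forall k (P : pred (k.-tuple 'I_m.+1)) (r : R) (B : k.-tuple 'I_m.+1 -> R),
  0 < r -> (forall w, P w -> 0 < B w) -> (forall w, P w ->
    \prod_(l < N) (2 * (sv (word_map T w) l * R0) / r + 1) <= B w) ->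
  ((\sum_(w | P w) (K * B w) `^ (1 - q) * word_mass w `^ q)%:E <= M r)%E.
Proof.
have [K K0 HK] := @cover_image R N; exists K => // k P r B r0 B0 HB.
have /choice[js jsP] : forall w : k.-tuple 'I_m.+1, exists js : seq 'cV[int]_N,
    (size js)%:R <= K * \prod_(l < N) (2 * (sv (word_map T w) l * R0) / r + 1) /\
    forall x, enorm x <= R0 ->
      mesh_index r (partial_sum T om w + word_map T w *m x) \in js.
  by move=> w; apply: HK => //; [exact: word_map_unit|exact: R0_gt0].
under eq_bigr do rewrite /word_mass -prefix_tuple_fiber.
apply: (@mesh_moment_ge R _ _ mu N (projection T om) r q _ r0 q_gt1 _
  (fun x => prefix_tuple x k) P js).
- exact: (measurable_projection a01 T_contr b_ge0 om_bounded).
- exact: measurable_prefix_fiber.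
- by move=> w Pw; rewrite mulr_gt0// B0.
- move=> w Pw; have [+ _] := jsP w; move=> /le_trans; apply.
  by rewrite ler_wpM2l ?(ltW K0)// HB.
- move=> x _; have [_ +] := jsP (prefix_tuple x k).
  have [y yb ->] := projection_split T_unit a01 T_contr b_ge0 om_bounded x k.
  by apply; rewrite (le_trans yb)// lerDl.
Qed.

(** All the mass is carried by about [r ^- N] cubes, so [M r] is at least a
    constant times [r `^ (N%:R * (q - 1))]. *)
Lemma moment_dim_le_N s r0 : mu setT <> 0%E -> 0 < r0 ->
  (forall r, 0 < r < r0 -> (M r <= (r `^ (s * (q - 1)))%:E)%E) -> s <= N%:R.
Proof.
move=> mu0 r00 H; rewrite leNgt; apply/negP => Ns.
have [K K0 HK] := cylinder_sum_le_moment.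
pose c := word_mass [::].
have cE : cylinder [::] = setT :> set (borel_code m).
  by apply/seteqP; split => x.
have c0 : 0 < c.
  rewrite lt_neqAle mass_of_ge0 andbT; apply/negP => /eqP c0; apply: mu0.
  by rewrite (mass_ofE mu (@measurableT _ _)) -cE -/(word_mass _) -/c -c0.
clear mu0; have R21 : 0 < 2 * R0 + 1 by have := R0_gt0; lra.
pose D := (K * (2 * R0 + 1) ^+ N) `^ (1 - q) * c `^ q.
have R00 := R0_gt0.
have D0 : 0 < D by rewrite mulr_gt0 ?powR_gt0// mulr_gt0// exprn_gt0//; lra.
have q10 : 0 < q - 1 by rewrite subr_gt0.
pose e := (s - N%:R) * (q - 1).
have e0 : 0 < e by rewrite mulr_gt0// subr_gt0.
pose r := Num.min (r0 / 2) (Num.min (1 / 2) ((D / 2) `^ e^-1)).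
have D20 : 0 < D / 2 by lra.
have r_gt0 : 0 < r.
  by rewrite !lt_min powR_gt0//; apply/andP; split; [lra|apply/andP; split; lra].
have rr0 : r < r0.
  by rewrite (@le_lt_trans _ _ (r0 / 2))//; [rewrite /r ge_min lexx|lra].
have r1 : r <= 1.
  by rewrite (@le_trans _ _ (1 / 2))//; [rewrite /r !ge_min lexx !orbT|lra].
have rD : r `^ e <= D / 2.
  rewrite -[leRHS](powR_powRV (ltW D20) e0).
  apply: ge0_ler_powR; rewrite ?nnegrE ?powR_ge0 ?(ltW e0) ?(ltW r_gt0)//.
  by rewrite /r !ge_min lexx !orbT.
have := le_trans (HK 0%N xpredT r (fun=> ((2 * R0 + 1) / r) ^+ N) r_gt0 _ _)
  (H r _).
have -> : (0 < r < r0) by rewrite r_gt0 rr0.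
move=> /(_ _ _ isT); rewrite lee_fin.
have -> : \sum_(w : 0.-tuple 'I_m.+1)
    (K * ((2 * R0 + 1) / r) ^+ N) `^ (1 - q) * word_mass w `^ q =
    D * r `^ (N%:R * (q - 1)).
  rewrite (bigD1 [tuple])//= big1 ?addr0; last by move=> w; rewrite tuple0.
  rewrite /D -/c mulrAC; congr (_ * _).
  rewrite exprMn mulrA powRM ?mulr_ge0 ?exprn_ge0 ?invr_ge0 ?(ltW K0) ?(ltW R21) ?(ltW r_gt0)//.
  congr (_ * _); rewrite -powR_inv1 ?(ltW r_gt0)// -powR_mulrn ?powR_ge0//.
  by rewrite -!powRrM; congr (_ `^ _); ring.
move=> F; have : D * r `^ (N%:R * (q - 1)) <= D / 2 * r `^ (N%:R * (q - 1)).
  apply: le_trans (F _ _) _.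
  - by move=> w _; rewrite exprn_gt0// divr_gt0.
  - move=> w _; rewrite -[X in _ <= _ ^+ X]card_ord -prodr_const.
    apply: ler_prod => l _; rewrite tuple0/= word_map_nil.
    have l0 := @sv_gt0 R N 1%:M l (unitmx1 _ _).
    have l1 : sv (1%:M : 'M[R]_N) l <= 1.
      by apply: sv_le; [exact: unitmx1|move=> x; rewrite mul1mx mul1r].
    have lR : 0 < sv (1%:M : 'M[R]_N) l * R0 by exact: mulr_gt0 l0 R00.
    apply/andP; split.
      by rewrite addr_ge0// divr_ge0 ?(ltW r_gt0)// mulr_ge0// ltW.
    rewrite [leRHS]mulrDl mul1r lerD//; last by rewrite invf_ge1.
    rewrite ler_wpM2r ?invr_ge0 ?(ltW r_gt0)//.
    by rewrite ler_wpM2l// -[leRHS]mul1r ler_wpM2r// ltW.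
  have -> : s * (q - 1) = e + N%:R * (q - 1) by rewrite /e; ring.
  rewrite powRD; last by rewrite (gt_eqF r_gt0) implybT.
  by rewrite ler_wpM2r ?powR_ge0.
rewrite ler_pM2r ?powR_gt0// leNgt => /negP; apply; by rewrite ltr_pdivrMr// ltr_pMr// ltr1n.
Qed.

(** The words of length [k] are grouped by the dyadic scale [r] of the singular
    value at which the product [phi s] stops.  A group contributes at most a
    constant times [r `^ e], where [e := (s' - s) * (q - 1)].  One half of the
    exponent [e] makes the sum over the scales converge; since [r < 2 * a ^+ k],
    the other half makes the sum over [k] converge. *)
Lemma level_sum_bound s s' r0 : 0 < s <= N%:R -> s < s' -> 0 < r0 ->
  (forall r, 0 < r < r0 -> (M r <= (r `^ (s' * (q - 1)))%:E)%E) ->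
  (\sum_(0 <= k <oo) (level_sum s k)%:E < +oo)%E.
Proof.
move=> sN ss' r00 H; have /andP[s0 sN'] := sN; have /andP[a0 a1] := a01.
have [K K0 HK] := cylinder_sum_le_moment.
have R00 := R0_gt0.
have R42 : 0 < 4 * R0 + 2 by lra.
have q10 : 0 < q - 1 by rewrite subr_gt0.
pose e := (s' - s) * (q - 1).
have e0 : 0 < e by rewrite mulr_gt0// subr_gt0.
have e20 : 0 < e / 2 by lra.
pose u : R := (2^-1) `^ (e / 2).
have half0 : 0 < 2^-1 :> R by rewrite invr_gt0.
have lt1 (x y : R) : 0 < x < 1 -> 0 < y -> 0 < x `^ y < 1.
  move=> /andP[x0 x1] y0; rewrite powR_gt0//=.
  have := @gt0_ltr_powR R y y0 x 1.
  by rewrite powR1 !nnegrE; apply => //; exact: ltW.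
have /andP[u0 u1] : 0 < u < 1.
  by apply: lt1 => //; rewrite half0 invf_lt1// ltr1n.
have jN : ((`|Num.ceil s|%N).-1 < N)%N.
  have c0 : 0 < Num.ceil s by rewrite ceil_gt0.
  rewrite prednK ?absz_gt0 ?gt_eqF// -lez_nat gez0_abs ?(ltW c0)//.
  by rewrite ceil_le_int -pmulrn.
pose j := Ordinal jN.
pose K1 := K * (4 * R0 + 2) ^+ N.
have K10 : 0 < K1 by rewrite mulr_gt0// exprn_gt0.
pose g w := phi s (word_map T w) `^ (1 - q) * word_mass w `^ q.
pose C := K1 `^ (q - 1).
have [k0 k0P] := exp_lt_eventually a01 (divr_gt0 r00 (ltr0Sn R 1)).
apply: (@nneseries_geometric_lty _ (C * 2 `^ (e / 2) * (1 - u)^-1)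
  (a `^ (e / 2)) k0).
- exact: level_sum_ge0.
- by rewrite !mulr_ge0 ?powR_ge0// invr_ge0 subr_ge0 ltW.
- exact: lt1.
move=> k kk.
(* the dyadic scale of the singular value that ends the definition of phi *)
have al w : 0 < sv (word_map T w) j <= a ^+ size w.
  apply/andP; split; first by apply: sv_gt0; exact: word_map_unit.
  apply: sv_le => [|x]; first exact: word_map_unit.
  exact: word_map_contr.
have /choice[sc scP] : forall w : k.-tuple 'I_m.+1, exists n,
    (2^-1) ^+ n / 2 < sv (word_map T w) j <= (2^-1) ^+ n.
  move=> w; apply: dyadic_scale; have /andP[-> /le_trans ->] := al w => //.
  by rewrite exprn_ile1// ltW.
have Hn n : \sum_(w : k.-tuple 'I_m.+1 | sc w == n) g w <=
    C * (2 `^ (e / 2) * (a `^ (e / 2)) ^+ k) * u ^+ n.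
  have [[w0 w0n]|no] := pselect (exists w, sc w == n); last first.
    rewrite big1 ?mulr_ge0 ?powR_ge0 ?exprn_ge0 ?powR_ge0 ?(ltW u0)//.
    by move=> w wn; exfalso; apply: no; exists w.
  pose r : R := (2^-1) ^+ n.
  have r_gt0 : 0 < r by rewrite exprn_gt0.
  have rk : r < 2 * a ^+ k.
    have := scP w0; rewrite (eqP w0n) -/r => /andP[h _].
    by have /andP[_] := al w0; rewrite size_tuple; lra.
  have rr0 : r < r0 by have := k0P k kk; lra.
  have := le_trans (HK k (fun w => sc w == n) r
    (fun w => (4 * R0 + 2) ^+ N * (phi s (word_map T w) / r `^ s)) r_gt0 _ _)
    (H r _).
  have -> : 0 < r < r0 by rewrite r_gt0 rr0.
  move=> /(_ _ _ isT); rewrite lee_fin => F.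
  have {F} : K1 `^ (1 - q) * r `^ (s * (q - 1)) *
      \sum_(w : k.-tuple 'I_m.+1 | sc w == n) g w <= r `^ (s' * (q - 1)).
    rewrite mulr_sumr; apply: le_trans (F _ _); last first.
    - move=> w /eqP wn; apply: prod_sv_le_phi => //; first exact: word_map_unit.
      by have := scP w; rewrite wn.
    - move=> w _; rewrite mulr_gt0 ?exprn_gt0//.
      by rewrite divr_gt0 ?powR_gt0// phi_gt0// word_map_unit.
    rewrite le_eqVlt; apply/orP; left; apply/eqP; apply: eq_bigr => w _.
    have p0 : 0 < phi s (word_map T w) by rewrite phi_gt0// word_map_unit.
    rewrite mulrA -/K1 powRM ?(ltW K10) ?divr_ge0 ?powR_ge0 ?(ltW p0)//.
    rewrite powR_divM ?(ltW p0) ?powR_gt0// /g -powRrM.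
    have -> : s * (1 - q) = - (s * (q - 1)) by ring.
    rewrite powRN invrK; ring.
  have -> : r `^ (s' * (q - 1)) = r `^ e * r `^ (s * (q - 1)).
    rewrite -powRD; last by rewrite (gt_eqF r_gt0) implybT.
    by congr (_ `^ _); rewrite /e; ring.
  have E : K1 `^ (1 - q) = C^-1 by rewrite -(opprB q 1) powRN.
  rewrite E [leLHS]mulrAC ler_pM2r ?powR_gt0// ler_pdivrMl ?powR_gt0//.
  move=> /le_trans; apply; rewrite -mulrA ler_wpM2l ?powR_ge0//.
  have rE : r `^ (e / 2) = u ^+ n.
    rewrite /r /u -(powR_mulrn _ (ltW half0)) -(powR_mulrn _ (powR_ge0 _ _)).
    by rewrite -!powRrM mulrC.
  have -> : r `^ e = r `^ (e / 2) * u ^+ n.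
    rewrite -rE -powRD; last by rewrite (gt_eqF r_gt0) implybT.
    by congr (_ `^ _); field.
  rewrite ler_wpM2r ?exprn_ge0 ?(ltW u0)//.
  apply: (@le_trans _ _ ((2 * a ^+ k) `^ (e / 2))).
    apply: ge0_ler_powR; rewrite ?nnegrE ?(ltW e20) ?(ltW r_gt0) ?(ltW rk)//.
    by rewrite mulr_ge0// exprn_ge0// ltW.
  rewrite powRM ?exprn_ge0 ?(ltW a0)// ler_wpM2l ?powR_ge0//.
  rewrite -(powR_mulrn _ (ltW a0)) -(powR_mulrn _ (powR_ge0 _ _)) -!powRrM.
  by rewrite mulrC.
pose nmax := \max_(w : k.-tuple 'I_m.+1) sc w.
have scn w : (sc w < nmax.+1)%N by rewrite ltnS; exact: leq_bigmax.
rewrite /level_sum (partition_big (fun w => Ordinal (scn w)) xpredT)//=.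
apply: (@le_trans _ _ (\sum_(n < nmax.+1)
    C * (2 `^ (e / 2) * (a `^ (e / 2)) ^+ k) * u ^+ n)).
  by apply: ler_sum => n _; exact: Hn.
rewrite -mulr_sumr.
have -> : C * 2 `^ (e / 2) * (1 - u)^-1 * a `^ (e / 2) ^+ k =
    C * (2 `^ (e / 2) * (a `^ (e / 2)) ^+ k) * (1 - u)^-1 by ring.
rewrite ler_wpM2l ?mulr_ge0 ?powR_ge0 ?exprn_ge0 ?powR_ge0//.
by rewrite geometric_sum_le// u1 ltW.
Qed.

End upper_bound.

(** * Bounds on the dimension for every choice of the vectors *)

Section deterministic_bounds.
Context {R : realType} {N m : nat}.
Variables (T : 'I_m.+1 -> 'M[R]_N) (a : R).
Hypothesis T_unit : forall i, T i \in unitmx.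
Hypothesis a01 : 0 < a < 1.
Hypothesis T_contr : forall i x, enorm (T i *m x) <= a * enorm x.
Variable mu : {finite_measure set (borel_code m) -> \bar R}.
Variables (om : seq 'I_m.+1 -> 'cV[R]_N) (b : R).
Hypothesis b_ge0 : 0 <= b.
Hypothesis om_bounded : forall i, enorm (om i) <= b.
Variable q : R.
Hypothesis q_gt1 : 1 < q.

Lemma d_minusE : d_minus T mu q = maxe 0%E (ereal_sup
  [set s%:E | s in [set s : R | 0 < s /\
    (\sum_(0 <= k <oo) (level_sum T mu q s k)%:E < +oo)%E]]).
Proof.
rewrite /d_minus; congr (maxe _ (ereal_sup (_ @` _))).
have E s : (\sum_(0 <= k <oo) \sum_(i : k.-tuple 'I_m.+1)
    (phi s (word_map T i) `^ (1 - q))%:E * mu (cylinder i) `^ q)%E =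
    (\sum_(0 <= k <oo) (level_sum T mu q s k)%:E)%E.
  by apply: eq_eseriesr => k _; exact: level_sumE.
by apply/seteqP; split => s /= [s0]; rewrite E.
Qed.

Theorem lower_dim_le_min : mu setT <> 0%E ->
  (lower_dim (image_measure T mu om) q <= mine (d_minus T mu q) N%:R%:E)%E.
Proof.
move=> mu0; set d := lower_dim _ _.
have dN : (d <= N%:R%:E)%E.
  rewrite leNgt; apply/negP => Nd.
  have [s Ns sd] : exists2 s : R, N%:R < s & (s%:E < d)%E.
    move: Nd; case: (d) => [x| |]//.
      by rewrite lte_fin => Nx; exists ((N%:R + x) / 2); rewrite ?lte_fin; lra.
    by move=> _; exists (N%:R + 1); [rewrite ltrDl|rewrite ltry].
  have [r0 r00 H] := lower_dim_gt q_gt1 sd.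
  have := moment_dim_le_N T_unit a01 T_contr b_ge0 om_bounded q_gt1 mu0 r00 H.
  by rewrite leNgt Ns.
rewrite le_min dN andbT leNgt; apply/negP => dd.
have d0 : (0 <= d_minus T mu q)%E by rewrite /d_minus le_max lexx.
have [s [s' [s0 ss' ds sd]]] : exists s s' : R,
    [/\ 0 < s, s < s', (d_minus T mu q < s%:E)%E & (s'%:E < d)%E].
  move: dd d0 dN; case: (d_minus T mu q) => [x| |]//; case: (d) => [y| |]//.
  rewrite lte_fin !lee_fin => xy x0 _.
  exists ((2 * x + y) / 3), ((x + 2 * y) / 3); rewrite !lte_fin.
  by split; lra.
have sN : 0 < s <= N%:R.
  rewrite s0 -lee_fin (le_trans _ dN)// (le_trans _ (ltW sd))//.
  by rewrite lee_fin ltW.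
have [r0 r00 H] := lower_dim_gt q_gt1 sd.
have fin := level_sum_bound T_unit a01 T_contr b_ge0 om_bounded q_gt1 sN ss' r00 H.
move: ds; rewrite ltNge => /negP; apply.
rewrite d_minusE le_max; apply/orP; right.
by apply: ereal_sup_ubound; exists s.
Qed.

(** The moments are bounded, hence below any negative power of a small [r]. *)
Lemma lower_dim_ge0 : (0 <= lower_dim (image_measure T mu om) q)%E.
Proof.
apply/lee_addgt0Pr => e e0.
suff : ((- e)%:E <= lower_dim (image_measure T mu om) q)%E.
  by rewrite -leeBlDr// sub0e.
have q0 : 0 < q - 1 by rewrite subr_gt0.
pose c := mass_of mu setT `^ q + 1.
have c0 : 0 < c by rewrite ltr_wpDl ?powR_ge0.
have eq0 : 0 < e * (q - 1) by rewrite mulr_gt0.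
pose r0 := (c^-1) `^ (e * (q - 1))^-1.
apply: (@lower_dim_ge _ _ _ _ _ r0) => //; first by rewrite powR_gt0// invr_gt0.
move=> r /andP[r_gt0 rr0].
have := mesh_moment_le_total mu (measurable_projection a01 T_contr b_ge0 om_bounded)
  r_gt0 q_gt1.
move=> /le_trans; apply; rewrite lee_fin mulNr powRN.
apply: (@le_trans _ _ c); first by rewrite lerDl.
rewrite -[leLHS]invrK lef_pV2 ?posrE ?powR_gt0 ?invr_gt0//.
rewrite -[leRHS](powR_powRV _ eq0) ?invr_ge0 ?(ltW c0)//.
by apply: ge0_ler_powR; rewrite ?nnegrE ?powR_ge0 ?(ltW eq0) ?(ltW r_gt0) ?(ltW rr0).
Qed.

End deterministic_bounds.

(** * Probability of falling into a thin ellipsoid *)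

Section bounded_density.
Context {R : realType}.

Definition cube n (x : 'cV[R]_n) (h : R) : set 'cV[R]_n :=
  [set v | forall i, `[x i ord0 - h, x i ord0 + h]%classic (v i ord0)].

Lemma measurable_cube n (x : 'cV[R]_n) h : measurable (cube x h).
Proof.
rewrite (_ : cube x h = \bigcap_(i in [set: 'I_n])
    ((fun v : 'cV[R]_n => v i ord0) @^-1`
      `[x i ord0 - h, x i ord0 + h]%classic)); last first.
  by apply/seteqP; split => v Hv i => [_|]; [exact: Hv|exact: Hv i I].
apply: fin_bigcap_measurable => // i _.
by rewrite -[X in measurable X]setTI; apply: measurable_cV_coord.
Qed.

Lemma bounded_density_cube n (nu : probability 'cV[R]_n R) :
  has_bounded_density nu -> exists2 c : R, 0 <= c &
    forall x h, 0 < h -> (nu (cube x h) <= (c * (2 * h) ^+ n)%:E)%E.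
Proof.
move=> [f [c [mf fc nuE]]].
have c0 : 0 <= c by have /andP[f0 f1] := fc 0; exact: le_trans f1.
exists c => // x h h0; rewrite nuE; last exact: measurable_cube.
apply: (@le_trans _ _ (\int[lebesgue_cV n]_(v in cube x h) (cst c%:E v))%E).
  apply: ge0_le_integral; [exact: measurable_cube|..].
  - by move=> v _; rewrite lee_fin; have /andP[] := fc v.
  - by apply/measurable_EFinP; exact: measurable_funTS.
  - exact: measurable_cst.
  - by move=> v _; rewrite lee_fin; have /andP[] := fc v.
rewrite integral_cst; last exact: measurable_cube.
have E : lebesgue_cV n (cube x h) = ((2 * h) ^+ n)%:E.
  pose J i : set R := `[x i ord0 - h, x i ord0 + h]%classic.
  transitivity (\prod_(i < n) lebesgue_measure (J i))%E.
    by apply: lebesgue_cV_box => i; exact: measurable_itv.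
  rewrite (eq_bigr (fun=> (2 * h)%:E)); last first.
    move=> i _; rewrite /J lebesgue_measure_itv/= lte_fin.
    rewrite ifT; last by lra.
    by rewrite -EFinD; congr (_%:E); ring.
  by rewrite prodEFin prodr_const card_ord.
by rewrite [leRHS]EFinM -E; exact: lexx.
Qed.

Definition mesh_point n (delta : R) (j : 'cV[int]_n) : 'cV[R]_n :=
  \col_i ((j i ord0)%:~R * delta).

Lemma mesh_point_dist n (delta : R) (v : 'cV[R]_n) : 0 < delta ->
  enorm (v - mesh_point delta (mesh_index delta v)) <= Num.sqrt n%:R * delta.
Proof.
move=> d0; apply: enorm_le_coord; first exact: ltW.
move=> i; have /(_ i) := iffRL (mesh_cubeE (mesh_index delta v) v d0) erefl.
rewrite intrD mulrDl mul1r => /andP[h1 h2].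
have -> : (v - mesh_point delta (mesh_index delta v)) i ord0 =
   v i ord0 - (mesh_index delta v i ord0)%:~R * delta by rewrite !mxE.
by rewrite ler_norml; lra.
Qed.

Lemma finite_subadditivity d (X : measurableType d)
    (mu : {finite_measure set X -> \bar R}) (I : eqType) (F : I -> set X)
    (s : seq I) (A : set X) (B : R) : measurable A ->
  (forall i, measurable (F i)) -> (forall i, mass_of mu (F i) <= B) ->
  (forall x, A x -> exists2 i, i \in s & F i x) ->
  mass_of mu A <= (size s)%:R * B.
Proof.
move=> mA mF FB; elim: s A mA => [|i s IH] A mA AF.
  rewrite mul0r (_ : A = set0) /mass_of ?measure0//.
  by apply/seteqP; split => // x /AF[].
rewrite /= -natr1 mulrDl mul1r addrC.
have AE : A = (A `&` F i) `|` (A `\` F i) by rewrite setUIDK.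
apply: (@le_trans _ _ (mass_of mu (A `&` F i) + mass_of mu (A `\` F i))).
  have mI : measurable (A `&` F i) by exact: measurableI.
  have mD : measurable (A `\` F i) by exact: measurableD.
  rewrite -lee_fin EFinD -!mass_ofE// {1}AE -measureU//.
  by apply/seteqP; split => // x [[_ h] [_]].
rewrite lerD//.
  apply: le_trans (FB i); apply: le_mass_of; [exact: measurableI|exact: mF|by move=> x []].
apply: IH; first exact: measurableD.
move=> x [/AF[k + Fk] nFi]; rewrite inE => /predU1P[ki|ks]; last by exists k.
by rewrite -ki in nFi.
Qed.

(** The vector [Y] is rounded to a mesh fine enough for the rounding to move its
    image by at most [rho]; hence [Y] itself is in the preimage of a ball of radius
    [2 * rho], which [cover_preimage] covers by cubes of known measure.  The
    bound [1 <= C] serves at the leaves of the tree. *)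
Lemma ellipsoid_probability d (Om : measurableType d) (P : probability Om R)
    n (nu : probability 'cV[R]_n R) (b s : R) :
  has_bounded_density nu -> 1 <= b -> 0 < s <= n%:R ->
  exists2 C, 1 <= C & forall (Y : Om -> 'cV[R]_n) (A : 'M[R]_n) c rho delta
    (js : seq 'cV[int]_n),
  measurable_fun setT Y -> (forall B, measurable B -> P (Y @^-1` B) = nu B) ->
  (forall w, enorm (Y w) <= b) -> A \in unitmx ->
  (forall x, enorm (A *m x) <= enorm x) -> 0 < delta ->
  Num.sqrt n%:R * delta <= rho -> 0 < rho -> uniq js ->
  \sum_(j <- js) mass_of P ((fun w => mesh_index delta (Y w)) @^-1` [set j]) *
      (enorm (c + A *m mesh_point delta j) <= rho)%R%:R
    <= C * rho `^ s * (phi s A)^-1.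
Proof.
move=> /bounded_density_cube[c c0 cP] b1 sn.
have b0 : 0 <= b by lra.
pose C := c * 2 ^+ n * (3 * b * Num.sqrt n%:R) ^+ n * 2 `^ s.
have C0 : 0 <= C by rewrite !mulr_ge0 ?powR_ge0 ?exprn_ge0// !mulr_ge0.
exists (1 + C); first by rewrite lerDl.
move=> Y A e rho delta js mY YE Yb Au Ac d0 drho rho0 ujs.
have rho20 : 0 < 2 * rho by lra.
have [xs [h h0 [xcov xsize]]] := cover_preimage e Au sn rho20 b1.
set f := fun w => mesh_index delta (Y w).
have mf j : measurable (f @^-1` [set j]).
  by have := measurable_idx mY d0 j.
have mYc x : measurable (Y @^-1` (cube x h)).
  rewrite -[X in measurable X]setTI.
  by apply: mY => //; exact: measurable_cube.
pose cond j := enorm (e + A *m mesh_point delta j) <= rho.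
have -> : \sum_(j <- js) mass_of P (f @^-1` [set j]) * (cond j)%:R =
    \sum_(j <- [seq j <- js | cond j]) mass_of P (setT `&` f @^-1` [set j]).
  rewrite big_filter [RHS]big_mkcond; apply: eq_bigr => j _; rewrite setTI.
  by case: (cond j); rewrite ?mulr1 ?mulr0.
rewrite mass_of_fibers ?filter_uniq//.
have mfs (t : seq 'cV[int]_n) : measurable [set w | f w \in t].
  rewrite (_ : [set x | f x \in t] = \bigcup_(k in [set` t]) f @^-1` [set k]).
    by apply: fin_bigcup_measurable => //; exact: finite_seq.
  apply/seteqP; split => x /=; first by move=> xt; exists (f x).
  by move=> [k /= kt ->].
apply: (@le_trans _ _ ((size xs)%:R * (c * (2 * h) ^+ n))).
  apply: (@finite_subadditivity _ _ P _ (fun x => Y @^-1` (cube x h))).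
  - exact: measurableI.
  - exact: mYc.
  - move=> x; rewrite -lee_fin -mass_ofE//.
    have := cP x h h0; rewrite -YE; last exact: measurable_cube.
    exact.
  - move=> w [_ /=]; rewrite mem_filter => /andP[cw _].
    have [|x xs_x xY] := xcov (Y w) (Yb w).
      have -> : e + A *m Y w = (e + A *m mesh_point delta (f w)) +
          A *m (Y w - mesh_point delta (f w)).
        by rewrite mulmxBr addrACA subrr addr0.
      apply: le_trans (enormD _ _) _; rewrite mulr2n mulrDl mul1r lerD//.
      apply: le_trans (Ac _) _; apply: le_trans drho.
      exact: mesh_point_dist.
    exists x => // i; have := le_trans (coord_le_enorm _ i) xY.
    have -> : (Y w - x) i ord0 = Y w i ord0 - x i ord0 by rewrite !mxE.
    by rewrite /= in_itv/= ler_norml; lra.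
have -> : (size xs)%:R * (c * (2 * h) ^+ n) = c * 2 ^+ n * ((size xs)%:R * h ^+ n).
  by rewrite exprMn; ring.
apply: (@le_trans _ _ (c * 2 ^+ n *
    ((3 * b * Num.sqrt n%:R) ^+ n * ((2 * rho) `^ s / phi s A)))).
  by rewrite ler_wpM2l// mulr_ge0// exprn_ge0.
have p0 := phi_gt0 Au sn.
rewrite powRM ?(ltW rho0)//.
apply: (@le_trans _ _ (C * rho `^ s * (phi s A)^-1)).
  by rewrite le_eqVlt /C; apply/orP; left; apply/eqP; ring.
by rewrite mulrDl mul1r mulrDl lerDr mulr_ge0 ?powR_ge0// invr_ge0 ltW.
Qed.

End bounded_density.

(** * The random model on a grid *)

Lemma insub_bseqK (T : Type) n (s : seq T) : (size s <= n)%N ->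
  val (insub_bseq n s) = s.
Proof. by move=> sn; rewrite /insub_bseq insubdK. Qed.

(** Isolates the only term that involves the vector of the prefix of [w] of
    length [k.+1]. *)
Lemma partial_sum_extract (R : realType) N m (T : 'I_m.+1 -> 'M[R]_N) om w k :
  (k < size w)%N -> partial_sum T om w =
    partial_sum T (fun i => if i == take k.+1 w then 0 else om i) w +
    word_map T (take k w) *m om (take k.+1 w).
Proof.
move=> kw; rewrite /partial_sum (bigD1 (Ordinal kw))//= [in RHS](bigD1 (Ordinal kw))//=.
rewrite eqxx mulmx0 add0r addrC; congr (_ + _); apply: eq_bigr => j jk.
case: eqP => // /(congr1 size); rewrite !size_takel// => -[jk'].
by move: jk; rewrite -val_eqE/= jk' eqxx.
Qed.

(** The vectors attached to the words of length at most [n] are rounded to the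
    corners of mesh cubes of side [delta].  The list [js] of indices covers the
    ball of radius [b], so that a choice of cells for all these words is a finite
    function. *)
Section discretization.
Context {R : realType} {N m : nat}.
Variables (T : 'I_m.+1 -> 'M[R]_N) (a : R).
Hypothesis T_unit : forall i, T i \in unitmx.
Hypothesis a01 : 0 < a < 1.
Hypothesis T_contr : forall i x, enorm (T i *m x) <= a * enorm x.
Variables (d : measure_display) (Om : measurableType d) (P : probability Om R).
Variable omega : seq 'I_m.+1 -> {RV P >-> 'cV[R]_N}.
Variable b : R.
Hypothesis b_ge1 : 1 <= b.
Hypothesis omega_bounded : forall i w, enorm (omega i w) <= b.
Hypothesis omega_independent : mutually_independent P omega.
Variable nu : probability 'cV[R]_N R.
Hypothesis omega_law : forall i (A : set 'cV[R]_N), measurable A ->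
  distribution P (omega i) A = nu A.
Variables (n : nat) (delta : R) (js : seq 'cV[int]_N) (K : nat).
Hypothesis delta_gt0 : 0 < delta.
Hypothesis js_uniq : uniq js.
Hypothesis js_size : size js = K.+1.
Hypothesis js_cover : forall v, enorm v <= b -> mesh_index delta v \in js.

Local Notation W := (n.-bseq 'I_m.+1).
Local Notation S := 'I_K.+1.

Definition grid_point (t : S) : 'cV[R]_N := mesh_point delta (js`_t).

Definition cell (v : 'cV[R]_N) : S := inord (index (mesh_index delta v) js).

(** The vectors are identically distributed, so the law of the cell is read off
    the vector of the empty word. *)
Definition cell_prob (t : S) : R :=
  mass_of P ((fun w => mesh_index delta (omega [::] w)) @^-1` [set js`_t]).

Definition sample (w : Om) : {ffun W -> S} := [ffun i => cell (omega (val i) w)].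

(** Words longer than [n] are sent to a default index; the partial sums of words
    of length [n] never reach them. *)
Definition grid_family (sg : {ffun W -> S}) (i : seq 'I_m.+1) : 'cV[R]_N :=
  grid_point (sg (insub_bseq n i)).

Lemma nth_cell v : enorm v <= b -> js`_(cell v) = mesh_index delta v.
Proof.
move=> vb; have vjs := js_cover vb.
by rewrite /cell inordK ?nth_index// -js_size index_mem.
Qed.

Lemma cellE v t : enorm v <= b -> cell v = t <-> mesh_index delta v = js`_t.
Proof.
move=> vb; split => [<-|vt]; first by rewrite nth_cell.
have ltK (u : S) : (u < size js)%N by rewrite js_size.
apply/val_inj/eqP; rewrite /= -(nth_uniq 0 (ltK _) (ltK _) js_uniq).
by rewrite nth_cell// vt.
Qed.

Lemma omega_measurable i : measurable_fun setT (omega i).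
Proof. exact: measurable_funP. Qed.

Lemma sum_grid (F : 'cV[int]_N -> R) : \sum_(t : S) F js`_t = \sum_(j <- js) F j.
Proof. by rewrite [RHS](big_nth 0) big_mkord js_size. Qed.

Lemma cell_prob_ge0 t : 0 <= cell_prob t.
Proof. exact: mass_of_ge0. Qed.

Lemma cell_prob_sum1 : \sum_t cell_prob t = 1.
Proof.
rewrite /cell_prob (sum_grid (fun j => mass_of P
  ((fun w => mesh_index delta (omega [::] w)) @^-1` [set j]))).
under eq_bigr do rewrite -[X in mass_of _ X]setTI.
rewrite mass_of_fibers//; last first.
  by move=> j; exact: (measurable_idx (omega_measurable [::])).
rewrite (_ : _ `&` _ = setT); first exact: (congr1 fine (probability_setT P)).
by apply/seteqP; split => // w _; split => //=; exact: js_cover.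
Qed.

Lemma cell_probE i (t : S) : P ((fun w => mesh_index delta (omega i w)) @^-1` [set js`_t]) =
  (cell_prob t)%:E.
Proof.
rewrite /cell_prob -mass_ofE; last first.
  exact: (measurable_idx (omega_measurable [::])).
have mc := @measurable_mesh_cube R N delta js`_t.
have E i' : P ((fun w => mesh_index delta (omega i' w)) @^-1` [set js`_t]) =
    nu (mesh_cube delta js`_t).
  rewrite -(preimage_mesh_cube (omega i') delta_gt0); exact: (omega_law i' mc).
exact: etrans (E i) (esym (E [::])).
Qed.

Lemma sample_fiber sg : sample @^-1` [set sg] =
  \bigcap_(i in [set` [fset val x | x in {: W}]%fset])
    (omega i @^-1` mesh_cube delta (js`_(sg (insub_bseq n i)))).
Proof.
apply/seteqP; split => w /=.
  move=> <- i /= /imfsetP[x _ ->]; apply/mesh_cubeE => //.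
  by rewrite /insub_bseq valKd ffunE nth_cell.
move=> H; apply/ffunP => x; rewrite ffunE; apply/cellE => //.
apply/mesh_cubeE => //.
have := H (val x); rewrite /insub_bseq valKd; apply.
by apply/imfsetP; exists x.
Qed.

Lemma measurable_sample sg : measurable (sample @^-1` [set sg]).
Proof.
rewrite sample_fiber; apply: fin_bigcap_measurable => // i _.
rewrite -[X in measurable X]setTI; apply: omega_measurable => //.
exact: measurable_mesh_cube.
Qed.

(** Independence of the vectors makes the law of the cells a product, which is
    the weight used by [expect]. *)
Lemma mass_of_sample sg : mass_of P (sample @^-1` [set sg]) =
  \prod_x cell_prob (sg x).
Proof.
apply/eqP; rewrite -eqe -mass_ofE; last exact: measurable_sample.
pose A i := mesh_cube delta (js`_(sg (insub_bseq n i))).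
have mA i : measurable (A i) by exact: measurable_mesh_cube.
have E := omega_independent [fset val x | x in {: W}]%fset mA.
rewrite sample_fiber; apply/eqP; apply: etrans E _.
rewrite big_imfset/=; last by move=> x y _ _; exact: val_inj.
rewrite big_enum/= -prodEFin; apply: eq_bigr => x _.
by rewrite /A /insub_bseq valKd -(cell_probE (val x)) preimage_mesh_cube.
Qed.

Definition grid_sum (sg : {ffun W -> S}) (w : n.-tuple 'I_m.+1) : 'cV[R]_N :=
  partial_sum T (grid_family sg) w.

Definition grid_dist sg v w : R := enorm (grid_sum sg v - grid_sum sg w).

Lemma grid_dist_triangle sg u v w :
  grid_dist sg v w <= grid_dist sg u v + grid_dist sg u w.
Proof.
rewrite /grid_dist [X in _ <= X + _]enormB; apply: le_trans (enormD _ _).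
by rewrite addrA subrK.
Qed.

Definition word_index (w : n.-tuple 'I_m.+1) (k : nat) : W :=
  insub_bseq n (take k.+1 w).

Lemma word_index_inj (u w : seq 'I_m.+1) : (size u <= n)%N -> (size w <= n)%N ->
  insub_bseq n u = insub_bseq n w -> u = w.
Proof. by move=> un wn /(congr1 val); rewrite !insub_bseqK. Qed.

Lemma size_take_tuple k (w : n.-tuple 'I_m.+1) : (size (take k w) <= n)%N.
Proof. by rewrite size_take_min size_tuple geq_minr. Qed.

Lemma grid_family_update sg (w : n.-tuple 'I_m.+1) k t (u : seq 'I_m.+1) :
  (size u <= n)%N ->
  grid_family (update sg (word_index w k) t) u =
    if u == take k.+1 w then grid_point t else grid_family sg u.
Proof.
move=> un; rewrite /grid_family ffunE; case: eqP => [H|H]; case: eqP => //.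
  by move=> ne; exfalso; apply: ne; apply: word_index_inj H => //; exact: size_take_tuple.
by move=> uE; exfalso; apply: H; rewrite uE.
Qed.

Lemma grid_sum_update sg (w v : n.-tuple 'I_m.+1) k t : (k < n)%N ->
  split_at k v w -> grid_sum (update sg (word_index w k) t) v = grid_sum sg v.
Proof.
move=> kn /andP[_ nvw]; apply: eq_partial_sum => j jn.
rewrite grid_family_update ?size_take_tuple//; case: eqP => // E.
have jk : j = k.
  move: (congr1 size E); rewrite !size_takel ?size_tuple//; first by case.
  by rewrite size_tuple in jn.
by move: nvw; rewrite -E jk eqxx.
Qed.

(** The words [v] and [v'] leave [w] before the prefix whose vector is changed. *)
Lemma grid_dist_indep sg w v v' k t : (k < n)%N ->
  split_at k v w -> split_at k v' w ->
  grid_dist (update sg (word_index w k) t) v v' = grid_dist sg v v'.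
Proof. by move=> kn vw v'w; rewrite /grid_dist !grid_sum_update. Qed.

Lemma grid_sum_resample sg (w : n.-tuple 'I_m.+1) k : (k < n)%N ->
  exists c, forall t, grid_sum (update sg (word_index w k) t) w =
    c + word_map T (take k w) *m grid_point t.
Proof.
move=> kn.
exists (partial_sum T (fun i => if i == take k.+1 w then 0 else grid_family sg i) w).
move=> t; rewrite /grid_sum (@partial_sum_extract _ _ _ _ _ _ k) ?size_tuple//.
congr (_ + _); last by rewrite grid_family_update ?size_take_tuple// eqxx.
apply: eq_partial_sum => j jn; case: eqP => // /eqP/negPf E.
by rewrite grid_family_update ?size_take_tuple// E.
Qed.

Lemma word_map_contr1 u x : enorm (word_map T u *m x) <= enorm x.
Proof.
have /andP[a0 a1] := a01; apply: le_trans (word_map_contr a01 T_contr _ _) _.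
by rewrite ler_piMl ?enorm_ge0// exprn_ile1// ltW.
Qed.

Lemma projection_grid w (x : borel_code m) :
  enorm (projection T (fun i => omega i w) x - grid_sum (sample w) (prefix_tuple x n))
    <= (a ^+ n * b + Num.sqrt N%:R * delta) / (1 - a).
Proof.
have b0 : 0 <= b by apply: le_trans b_ge1.
have pn := projection_near T_unit a01 T_contr b0 (omega_bounded ^~ w) x n.
rewrite -(subrK (partial_sum T (fun i => omega i w) (prefix_word x n))
  (projection _ _ _)) -addrA (le_trans (enormD _ _))// mulrDl lerD//.
  by rewrite -mulrA.
have -> : grid_sum (sample w) (prefix_tuple x n) = partial_sum T
    (fun i => mesh_point delta (mesh_index delta (omega i w))) (prefix_word x n).
  apply: eq_partial_sum => j jn; rewrite /grid_family /sample ffunE /grid_point.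
  rewrite insub_bseqK; last first.
    by rewrite size_take_min geq_min size_prefix_word leqnn orbT.
  by rewrite nth_cell.
rewrite partial_sumB; apply: (enorm_partial_sum a01 T_contr).
  by rewrite mulr_ge0// ltW.
by move=> i; exact: mesh_point_dist.
Qed.

End discretization.

(** * Moments of the random measure on the grid *)

Section random_moments.
Context {R : realType} {N m : nat}.
Variables (T : 'I_m.+1 -> 'M[R]_N) (a : R).
Hypothesis T_unit : forall i, T i \in unitmx.
Hypothesis a01 : 0 < a < 1.
Hypothesis T_contr : forall i x, enorm (T i *m x) <= a * enorm x.
Variable mu : {finite_measure set (borel_code m) -> \bar R}.
Variables (d : measure_display) (Om : measurableType d) (P : probability Om R).
Variable omega : seq 'I_m.+1 -> {RV P >-> 'cV[R]_N}.
Variable b : R.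
Hypothesis b_ge1 : 1 <= b.
Hypothesis omega_bounded : forall i w, enorm (omega i w) <= b.
Variable nu : probability 'cV[R]_N R.
Hypothesis omega_law : forall i (A : set 'cV[R]_N), measurable A ->
  distribution P (omega i) A = nu A.
Hypothesis nu_density : has_bounded_density nu.
Variable q : R.
Hypothesis q_gt1 : 1 < q.

Lemma moment_level (p : R) : 0 < p -> exists k : nat, k%:R < p <= k.+1%:R.
Proof.
move=> p0.
have ex : exists k : nat, p <= k.+1%:R.
  by exists (Num.truncn p); rewrite ltW// truncnS_gt.
have [k pk kmin] := ex_minnP ex; exists k; rewrite pk andbT ltNge.
apply/negP => kp; case: k pk kmin kp => [|k] pk kmin kp.
  by rewrite leNgt p0 in kp.
by have := kmin k kp; rewrite ltnn.
Qed.

Lemma prefix_word_mass n k (w : n.-tuple 'I_m.+1) : (k <= n)%N ->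
  prefix_mass (fun v : n.-tuple 'I_m.+1 => word_mass mu v) k w =
  word_mass mu (take k w).
Proof.
move=> kn; rewrite /prefix_mass /word_mass.
pose s := enum [pred v : n.-tuple 'I_m.+1 | take k v == take k w].
have -> : \sum_(v : n.-tuple 'I_m.+1 | take k v == take k w)
    mass_of mu (cylinder v) = \sum_(v <- s) mass_of mu
    (setT `&` (fun x : borel_code m => prefix_tuple x n) @^-1` [set v]).
  by rewrite big_enum/=; apply: eq_bigr => v _; rewrite setTI prefix_tuple_fiber.
rewrite mass_of_fibers ?enum_uniq//; last exact: measurable_prefix_fiber.
congr mass_of; apply/seteqP; split => x /=.
  move=> [_]; rewrite mem_enum inE/= take_prefix_word// => /eqP xw.
  by rewrite /cylinder/= size_takel ?size_tuple.
rewrite /cylinder/= size_takel ?size_tuple// => xw; split => //.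
by rewrite mem_enum inE/= take_prefix_word// xw.
Qed.

Lemma sum_prefix n k (F : seq 'I_m.+1 -> R) : (k <= n)%N ->
  \sum_(w : n.-tuple 'I_m.+1) word_mass mu w * F (take k w) =
  \sum_(u : k.-tuple 'I_m.+1) word_mass mu u * F u.
Proof.
move=> kn.
have E (w : n.-tuple 'I_m.+1) : word_mass mu w * F (take k w) =
    \sum_(u : k.-tuple 'I_m.+1 | val u == take k w) word_mass mu w * F u.
  have sz : size (take k w) == k by rewrite size_takel ?size_tuple.
  by rewrite (big_pred1 (Tuple sz)).
rewrite (eq_bigr _ (fun w _ => E w)) (exchange_big_dep xpredT)//=.
apply: eq_bigr => u _; rewrite -mulr_suml; congr (_ * _).
have [w0 uw0] : exists w0 : n.-tuple 'I_m.+1, take k w0 = u.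
  have sz : size (val u ++ nseq (n - k) ord0) == n.
    by rewrite size_cat size_tuple size_nseq subnKC.
  by exists (Tuple sz); rewrite /= take_size_cat// size_tuple.
rewrite -uw0 -prefix_word_mass//; apply: eq_bigl => w.
by rewrite eq_sym uw0.
Qed.

Variables s t : R.
Hypothesis s_range : 0 < s < N%:R.
Hypothesis s_lt_t : s < t.
Variable Sum : R.
Hypothesis level_sums : forall n, \sum_(k < n) level_sum T mu q t k <= Sum.

Local Notation p := (q - 1).
Local Notation th := (a `^ (t - s)).

Section weights.
Variable n : nat.

Definition inv_phi (w : n.-tuple 'I_m.+1) (k : nat) : R :=
  (phi s (word_map T (take k w)))^-1.

(** The factor [th ^+ k] is the decay gained from the difference of the exponents
    [s] and [t]: by [phi_le_phi] the ratio is at most the one with [phi t] in the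
    denominator and without the factor. *)
Definition weight_ratio (w : seq 'I_m.+1) (k : nat) : R :=
  (th ^+ k)^-1 * (word_mass mu (take k w) / phi s (word_map T (take k w))).

(** The largest of the ratios would do as well; with the sum of their powers
    the integral of the weight is directly the series of level sums. *)
Definition weight (w : n.-tuple 'I_m.+1) : R :=
  (\sum_(k < n.+1) weight_ratio w k `^ p) `^ p^-1.

Lemma th_range : 0 < th < 1.
Proof.
have /andP[a0 a1] := a01; rewrite powR_gt0//=.
have ts : 0 < t - s by rewrite subr_gt0.
have := @gt0_ltr_powR R (t - s) ts a 1.
by rewrite powR1 !nnegrE; apply => //; exact: ltW.
Qed.

Lemma weight_ratio_ge0 w k : 0 <= weight_ratio w k.
Proof.
have /andP[s0 _] := s_range; have /andP[th0 _] := th_range.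
rewrite mulr_ge0 ?invr_ge0 ?exprn_ge0 ?(ltW th0)// divr_ge0 ?mass_of_ge0//.
exact/ltW/phi_gt0_all/s0/word_map_unit.
Qed.

Lemma weight_ge0 w : 0 <= weight w. Proof. exact: powR_ge0. Qed.

Lemma prefix_le_weight (w : n.-tuple 'I_m.+1) k : (k <= n)%N ->
  word_mass mu (take k w) * inv_phi w k <= th ^+ k * weight w.
Proof.
move=> kn; have p0 : 0 < p by rewrite subr_gt0.
have /andP[th0 _] := th_range.
rewrite -ler_pdivrMl ?exprn_gt0//.
have -> : (th ^+ k)^-1 * (word_mass mu (take k w) * inv_phi w k) =
  weight_ratio w k by [].
rewrite -[leLHS](powRV_powR (weight_ratio_ge0 w k) p0).
apply: ge0_ler_powR; rewrite ?nnegrE ?invr_ge0 ?powR_ge0 ?(ltW p0)//.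
  by apply: sumr_ge0 => j _; exact: powR_ge0.
have kn' : (k < n.+1)%N by rewrite ltnS.
rewrite (bigD1 (Ordinal kn'))//= lerDl sumr_ge0// => j _.
exact: powR_ge0.
Qed.

Lemma sum_weight_le : \sum_(w : n.-tuple 'I_m.+1) word_mass mu w * weight w `^ p
  <= Sum.
Proof.
have p0 : 0 < p by rewrite subr_gt0.
have /andP[s0 sN] := s_range; have /andP[a0 a1] := a01.
have /andP[th0 th1] := th_range.
under eq_bigr => w _.
  have -> : weight w `^ p = \sum_(k < n.+1) weight_ratio w k `^ p.
    by rewrite /weight powR_powRV// sumr_ge0// => j _; exact: powR_ge0.
  rewrite mulr_sumr; over.
rewrite exchange_big/=; apply: le_trans (level_sums n.+1); apply: ler_sum => k _.
have kn : (k <= n)%N by rewrite -ltnS.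
pose F (u : seq 'I_m.+1) := ((th ^+ k)^-1 *
  (word_mass mu u / phi s (word_map T u))) `^ p.
rewrite (sum_prefix F kn) /level_sum; apply: ler_sum => u _.
have Wu := word_map_unit T_unit u.
have ps := phi_gt0_all Wu s0; have pt := phi_gt0_all Wu (lt_trans s0 s_lt_t).
have mu0 : 0 <= word_mass mu u by exact: mass_of_ge0.
have phi_ts : phi t (word_map T u) <= th ^+ k * phi s (word_map T u).
  have ak : 0 < a ^+ k <= 1 by rewrite exprn_gt0//= exprn_ile1// ltW.
  have := phi_le_phi Wu s_range (ltW s_lt_t) ak _.
  have -> : (a ^+ k) `^ (t - s) = th ^+ k.
    by rewrite -(powR_mulrn _ (ltW a0)) -(powR_mulrn _ (powR_ge0 _ _)) -!powRrM mulrC.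
  apply => x; have := word_map_contr a01 T_contr u x.
  by rewrite size_tuple.
have D0 : 0 < th ^+ k * phi s (word_map T u) by rewrite mulr_gt0// exprn_gt0.
have -> : F u = word_mass mu u `^ p * ((th ^+ k * phi s (word_map T u)) `^ p)^-1.
  rewrite /F -powR_divM//; congr (_ `^ _).
  by rewrite invfM; ring.
rewrite mulrA mulr_powRB1 ?(lt_trans _ q_gt1)// mulrC ler_wpM2r ?powR_ge0//.
rewrite -(opprB q 1) powRN lef_pV2 ?posrE ?powR_gt0//.
by apply: ge0_ler_powR; rewrite ?nnegrE ?(ltW p0) ?(ltW pt) ?(ltW D0).
Qed.

End weights.

(** The constant is independent of the grid.  The leaf hypothesis of
    [expect_ball_moment] holds because [phi s] of a word of length [n] is at most
    [(a ^+ n) `^ s], and [a ^+ n] is at most the smallest radius [r] considered. *)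
Lemma expect_grid_moment : exists2 C, 0 <= C & forall n delta js K r,
  0 < delta -> uniq js -> size js = K.+1 ->
  (forall v : 'cV[R]_N, enorm v <= b -> mesh_index delta v \in js) ->
  0 < r -> a ^+ n <= r -> Num.sqrt N%:R * delta <= r ->
  forall rho, r <= rho ->
  expect (cell_prob omega delta js (K := K)) (fun sg : {ffun n.-bseq 'I_m.+1 -> 'I_K.+1} =>
    \sum_(w : n.-tuple 'I_m.+1) word_mass mu w *
      ball_mass (fun v : n.-tuple _ => word_mass mu v) (@grid_dist _ _ _ T n delta js K) 0 rho sg w `^ p)
    <= C * rho `^ (s * p).
Proof.
have p0 : 0 < p by rewrite subr_gt0.
have /andP[s0 sN] := s_range; have /andP[a0 a1] := a01.
have sN' : 0 < s <= N%:R by rewrite s0 ltW.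
have [k0 k0P] := moment_level p0.
have [C1 C11 C1P] := @ellipsoid_probability R d Om P N nu b s nu_density b_ge1 sN'.
have C10 : 0 <= C1 by apply: le_trans C11.
have Sum0 : 0 <= Sum by have := level_sums 0; rewrite big_ord0.
exists (`|moment_const s C1 th k0 p| * Sum); first by rewrite mulr_ge0.
move=> n delta js K r d0 ujs szjs cov r0 anr dr rho rrho.
pose w0 : n.-tuple 'I_m.+1 := [tuple ord0 | _ < n].
have hg (w : n.-tuple 'I_m.+1) k : 0 < inv_phi w k.
  rewrite invr_gt0; apply: phi_gt0_all => //; exact: word_map_unit.
have hp (v w : n.-tuple 'I_m.+1) k : take k v == take k w ->
    inv_phi v k = inv_phi w k.
  by move=> /eqP vw; rewrite /inv_phi vw.
have dp (sg : {ffun n.-bseq 'I_m.+1 -> 'I_K.+1}) (w v : n.-tuple 'I_m.+1) k rho' :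
    (k < n)%N -> split_at k v w -> r <= rho' ->
    \sum_t' cell_prob omega delta js t' *
      (grid_dist T delta js (update sg (word_index w k) t') w v <= rho')%R%:R
    <= C1 * rho' `^ s * inv_phi w k.
  move=> kn vw rr'.
  have [c cE] := grid_sum_resample T delta js sg w kn.
  have rho'0 : 0 < rho' by exact: lt_le_trans rr'.
  have vE t' := grid_sum_update T delta js sg t' kn vw.
  have := C1P (omega [::]) (word_map T (take k w)) (c - grid_sum T delta js sg v)
    rho' delta js (measurable_funP _) _ _ (word_map_unit T_unit _)
    (word_map_contr1 a01 T_contr _) d0 (le_trans dr rr') rho'0 ujs.
  rewrite -(sum_grid szjs (fun j => mass_of P
    ((fun w => mesh_index delta (omega [::] w)) @^-1` [set j]) *
    (enorm (c - grid_sum T delta js sg v + word_map T (take k w) *m mesh_point delta j)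
      <= rho')%R%:R)).
  move=> H; apply: le_trans (H _ _) => //.
    apply: ler_sum => t' _; rewrite /grid_dist cE vE /cell_prob /grid_point.
    by rewrite addrAC.
  by move=> B mB; rewrite -(omega_law [::] mB).
have gp (w : n.-tuple 'I_m.+1) k : (k < n)%N ->
    prefix_mass (fun v : n.-tuple _ => word_mass mu v) k w * inv_phi w k
      <= th ^+ k * weight w.
  move=> kn; rewrite prefix_word_mass ?(ltnW kn)//.
  by rewrite prefix_le_weight// ltnW.
have gl (w : n.-tuple 'I_m.+1) : word_mass mu w <=
    C1 * r `^ s * (th ^+ n * weight w).
  have := prefix_le_weight w (leqnn n).
  rewrite take_oversize ?size_tuple// /inv_phi take_oversize ?size_tuple//.
  have Wu := word_map_unit T_unit w; have ps := phi_gt0_all Wu s0.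
  rewrite ler_pdivrMr// => /le_trans; apply; rewrite mulrC ler_wpM2r//.
    by rewrite mulr_ge0 ?weight_ge0// exprn_ge0// powR_ge0.
  have an0 : 0 < a ^+ n by rewrite exprn_gt0.
  apply: (@le_trans _ _ ((a ^+ n) `^ s)).
    apply: phi_le => // x; have := word_map_contr a01 T_contr w x.
    by rewrite size_tuple.
  apply: (@le_trans _ _ (r `^ s)); last by rewrite ler_peMl ?powR_ge0.
  by apply: ge0_ler_powR; rewrite ?nnegrE ?(ltW s0) ?(ltW an0) ?(ltW r0).
have [mc0 H] := expect_ball_moment
  (@cell_prob_ge0 _ _ _ _ _ P omega delta js K)
  (cell_prob_sum1 omega_bounded d0 ujs szjs cov)
  (fun w : n.-tuple _ => mass_of_ge0 mu (cylinder w)) (@weight_ge0 n) hg hp (ltW s0) C10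
  th_range r0
  (@grid_dist_triangle _ _ _ T n delta js K)
  (@grid_dist_indep _ _ _ T n delta js K) dp gp gl w0 k0P (leq0n n) rrho.
have E (w : n.-tuple 'I_m.+1) : (take 0 w == take 0 w0) = true by rewrite !take0 eqxx.
have -> : expect (cell_prob omega delta js (K:=K))
  (fun sg : {ffun n.-bseq 'I_m.+1 -> 'I_K.+1} =>
   \sum_(w : n.-tuple 'I_m.+1)
      word_mass mu w *
      ball_mass (fun v : n.-tuple 'I_m.+1 => word_mass mu v)
        (grid_dist T delta js (K:=K)) 0 rho sg w `^ p) =
  expect (cell_prob omega delta js (K:=K))
  (fun sg : {ffun n.-bseq 'I_m.+1 -> 'I_K.+1} =>
   \sum_(w : n.-tuple 'I_m.+1 | take 0 w == take 0 w0)
      word_mass mu w *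
      ball_mass (fun v : n.-tuple 'I_m.+1 => word_mass mu v)
        (grid_dist T delta js (K:=K)) 0 rho sg w `^ p).
  by apply: eq_expect => sg; apply: eq_bigl => w; rewrite E.
apply: le_trans H _; rewrite mulrAC ler_wpM2r ?powR_ge0//.
rewrite ger0_norm// ler_wpM2l//; apply: le_trans (sum_weight_le n).
by rewrite /total (eq_bigl xpredT).
Qed.

End random_moments.

(** * The almost sure lower bound *)

Section almost_sure_bound.
Context {R : realType} {N m : nat}.
Variables (T : 'I_m.+1 -> 'M[R]_N) (a : R).
Hypothesis N_gt0 : (0 < N)%N.
Hypothesis T_unit : forall i, T i \in unitmx.
Hypothesis a01 : 0 < a < 1.
Hypothesis T_contr : forall i x, enorm (T i *m x) <= a * enorm x.
Variable mu : {finite_measure set (borel_code m) -> \bar R}.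
Variables (d : measure_display) (Om : measurableType d) (P : probability Om R).
Variable omega : seq 'I_m.+1 -> {RV P >-> 'cV[R]_N}.
Variable b : R.
Hypothesis b_ge1 : 1 <= b.
Hypothesis omega_bounded : forall i w, enorm (omega i w) <= b.
Hypothesis omega_independent : mutually_independent P omega.
Variable nu : probability 'cV[R]_N R.
Hypothesis omega_law : forall i (A : set 'cV[R]_N), measurable A ->
  distribution P (omega i) A = nu A.
Hypothesis nu_density : has_bounded_density nu.
Variable q : R.
Hypothesis q_gt1 : 1 < q.
Variables s t : R.
Hypothesis s_range : 0 < s < N%:R.
Hypothesis s_lt_t : s < t.
Variable Sum : R.
Hypothesis level_sums : forall n, \sum_(k < n) level_sum T mu q t k <= Sum.

Local Notation p := (q - 1).
Local Notation M w r := (mesh_moment (image_measure T mu (fun i => omega i w)) q r).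

(** Markov's inequality for the moment at radius [c * r], for a grid adapted to
    [r].  The exceptional event does not depend on [r'], because two points in a
    cube of side [r' <= r] have grid approximations within [c * r]. *)
Lemma moment_probability : exists2 C, 0 <= C & forall r lam, 0 < r <= 1 -> 0 < lam ->
  exists E : set Om, [/\ measurable E, (P E <= (C * r `^ (s * p) / lam)%:E)%E &
    forall w, ~ E w -> forall r', 0 < r' <= r -> (M w r' <= lam%:E)%E].
Proof.
have p0 : 0 < p by rewrite subr_gt0.
have /andP[s0 sN] := s_range; have /andP[a0 a1] := a01.
have b0 : 0 <= b by apply: le_trans b_ge1.
have [C C0 CP] := expect_grid_moment T_unit a01 T_contr b_ge1 omega_bounded omega_law
  nu_density q_gt1 s_range s_lt_t level_sums.
(* the diameter of a cube of side [r] plus the error of approximation of two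
   points *)
pose c := Num.sqrt N%:R + 2 * ((b + 1) / (1 - a)).
have a10 : 0 < 1 - a by rewrite subr_gt0.
have sN1 : 1 <= Num.sqrt N%:R :> R by rewrite -[leLHS]sqrtr1 ler_sqrt// ler1n.
have c1 : 1 <= c.
  by rewrite /c (le_trans sN1)// lerDl mulr_ge0// divr_ge0 ?(ltW a10)// addr_ge0.
exists (C * c `^ (s * p)); first by rewrite mulr_ge0 ?powR_ge0.
move=> r lam /andP[r0 r1] lam0.
have [n anr] : exists n, a ^+ n <= r.
  have [n nP] := exp_lt_eventually a01 r0.
  by exists n; rewrite ltW// nP.
pose delta := r / (Num.sqrt N%:R + 1).
have sq0 : 0 < Num.sqrt N%:R + 1 :> R by lra.
have d0 : 0 < delta by rewrite divr_gt0.
have dr : Num.sqrt N%:R * delta <= r.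
  rewrite /delta mulrCA ler_piMr ?(ltW r0)// ler_pdivrMr// mul1r; lra.
have [Kc Kc0 HK] := @cover_image R N.
have b_gt0 : 0 < b by exact: lt_le_trans b_ge1.
have [js0 [_ cov0]] := HK 1%:M 0 b delta (unitmx1 _ _) b_gt0 d0.
pose js := undup js0.
have cov (v : 'cV[R]_N) : enorm v <= b -> mesh_index delta v \in js.
  by move=> vb; rewrite mem_undup; have := cov0 v vb; rewrite mul1mx add0r.
have [K szjs] : exists K, size js = K.+1.
  have : mesh_index delta (0 : 'cV[R]_N) \in js by apply: cov; rewrite enorm0.
  by case: (js) => // j js' _; exists (size js').
have ujs : uniq js by exact: undup_uniq.
have rho : r <= c * r by rewrite ler_peMl// ltW.
have EH := CP n delta js K r d0 ujs szjs cov r0 anr dr (c * r) rho.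
set H := (fun sg => _) in EH.
pose smp : Om -> {ffun n.-bseq 'I_m.+1 -> 'I_K.+1} := sample omega n delta js K.
have msmp sg : measurable (smp @^-1` [set sg]).
  exact: (measurable_sample omega_bounded d0 ujs szjs cov).
pose bad := enum [pred sg | lam < H sg].
pose E := [set w | smp w \in bad].
have mE : measurable E.
  rewrite (_ : E = \bigcup_(k in [set` bad]) smp @^-1` [set k]).
    by apply: fin_bigcup_measurable => //; exact: finite_seq.
  apply/seteqP; split => x /=; first by move=> xt; exists (smp x).
  by move=> [k /= kt]; rewrite /E/= => ->.
have H0 sg : 0 <= H sg.
  by apply: sumr_ge0 => w _; rewrite mulr_ge0 ?powR_ge0 ?mass_of_ge0.
exists E; split => //.
  have -> : P E = (mass_of P E)%:E by exact: (mass_ofE P mE).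
  rewrite lee_fin.
  have -> : mass_of P E = \sum_(sg | lam < H sg) \prod_x cell_prob omega delta js (sg x).
    have -> : E = setT `&` [set w | smp w \in bad] by rewrite setTI.
    rewrite -(mass_of_fibers P msmp measurableT (enum_uniq _)) big_enum/=.
    apply: eq_bigr => sg _; rewrite setTI.
    exact: (mass_of_sample omega_bounded omega_independent omega_law d0 ujs szjs cov).
  rewrite ler_pdivlMr// mulr_suml -mulrA -powRM ?(ltW r0) ?(le_trans ler01 c1)//.
  apply: le_trans EH; rewrite /expect [leLHS]big_mkcond; apply: ler_sum => sg _.
  have wt0 : 0 <= \prod_x cell_prob omega delta js (sg x).
    by apply: prodr_ge0 => x _; exact: cell_prob_ge0.
  case: ifPn => [/ltW lH|_]; first by rewrite ler_wpM2l.
  by rewrite mulr_ge0.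
move=> w Ew r' /andP[r'0 r'r].
have Hlam : H (smp w) <= lam.
  by rewrite leNgt; apply/negP => lH; apply: Ew; rewrite /E/= mem_enum inE.
pose near (i j : n.-tuple 'I_m.+1) := grid_dist T delta js (smp w) i j <= c * r.
have := @mesh_moment_le R _ _ mu N (projection T (fun i => omega i w)) r' q
  (measurable_projection a01 T_contr b0 (omega_bounded ^~ w)) r'0 q_gt1 _
  (fun x => prefix_tuple x n) near (@measurable_prefix_fiber _ _) _.
move=> /(_ _)/le_trans; apply; last first.
  rewrite lee_fin; apply: le_trans Hlam; rewrite /H le_eqVlt; apply/orP; left.
  apply/eqP; apply: eq_bigr => v _; rewrite prefix_tuple_fiber; congr (_ * _ `^ _).
  rewrite /ball_mass; apply: eq_big => [u|u _]; last by rewrite prefix_tuple_fiber.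
  by rewrite !take0 eqxx.
move=> x y xy; rewrite /near /grid_dist.
pose eps := (a ^+ n * b + Num.sqrt N%:R * delta) / (1 - a).
have nx := projection_grid T_unit a01 T_contr b_ge1 omega_bounded n d0 szjs cov w x.
have ny := projection_grid T_unit a01 T_contr b_ge1 omega_bounded n d0 szjs cov w y.
rewrite -/eps in nx ny.
have epsr : eps <= (b + 1) / (1 - a) * r.
  rewrite /eps mulrAC ler_wpM2r ?invr_ge0 ?(ltW a10)// mulrDl mul1r lerD//.
  by rewrite mulrC ler_wpM2l.
set gx := grid_sum _ _ _ _ _ in nx *; set gy := grid_sum _ _ _ _ _ in ny *.
set px := projection _ _ x in nx xy; set py := projection _ _ y in ny xy.
have -> : gx - gy = (gx - px) + ((px - py) + (py - gy)).
  by rewrite (addrA (px - py)) subrK addrA subrK.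
apply: le_trans (enormD _ _) _; rewrite enormB.
have := enormD (px - py) (py - gy).
have : Num.sqrt N%:R * r' <= Num.sqrt N%:R * r by rewrite ler_wpM2l.
rewrite /c mulrDl -(mulrA 2); lra.
Qed.

(** Two intermediate exponents are lost: between [s] and [s1] for the
    probabilities of the exceptional events to be summable over the dyadic radii,
    and between [s1] and [s'] to pass from the dyadic radii to all radii. *)
Lemma ae_lower_dim_ge s' : 0 < s' < s ->
  {ae P, forall w, (s'%:E <= lower_dim (image_measure T mu (fun i => omega i w)) q)%E}.
Proof.
move=> /andP[s'0 s's].
have p0 : 0 < p by rewrite subr_gt0.
have [C C0 CP] := moment_probability.
pose s1 := (s + s') / 2.
have s1s : s1 < s by rewrite /s1; lra.
have s's1 : s' < s1 by rewrite /s1; lra.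
pose r n : R := (2^-1) ^+ n.
have half0 : 0 < 2^-1 :> R by rewrite invr_gt0.
have half1 : 2^-1 < 1 :> R by rewrite invf_lt1// ltr1n.
have r0 n : 0 < r n by rewrite exprn_gt0.
have r1 n : r n <= 1 by rewrite exprn_ile1// ltW.
have /choice[E EP] : forall n, exists E : set Om, [/\ measurable E,
    (P E <= (C * r n `^ (s * p) / (r n `^ (s1 * p)))%:E)%E &
    forall w, ~ E w -> forall r', 0 < r' <= r n -> (M w r' <= (r n `^ (s1 * p))%:E)%E].
  by move=> n; apply: CP; rewrite ?powR_gt0// r0 r1.
have mE n : measurable (E n) by have [] := EP n.
have PE0 : P (lim_sup_set E) = 0%E.
  apply: lim_sup_set_cvg0 => //.
  pose g : R := (2^-1) `^ ((s - s1) * p).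
  have e0 : 0 < (s - s1) * p by rewrite mulr_gt0// subr_gt0.
  have PEn n : P (E n) = (mass_of P (E n))%:E by exact: (mass_ofE P (mE n)).
  rewrite (eq_eseriesr (fun n _ => PEn n)).
  apply: (@nneseries_geometric_lty _ _ C g 0) => //.
  - by move=> k; exact: mass_of_ge0.
  - rewrite /g powR_gt0//=; have := @gt0_ltr_powR R _ e0 (2^-1) 1.
    by rewrite powR1 !nnegrE; apply => //; exact: ltW.
  - move=> k _; have [_ + _] := EP k; rewrite PEn lee_fin => /le_trans; apply.
    rewrite -mulrA ler_wpM2l// -powRB; last by rewrite (gt_eqF (r0 k)) implybT.
    rewrite /r /g -(powR_mulrn _ (ltW half0)) -(powR_mulrn _ (powR_ge0 _ _)) -!powRrM.
    by rewrite le_eqVlt; apply/orP; left; apply/eqP; congr (_ `^ _); ring.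
exists (lim_sup_set E); split => //.
  apply: bigcap_measurable => // k _; apply: bigcup_measurable => j _; exact: mE.
move=> w; apply: contra_notP => /= nE.
have [n0 n0P] : exists n0, forall n, (n0 <= n)%N -> ~ E n w.
  apply: contrapT => H; apply: nE => n _ /=.
  apply: contrapT => nn; apply: H; exists n => k nk Ek; apply: nn.
  by exists k.
pose e := (s1 - s') * p.
have e0 : 0 < e by rewrite mulr_gt0// subr_gt0.
(* below this scale the factor 2 between a radius and its dyadic scale is
   absorbed by the difference of the exponents *)
pose x : R := (2 `^ (s1 * p))^-1 `^ e^-1.
have D0 : 0 < (2 `^ (s1 * p))^-1 :> R by rewrite invr_gt0 powR_gt0.
have x0 : 0 < x by rewrite powR_gt0.
apply: (@lower_dim_ge _ _ _ _ _ (Num.min (r n0 / 2) x)) => //.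
  by rewrite lt_min x0 divr_gt0.
move=> r' /andP[r'0]; rewrite lt_min => /andP[r'r r'x].
have r'1 : r' <= 1 by have := r1 n0; lra.
have [|n /andP[nr nr']] := @dyadic_scale R r'; first by rewrite r'0.
have nn0 : (n0 <= n)%N.
  rewrite leqNgt; apply/negP => nn0.
  have : r n0 <= r n.+1 by rewrite /r ler_wiXn2l// ltW.
  by rewrite {2}/r exprSr -/(r n); move: nr (r0 n); rewrite -/(r n); lra.
have [_ _ EnP] := EP n.
apply: le_trans (EnP w (n0P n nn0) r' _) _; first by rewrite r'0.
rewrite lee_fin; apply: (@le_trans _ _ ((2 * r') `^ (s1 * p))).
  apply: ge0_ler_powR; rewrite ?nnegrE ?(ltW (r0 n))//.
  - by rewrite mulr_ge0 ?(ltW p0)// (le_trans (ltW s'0)) ?(ltW s's1).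
  - by rewrite mulr_ge0// ltW.
  - by move: nr; rewrite -/(r n); lra.
rewrite powRM ?(ltW r'0)//.
have -> : r' `^ (s1 * p) = r' `^ e * r' `^ (s' * p).
  rewrite -powRD; last by rewrite (gt_eqF r'0) implybT.
  by congr (_ `^ _); rewrite /e; ring.
rewrite mulrA ler_piMl ?powR_ge0//.
rewrite -ler_pdivlMl ?powR_gt0// mulr1.
rewrite -[leRHS](powR_powRV (ltW D0) e0).
by apply: ge0_ler_powR; rewrite ?nnegrE ?(ltW e0) ?(ltW r'0) ?(ltW x0) ?(ltW r'x).
Qed.

End almost_sure_bound.

(** * The dimension formula *)

Lemma partial_sums_le (R : realType) (u : nat -> R) : (forall k, 0 <= u k) ->
  (\sum_(0 <= k <oo) (u k)%:E < +oo)%E ->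
  exists S, forall n, \sum_(k < n) u k <= S.
Proof.
move=> u0 uoo; exists (fine (\sum_(0 <= k <oo) (u k)%:E)%E) => n.
have ge0 : (0 <= \sum_(0 <= k <oo) (u k)%:E)%E.
  by apply: nneseries_ge0 => k _ _; rewrite lee_fin.
rewrite -lee_fin fineK ?ge0_fin_numE// -sumEFin -(big_mkord xpredT (fun k => (u k)%:E)).
by apply: nneseries_lim_ge => k _ _; rewrite lee_fin.
Qed.

Theorem theorem8p1 (R : realType) (N m : nat) (N_gt0 : (0 < N)%N)
    (T : 'I_m.+1 -> 'M[R]_N)
    (T_nonsingular : forall i, T i \in unitmx)
    (T_contracting : forall i, opnorm (T i) < 1)
    (mu : {finite_measure set (borel_code m) -> \bar R})
    (mu_nonzero : mu setT <> 0%E)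
    (D : set 'cV[R]_N) (D_bounded : bounded_set D)
    (d : measure_display) (Om : measurableType d) (P : probability Om R)
    (omega : seq 'I_m.+1 -> {RV P >-> 'cV[R]_N})
    (omega_in_D : forall i w, D (omega i w))
    (omega_independent : mutually_independent P omega)
    (nu : probability 'cV[R]_N R)
    (omega_law : forall i (A : set 'cV[R]_N), measurable A ->
      distribution P (omega i) A = nu A)
    (nu_density : has_bounded_density nu)
    (q : R) (q_gt1 : 1 < q) :
  {ae P, forall w,
    lower_dim (image_measure T mu (fun i => omega i w)) q =
    mine (d_minus T mu q) N%:R%:E}.
Proof.
have [a a01 T_contr] := common_contraction_ratio T_contracting.
have [b b_ge1 om_bounded] : exists2 b : R, 1 <= b &
    forall i w, enorm (omega i w) <= b.
  have [M [_ HM]] := D_bounded.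
  pose M1 := `|M| + 1.
  have MM1 : M < M1 by rewrite /M1 ltr_pwDr// ler_norm.
  have sM1 : 0 <= Num.sqrt N%:R * M1 by rewrite mulr_ge0// addr_ge0.
  exists (Num.sqrt N%:R * M1 + 1); first by rewrite lerDr.
  move=> i w; apply: le_trans (enorm_le_mx_norm _) _.
  rewrite (@le_trans _ _ (Num.sqrt N%:R * M1))//; last by rewrite lerDl.
  by rewrite ler_wpM2l//; apply: HM => //; exact: omega_in_D.
have b_ge0 : 0 <= b by apply: le_trans b_ge1.
have upper w := lower_dim_le_min T_nonsingular a01 T_contr b_ge0
  (om_bounded ^~ w) q_gt1 mu_nonzero.
have nonneg w := lower_dim_ge0 a01 T_contr mu b_ge0 (om_bounded ^~ w) q_gt1.
have L_ge0 : (0 <= mine (d_minus T mu q) N%:R%:E)%E.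
  by rewrite le_min lee_fin ler0n andbT /d_minus le_max lexx.
have L_le_N : (mine (d_minus T mu q) N%:R%:E <= N%:R%:E)%E.
  by rewrite ge_min lexx orbT.
have L_le_d : (mine (d_minus T mu q) N%:R%:E <= d_minus T mu q)%E.
  by rewrite ge_min lexx.
move: (mine _ _) L_ge0 L_le_N L_le_d upper => [l| |]//.
rewrite !lee_fin => l_ge0 l_le_N l_le_d upper.
(* a vanishing dimension is attained without any randomness *)
move: l_ge0; rewrite le_eqVlt => /predU1P[l0|l_gt0].
  by apply: aeW => w; apply/eqP; rewrite eq_le upper -l0 nonneg.
(* exponents that increase to [l], one almost sure event for each *)
pose s' (k : nat) := l - l / k.+2%:R.
have s'0 k : 0 < s' k.
  by rewrite /s' subr_gt0 ltr_pdivrMr// ltr_pMr// ltr1n.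
have s'l k : s' k < l by rewrite /s' ltrBlDr ltrDl divr_gt0.
have lower k : {ae P, forall w,
    ((s' k)%:E <= lower_dim (image_measure T mu (fun i => omega i w)) q)%E}.
  pose s := (s' k + l) / 2.
  have sl : s < l by have := s'l k; rewrite /s; lra.
  have s's : s' k < s by have := s'l k; rewrite /s; lra.
  have s0 : 0 < s by exact: lt_trans s's.
  have [t s_lt_t tfin] : exists2 t, s < t &
      (\sum_(0 <= k <oo) (level_sum T mu q t k)%:E < +oo)%E.
    have : (s%:E < d_minus T mu q)%E by rewrite (lt_le_trans _ l_le_d)// lte_fin.
    rewrite d_minusE lt_max => /orP[|/ereal_sup_gt[_ [t [_ tfin] <-]]].
      by rewrite lte_fin => /lt_trans/(_ s0); rewrite ltxx.
    by rewrite lte_fin => st; exists t.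
  have [S HS] := partial_sums_le (level_sum_ge0 T mu q t) tfin.
  apply: (ae_lower_dim_ge N_gt0 T_nonsingular a01 T_contr b_ge1 om_bounded
    omega_independent omega_law nu_density q_gt1 _ s_lt_t HS).
  - by rewrite s0 (lt_le_trans sl).
  - by rewrite s'0 s's.
have := ae_foralln lower; apply: filterS => w H.
apply/eqP; rewrite eq_le upper/=; apply/lee_addgt0Pr => e e0.
have [k lk] : exists k : nat, l / k.+2%:R <= e.
  exists (Num.truncn (l / e)); rewrite ler_pdivrMr// mulrC -ler_pdivrMr//.
  by rewrite (le_trans (ltW (truncnS_gt _)))// ler_nat.
apply: (@le_trans _ _ ((s' k)%:E + e%:E)%E); last by rewrite leeD2r.
by rewrite -EFinD lee_fin /s' -addrA lerDl addrC subr_ge0.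
Qed.
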